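(* Let $m,n$ be positive integers with $n\ge 2m$, and let $B_1\subset\mathbb{R}^n$ be the open unit ball. Let $u\in C^{2m}(B_1\setminus\{0\})$ solve \[ (-\Delta)^m u=f(x)\quad\text{in }B_1\setminus\{0\}, \] where $f$ satisfies $\int_{B_1\setminus\{0\}}|x|^{s}|f(x)|\,dx<+\infty$ for some integer $0\le s\le 2m-1$. If $\int_{B_1\setminus\{0\}}u^{+}(x)\,dx<+\infty$, where $u^{+}=\max\{u,0\}$, then there exist constants $a_\beta\in\mathbb{R}$ for multi-indices $|\beta|\le 2m-1$ and a function $h\in C^\infty(B_1)$ with $(-\Delta)^m h=0$ in $B_1$ such that \[ u(x)=N(x)+h(x)+\sum_{|\beta|\le 2m-1}a_\beta D^\beta\phi(x)\quad\text{for }x\in B_1\setminus\{0\}, \] where $\phi$ and $N$ are defined below.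
   Context: The fundamental solution of $(-\Delta)^m$ in $\mathbb{R}^n$ is $\phi(x)=c\,|x|^{2m-n}$ if $n>2m$ and $\phi(x)=c\ln\frac{5}{|x|}$ if $n=2m$, with $c=c(m,n)>0$ the normalizing constant making $(-\Delta)^m\phi=\delta_0$. For $x\ne0$, $y\ne x$, set \[ \psi(x,y)=\phi(x-y)-\sum_{|\beta|\le s-1}\frac{(-y)^\beta}{\beta!}D^\beta\phi(x) \] (the sum is absent when $s=0$), and $N(x)=\int_{\{|y|\le1\}}\psi(x,y)f(y)\,dy$ for $x\ne0$. Multi-index notation: $y^\beta=y_1^{\beta_1}\cdots y_n^{\beta_n}$, $\beta!=\beta_1!\cdots\beta_n!$. *)

(* Defs.v *)
From HB Require Import structures.
From mathcomp Require Import all_boot all_order all_algebra.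
From mathcomp Require Import all_classical all_reals all_analysis.
Set Implicit Arguments. Unset Strict Implicit. Unset Printing Implicit Defensive.
Import Order.TTheory GRing.Theory Num.Theory.
Import numFieldNormedType.Exports.
Local Open Scope classical_set_scope.
Local Open Scope ring_scope.

Section Defs.
Variable R : realType.

(* Euclidean norm |x| on R^n (the library's norm on 'rV is the max norm). *)
Definition enorm n (x : 'rV[R]_n) : R := Num.sqrt (\sum_i x 0 i ^+ 2).

Definition ball1 n : set 'rV[R]_n := [set x | enorm x < 1].
Definition pball1 n : set 'rV[R]_n := [set x | enorm x < 1 /\ x != 0].
Arguments ball1 n _ : clear implicits.
Arguments pball1 n _ : clear implicits.

Definition evec n (i : 'I_n) : 'rV[R]_n := \row_j (i == j)%:R.
Definition partial n (i : 'I_n) (g : 'rV[R]_n -> R) : 'rV[R]_n -> R :=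
  fun x => 'D_(evec i) g x.

Definition Dseq n (s : seq 'I_n) (g : 'rV[R]_n -> R) : 'rV[R]_n -> R :=
  foldr (@partial n) g s.

Definition Ck n (k : nat) (O : set 'rV[R]_n) (g : 'rV[R]_n -> R) : Prop :=
  forall (s : seq 'I_n), (size s <= k)%N -> forall x, O x ->
    {for x, continuous (Dseq s g)} /\
    ((size s < k)%N -> forall i : 'I_n, derivable (Dseq s g) x (evec i)).

Definition Cinf n (O : set 'rV[R]_n) (g : 'rV[R]_n -> R) : Prop :=
  forall k, Ck k O g.

Definition Dmulti n (beta : 'I_n -> nat) (g : 'rV[R]_n -> R) : 'rV[R]_n -> R :=
  Dseq (flatten [seq nseq (beta i) i | i <- enum 'I_n]) g.

Definition mabs n (beta : 'I_n -> nat) : nat := (\sum_i beta i)%N.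

Definition lap n (g : 'rV[R]_n -> R) : 'rV[R]_n -> R :=
  fun x => \sum_i partial i (partial i g) x.
Definition mlapm n (m : nat) (g : 'rV[R]_n -> R) : 'rV[R]_n -> R :=
  iter m (fun h x => - lap h x) g.
Arguments mlapm n m g : clear implicits.

(* Lebesgue integral over R^n of a nonnegative (extended) function, built as
   an iterated one-dimensional Lebesgue integral (Tonelli). *)
Fixpoint iint (n : nat) : ('rV[R]_n -> \bar R) -> \bar R :=
  match n return ('rV[R]_n -> \bar R) -> \bar R with
  | 0 => fun g => g 0
  | k.+1 => fun g =>
      (\int[@lebesgue_measure R]_t
         iint (fun v : 'rV[R]_k => g (row_mx (const_mx t : 'rV[R]_1) v)))%E
  end.

Definition Rint n (F : 'rV[R]_n -> R) : R :=
  fine (iint (fun x => (Num.max (F x) 0)%:E)) -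
  fine (iint (fun x => (Num.max (- F x) 0)%:E)).

Definition fundsol (m n : nat) (c : R) (x : 'rV[R]_n) : R :=
  if (2 * m < n)%N then c * (enorm x ^+ (n - 2 * m))^-1
  else c * ln (5 / enorm x).
Arguments fundsol m n c x : clear implicits.

(* c is the normalizing constant: (-Delta)^m phi = delta_0 in the sense of
   distributions, i.e. <phi, (-Delta)^m psi> = psi(0) for every test function. *)
Definition test_fun n (psi : 'rV[R]_n -> R) : Prop :=
  Cinf setT psi /\ exists r : R, forall x, r < enorm x -> psi x = 0.

Definition normalizing_const (m n : nat) (c : R) : Prop :=
  0 < c /\ forall psi : 'rV[R]_n -> R, test_fun psi ->
    Rint (fun x => fundsol m n c x * mlapm n m psi x) = psi 0.
Arguments normalizing_const m n c : clear implicits.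

Definition mono_fact n (beta : 'I_n -> nat) (y : 'rV[R]_n) : R :=
  (\prod_i (- y 0 i) ^+ beta i) / (\prod_i (beta i)`!)%:R.

Definition psi_kernel (m n s : nat) (c : R) (x y : 'rV[R]_n) : R :=
  fundsol m n c (x - y) -
  \sum_(beta : {ffun 'I_n -> 'I_s} | (mabs (fun i => nat_of_ord (beta i)) < s)%N)
     mono_fact (fun i => nat_of_ord (beta i)) y *
     Dmulti (fun i => nat_of_ord (beta i)) (fundsol m n c) x.
Arguments psi_kernel m n s c x y : clear implicits.

(* N(x) = int_{|y| <= 1} psi(x,y) f(y) dy ; the null set {|y| = 1} u {0} u {x}
   is removed from the domain of integration. *)
Definition Npot (m n s : nat) (c : R) (f : 'rV[R]_n -> R) (x : 'rV[R]_n) : R :=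
  Rint (fun y => if `[< pball1 n y /\ y != x >] then psi_kernel m n s c x y * f y
                 else 0).
Arguments Npot m n s c f x : clear implicits.

End Defs.
Arguments ball1 {R} n _.
Arguments pball1 {R} n _.
Arguments fundsol {R} m n c x.
Arguments mlapm {R} n m g _.
Arguments normalizing_const {R} m n c.
Arguments psi_kernel {R} m n s c x y.
Arguments Npot {R} m n s c f x.

(* Main.v *)
(** Step 1: [u] is integrable near the origin.  With [t = |x|^2], the test
    functions [w = t^m (1 + lam ln t)_+^k] vanish near [0] and satisfy
    [Delta^m w = sum_i a_i lam^i (1 + lam ln t)_+^(k-i)] with [a_i >= 0] and
    [a_0 > 0].  Since [|w| <= |x|^(2m) <= |x|^s], testing the equation with [w]
    (cut off away from [0]) bounds the integral of [u^- (1 + lam ln t)_+^k] by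
    those of [|x|^s |f|] and [u^+]; Fatou's lemma with [lam -> 0] concludes.

    Step 2: for cutoffs [xi_d] near [0] and [eta_r] near the unit sphere,
    the function [u eta_r (1 - xi_d)] is [C^(2m)] with compact support, so it is
    the convolution of [phi] with
    [(-Delta)^m (u eta_r (1 - xi_d)) = f (1 - xi_d) + C_d + O_r], where [C_d]
    lives on the shell [d <= |y| <= 2 d] and [O_r] on [|y| >= r].  The
    convolution with [O_r] is smooth and polyharmonic in [|x| < r].  Replacing
    [phi (x - y)] by its Taylor polynomial in [y] plus remainder, of order [s]
    against [f (1 - xi_d)] and of order [2 m] against [C_d], the first remainder
    tends to [N x] by dominated convergence, and the second tends to [0]:
    integrating by parts back onto [u], it is at most a constant times the
    integral of [|u|] over [|y| <= 4 d].

    Step 3: what remains is a combination of the [D^beta phi], with coefficients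
    depending on [d] but neither on [x] nor on [r], which converges pointwise as
    [d -> 0]; a pointwise limit of elements of a finite-dimensional space of
    functions stays in that space. *)
Require Import Defs.
From HB Require Import structures.
From mathcomp Require Import all_boot all_order all_algebra.
From mathcomp Require Import all_classical all_reals all_analysis.
From mathcomp Require Import measurable_realfun.
From mathcomp Require Import ring lra zify.
Set Implicit Arguments. Unset Strict Implicit. Unset Printing Implicit Defensive.
Import Order.TTheory GRing.Theory Num.Theory.
Import numFieldNormedType.Exports.
Local Open Scope classical_set_scope.
Local Open Scope ring_scope.

(** * Lebesgue measure on row vectors *)


Section BorelRow.
Variable R : realType.

(** The integral of the statement is iterated and one-dimensional at each stage, so a measure [mu n]
    on row vectors is built whose integral of nonnegative Borel functions is [iint]; convergence
    theorems and translation invariance then apply.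

    The normalisation of [c] speaks of smooth test functions, whereas the representation is needed
    for functions that are only [C^(2m)]. No mollification is used: for a function vanishing at the
    origin, [phi] is cut off at scale [d] and integration by parts leaves an error of order
    [d (1 + |ln d|)]; a single fixed bump then supplies the value at the origin.

    The order [2 m] against [C_d] is forced by what is known of [u]: only its integral near the
    origin is controlled, so all derivatives must fall on the Taylor remainder, and vanishing to
    order [2 m] is exactly what offsets the factor [d^(-2m)] produced by cutoffs at scale [d].

    No pointwise bound on [u] or [f] holds near the unit sphere, so the regular part is obtained
    only on balls of radius [r < 1]. Since the other terms do not see [r], these local pieces agree
    and glue to one function on the ball. *)

Definition rVm n := g_sigma_algebraType (@open 'rV[R]_n).

Lemma open_measurable_rV n (U : set 'rV[R]_n) :
  open U -> measurable (U : set (rVm n)).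
Proof. by move=> oU; exact: sub_sigma_algebra. Qed.

Lemma closed_measurable_rV n (U : set 'rV[R]_n) :
  closed U -> measurable (U : set (rVm n)).
Proof.
move=> cU; rewrite -(setCK U); apply: measurableC.
by apply: open_measurable_rV; exact: closed_openC.
Qed.

Lemma mx_norm_coord_lt n (v : 'rV[R]_n) (e : R) :
  0 < e -> (forall i, `|v 0 i| < e) -> `|v| < e.
Proof.
move=> e0 h; rewrite [X in X < _]/Num.Def.normr /= mx_normrE; apply/bigmax_ltP; split => //.
by move=> [i j] _ /=; rewrite (ord1 i).
Qed.

Lemma mx_norm_coord_le n (v : 'rV[R]_n) (e : R) :
  0 <= e -> (forall i, `|v 0 i| <= e) -> `|v| <= e.
Proof.
move=> e0 h; rewrite [X in X <= _]/Num.Def.normr /= mx_normrE; apply/bigmax_leP; split => //.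
by move=> [i j] _ /=; rewrite (ord1 i).
Qed.

Lemma coord_le_mx_norm n (v : 'rV[R]_n) i : `|v 0 i| <= `|v|.
Proof.
rewrite [X in _ <= X]/Num.Def.normr /= mx_normrE.
by apply/bigmax_geP; right => /=; exists (0, i).
Qed.

Lemma continuous_rVP (V : normedModType R) k (h : 'rV[R]_k -> V) (x : 'rV[R]_k) :
  {for x, continuous h} <->
  (forall e : R, 0 < e -> exists2 d : R, 0 < d &
     forall y : 'rV[R]_k, `|x - y| < d -> `|h x - h y| < e).
Proof.
have FF : Filter (nbhs x) by exact: nbhs_filter.
split.
  move=> ch e e0.
  have := iffLR (@cvgrPdist_lt R V _ (nbhs x) FF h (h x)) ch e e0.
  by move=> /nbhs_ballP[d /= d0]; rewrite mx_norm_ball => H; exists d.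
move=> H; apply: (iffRL (@cvgrPdist_lt R V _ (nbhs x) FF h (h x))) => e e0.
by have [d d0 hd] := H e e0; apply/nbhs_ballP; exists d => //= y;
  rewrite mx_norm_ball; exact: hd.
Qed.

(** Same [row_mx] expression as in [iint], so that the two match by conversion. *)
Definition rcons1 k (p : R * 'rV[R]_k) : 'rV[R]_k.+1 :=
  row_mx (const_mx p.1 : 'rV[R]_1) p.2.

Lemma rcons1l k (p : R * 'rV[R]_k) (j : 'I_1) : rcons1 p 0 (@lshift 1 k j) = p.1.
Proof. by have := row_mxEl (const_mx p.1 : 'rV[R]_1) p.2 0 j; rewrite [RHS]mxE. Qed.

Lemma rcons1r k (p : R * 'rV[R]_k) j : rcons1 p 0 (@rshift 1 k j) = p.2 0 j.
Proof. exact: (row_mxEr (const_mx p.1 : 'rV[R]_1)). Qed.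

Lemma rcons1_norm k (p : R * 'rV[R]_k) (e : R) :
  0 < e -> (`|rcons1 p| < e) <-> (`|p.1| < e /\ `|p.2| < e).
Proof.
move=> e0; split => [h|[h1 h2]].
  split.
    apply: le_lt_trans h.
    have := coord_le_mx_norm (rcons1 p) (@lshift 1 k 0).
    by rewrite rcons1l.
  apply: mx_norm_coord_lt => // i; apply: le_lt_trans h.
  have := coord_le_mx_norm (rcons1 p) (rshift 1 i).
  by rewrite rcons1r.
apply: mx_norm_coord_lt => // i; rewrite -[i](@splitK 1 k) /=.
case: (@fintype.split 1 k i) => j /=; first by rewrite rcons1l.
by rewrite rcons1r; apply: le_lt_trans h2; exact: coord_le_mx_norm.
Qed.

Lemma rcons1B k (p q : R * 'rV[R]_k) : rcons1 p - rcons1 q = rcons1 (p - q).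
Proof.
by apply/rowP => i; rewrite !mxE; case: fintype.split => j; rewrite !mxE.
Qed.

Lemma rat_approx (x e : R) : 0 < e -> exists q : rat, `|x - ratr q| < e.
Proof.
move=> e0; have [q] := @rat_in_itvoo R (x - e) (x + e) (ltac:(lra)).
by rewrite in_itv/= => /andP[h1 h2]; exists q; rewrite ltr_norml; lra.
Qed.

(** The Borel sets of the target are generated by open sets, and the preimage of an open set is the
    union of the rational boxes that it contains. These boxes are countably many measurable
    rectangles, hence measurable for the product. *)
Lemma measurable_rcons1 k :
  measurable_fun setT (@rcons1 k : (measurableTypeR R * rVm k)%type -> rVm k.+1).
Proof.
apply: (@measurability _ _ (measurableTypeR R * rVm k)%type (rVm k.+1) setT (@rcons1 k) (@open 'rV[R]_k.+1)) => //.
move=> _ [U oU <-]; rewrite setTI.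
pose I : countType := (rat * 'rV[rat]_k * nat)%type.
pose box (i : I) : set (measurableTypeR R * rVm k)%type :=
  (ball (ratr i.1.1 : R) (i.2.+1%:R^-1)) `*`
  (ball (map_mx ratr i.1.2 : 'rV[R]_k) (i.2.+1%:R^-1)).
have -> : (@rcons1 k @^-1` U) =
   \bigcup_(i in [set i | box i `<=` @rcons1 k @^-1` U]) box i.
  apply/seteqP; split => [p Up|p [i sub]]; last by apply: sub.
  have /nbhs_ballP[e /= e0 eU] : nbhs (rcons1 p) U by apply: open_nbhs_nbhs.
  (* A point of the box and the given point are both within [1 / (j + 1)] of the rational centre,
     hence the factor 2. *)
  have [j je] : exists j : nat, 2 * (j.+1%:R^-1) < e.
    have [j j1] := @ltr_add_invr R 0 (e/2) (ltac:(lra)).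
    by exists j; move: j1; set z := _^-1 => j1; lra.
  set d := j.+1%:R^-1 in je.
  have d0 : 0 < d by rewrite invr_gt0.
  have [a ap] := rat_approx p.1 d0.
  have [w wp] : exists w : 'rV[rat]_k, forall i, `|p.2 0 i - ratr (w 0 i)| < d.
    have /choice[w wp] : forall i, exists q : rat, `|p.2 0 i - ratr q| < d.
      by move=> i; exact: rat_approx.
    by exists (\row_i w i) => i; rewrite mxE.
  exists (a, w, j) => /=; last first.
    split => /=; first by rewrite /ball/= distrC.
    rewrite -[ball _ _ _]/(ball (map_mx ratr w : 'rV[R]_k) d p.2).
    rewrite mx_norm_ball /ball_ /= distrC; apply: mx_norm_coord_lt => // i.
    by rewrite !mxE.
  move=> q [/=]; rewrite -/d; clearbody d => q1 q2; apply: eU; rewrite mx_norm_ball /ball_ /=.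
  rewrite rcons1B; apply/rcons1_norm => //; split => /=.
    move: q1; rewrite /ball /= => q1.
    rewrite (_ : p.1 - q.1 = (p.1 - ratr a) + (ratr a - q.1)); last by ring.
    by apply: le_lt_trans (ler_normD _ _) _; move: ap je q1; lra.
  move: q2; rewrite mx_norm_ball /ball_/= => q2.
  apply: mx_norm_coord_lt => // i.
  have := coord_le_mx_norm (map_mx ratr w - q.2) i; rewrite !mxE => h.
  have := wp i => h'.
  rewrite (_ : p.2 0 i - q.2 0 i = (p.2 0 i - ratr (w 0 i)) + (ratr (w 0 i) - q.2 0 i)); last by ring.
  apply: le_lt_trans (ler_normD _ _) _.
  by move: (le_lt_trans h q2) => h''; move: h' h''; lra.
rewrite bigcup_mkcond; apply: countable_bigcupT_measurable; first exact: countableP.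
move=> i; case: ifP => // _; apply: measurableX.
  by apply: open_measurable; apply: ball_open; rewrite invr_gt0.
by apply: open_measurable_rV; apply: ball_open; rewrite invr_gt0.
Qed.

Lemma continuous_measurable_rV k l (h : 'rV[R]_k -> 'rV[R]_l) :
  continuous h -> measurable_fun setT (h : rVm k -> rVm l).
Proof.
move=> ch; apply: (@measurability _ _ (rVm k) (rVm l) setT h (@open 'rV[R]_l)) => //.
move=> _ [U oU <-]; rewrite setTI; apply: open_measurable_rV.
by apply: open_comp => // x _; exact: ch.
Qed.

Lemma open_measurable_fun_rV k (h : 'rV[R]_k -> R) (O : set 'rV[R]_k) :
  open O -> (forall x, O x -> {for x, continuous h}) ->
  measurable_fun (O : set (rVm k)) (h : rVm k -> R).
Proof.
move=> oO ch.
apply: (@measurability _ _ (rVm k) (measurableTypeR R) O h _ (RGenOInfty.measurableE R)).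
move=> _ [_ [a ->] <-]; apply: open_measurable_rV.
rewrite openE => y [Oy hy]; apply: filterI; first exact: open_nbhs_nbhs.
apply: (ch y Oy); apply: open_nbhs_nbhs; split => //; exact: interval_open.
Qed.

Section Step.
Variables (k : nat) (nu : {sigma_finite_measure set (rVm k) -> \bar R}).

(** The image of a product measure under [rcons1]; Tonelli then turns its integral into one more
    level of the iterated integral. *)
Definition muS_ (A : set (rVm k.+1)) : \bar R :=
  (@lebesgue_measure R \x nu)%E (@rcons1 k @^-1` A).

Let preS (A : set (rVm k.+1)) : measurable A ->
  measurable (@rcons1 k @^-1` A : set (measurableTypeR R * rVm k)%type).
Proof. by move=> mA; rewrite -[X in measurable X]setTI; exact: measurable_rcons1. Qed.

Let muS0 : muS_ set0 = 0%E.
Proof. by rewrite /muS_ preimage_set0 measure0. Qed.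

Let muS_ge0 A : (0 <= muS_ A)%E.
Proof. exact: measure_ge0. Qed.

Let muS_sigma_additive : semi_sigma_additive muS_.
Proof.
move=> F mF tF mUF; rewrite /muS_ preimage_bigcup.
apply: measure_semi_sigma_additive.
- by move=> n; exact: preS.
- apply/trivIsetP => /= i j _ _ ij; rewrite -preimage_setI.
  by move/trivIsetP : tF => /(_ _ _ _ _ ij) ->//; rewrite preimage_set0.
- by rewrite -preimage_bigcup; exact: preS.
Qed.

HB.instance Definition _ := isMeasure.Build _ _ _ muS_ muS0 muS_ge0 muS_sigma_additive.

Definition tail1 (v : 'rV[R]_k.+1) : 'rV[R]_k := \row_i v 0 (@rshift 1 k i).

Lemma rcons1_tail1 (p : R * 'rV[R]_k) : tail1 (rcons1 p) = p.2.
Proof. by apply/rowP => i; rewrite mxE rcons1r. Qed.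

Lemma continuous_tail1 : continuous tail1.
Proof.
move=> v; apply/continuous_rVP => e e0; exists e => // w vw.
apply: mx_norm_coord_lt => // i; rewrite !mxE; apply: le_lt_trans vw.
by have := coord_le_mx_norm (v - w) (@rshift 1 k i); rewrite !mxE.
Qed.

(** Needed for Tonelli in the next dimension. The space is covered by the sets where the first
    coordinate is below [j] in absolute value and the tail lies in the [j]-th set of an exhaustion
    for [nu]. *)
Lemma muS_sigma_finite : sigma_finite setT muS_.
Proof.
have /sigma_finiteP[G [TG ndG Goo]] := sigma_finiteT nu.
exists (fun j => [set v : 'rV[R]_k.+1 | `|v 0 (@lshift 1 k 0)| < j%:R]
   `&` [set v | G j (tail1 v)]).
  apply/seteqP; split => // v _.
  have [j _ Gj] : (\bigcup_i G i) (tail1 v) by rewrite -TG.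
  pose N := maxn j (Num.truncn `|v 0 (@lshift 1 k 0)|).+1.
  exists N => //; split => /=.
    apply: lt_le_trans (truncnS_gt _) _.
    by rewrite ler_nat leq_maxr.
  by move: (tail1 v) Gj; exact/subsetPset/ndG/leq_maxl.
move=> j; have [mG fG] := Goo j; split.
  apply: measurableI.
    apply: open_measurable_rV.
    apply: (@open_comp _ _ (fun v : 'rV[R]_k.+1 => `|v 0 (@lshift 1 k 0)|) [set y | y < j%:R]).
      move=> v _; apply: continuous_comp; first exact: coord_continuous.
      exact: norm_continuous.
    exact: open_lt.
  have /(_ measurableT _ mG) := @continuous_measurable_rV _ _ tail1 continuous_tail1.
  by rewrite setTI.
rewrite /muS_ /=.
rewrite (_ : _ @^-1` _ = [set t | `|t| < j%:R] `*` G j); last first.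
  by apply/seteqP; split => p /= []; rewrite ?rcons1l rcons1_tail1.
have -> : [set t : R | `|t| < j%:R] = `](- j%:R), j%:R[%classic.
  by apply/seteqP; split => t /=; rewrite in_itv/= ltr_norml.
rewrite product_measure1E//; apply: lte_mul_pinfty => //.
by rewrite /= lebesgue_measure_itv/=; case: ifP.
Qed.

HB.instance Definition _ := Measure_isSigmaFinite.Build _ _ _ muS_ muS_sigma_finite.

Definition muS : {sigma_finite_measure set (rVm k.+1) -> \bar R} := muS_.

Lemma measurable_comp_rcons1 (g : 'rV[R]_k.+1 -> \bar R) :
  measurable_fun setT (g : rVm k.+1 -> \bar R) ->
  measurable_fun setT (g \o @rcons1 k : (measurableTypeR R * rVm k)%type -> \bar R).
Proof.
move=> mg _ A mA; rewrite setTI.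
by have := mg measurableT A mA; rewrite setTI; exact: preS.
Qed.

Lemma integral_muS (g : 'rV[R]_k.+1 -> \bar R) :
  measurable_fun setT (g : rVm k.+1 -> \bar R) -> (forall x, 0 <= g x)%E ->
  (\int[muS]_x g x = \int[@lebesgue_measure R]_t \int[nu]_v g (rcons1 (t, v)))%E.
Proof.
move=> mg g0.
have := @ge0_integral_pushforward _ _ (measurableTypeR R * rVm k)%type (rVm k.+1) R
  (@rcons1 k) (@measurable_rcons1 k) (@lebesgue_measure R \x nu)%E setT g measurableT mg.
rewrite preimage_setT => /(_ (fun y _ => g0 y)).
rewrite (_ : pushforward _ _ = muS_)// => ->.
rewrite fubini_tonelli1//; last by move=> x; exact: g0.
exact: measurable_comp_rcons1.
Qed.

Lemma measurable_integral_muS (g : 'rV[R]_k.+1 -> \bar R) :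
  measurable_fun setT (g : rVm k.+1 -> \bar R) -> (forall x, 0 <= g x)%E ->
  measurable_fun setT (fun t : R => \int[nu]_v g (rcons1 (t, v)))%E.
Proof.
move=> mg g0.
apply: (@measurable_fun_fubini_tonelli_F _ _ (measurableTypeR R) (rVm k) R nu (g \o @rcons1 k)) => //; last by move=> x; exact: g0.
exact: measurable_comp_rcons1.
Qed.

Lemma measurable_section (g : 'rV[R]_k.+1 -> \bar R) t :
  measurable_fun setT (g : rVm k.+1 -> \bar R) ->
  measurable_fun setT (fun v : rVm k => g (rcons1 (t, v))).
Proof.
move=> mg; have mr : measurable_fun setT ((fun v => rcons1 (t, v)) : rVm k -> rVm k.+1).
  apply: continuous_measurable_rV => v; apply/continuous_rVP => e e0.
  exists e => // w vw; rewrite rcons1B; apply/rcons1_norm => //=; split => //.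
  by rewrite subrr normr0.
move=> _ A mA; rewrite setTI; have := mg measurableT A mA; rewrite setTI => h.
by have := mr measurableT _ h; rewrite setTI.
Qed.

End Step.

(** Dimension 0 is a single point, where [iint] evaluates; hence the Dirac mass. *)
Fixpoint mu n : {sigma_finite_measure set (rVm n) -> \bar R} :=
  match n return {sigma_finite_measure set (rVm n) -> \bar R} with
  | 0 => @dirac _ (rVm 0) (0 : 'rV[R]_0) R
  | k.+1 => muS (mu k)
  end.

Lemma iint_mu n (g : 'rV[R]_n -> \bar R) :
  measurable_fun setT (g : rVm n -> \bar R) -> (forall x, 0 <= g x)%E ->
  iint g = (\int[mu n]_x g x)%E.
Proof.
elim: n g => [|n IH] g mg g0 /=.
  by rewrite integral_dirac// diracE in_setT mul1e.
rewrite integral_muS//; apply: eq_integral => t _.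
by rewrite IH//; exact: measurable_section.
Qed.

End BorelRow.

(** * Integrable functions *)


Section IntegralAPI.
Variable R : realType.
Implicit Type n : nat.

Definition meas n (g : 'rV[R]_n -> R) : Prop :=
  measurable_fun setT (g : rVm R n -> R).
Definition L1 n (g : 'rV[R]_n -> R) : Prop :=
  (mu R n).-integrable setT (EFin \o (g : rVm R n -> R)).
(** Meaningful only together with [L1], since [fine] sends infinite values to 0. *)
Definition Int n (g : 'rV[R]_n -> R) : R :=
  fine (\int[mu R n]_x (g x)%:E)%E.

Lemma meas_continuous n (g : 'rV[R]_n -> R) : continuous g -> meas g.
Proof.
by move=> cg; apply: (@open_measurable_fun_rV R n g setT) => // [|x _];
  [exact: openT|exact: cg].
Qed.

Lemma meas_cst n (c : R) : meas (fun _ : 'rV[R]_n => c).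
Proof. exact: measurable_cst. Qed.

Lemma meas_asbool n (A : set 'rV[R]_n) : measurable (A : set (rVm R n)) ->
  measurable_fun setT ((fun x => `[< A x >]) : rVm R n -> bool).
Proof.
move=> mA; apply: (@measurable_fun_bool _ (rVm R n) setT _ true).
rewrite setTI (_ : _ @^-1` _ = A)//.
by apply/seteqP; split => x /=; [move=> /asboolP|move=> ?; apply/asboolP].
Qed.

Lemma meas_if_set n (g h : 'rV[R]_n -> R) (A : set 'rV[R]_n) :
  measurable (A : set (rVm R n)) ->
  measurable_fun (A : set (rVm R n)) (g : rVm R n -> R) -> meas h ->
  meas (fun x => if `[< A x >] then g x else h x).
Proof.
move=> mA mg mh; apply: measurable_fun_if => //; first exact: meas_asbool.
  apply: measurable_funS mg => // x [_] /= h'.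
  by apply/asboolP; rewrite h'.
by apply: measurable_funS mh.
Qed.

Lemma meas_if_open n (g : 'rV[R]_n -> R) (O : set 'rV[R]_n) :
  open O -> (forall x, O x -> {for x, continuous g}) ->
  meas (fun x => if `[< O x >] then g x else 0).
Proof.
move=> oO cg; apply: meas_if_set; first exact: open_measurable_rV.
  exact: open_measurable_fun_rV.
exact: meas_cst.
Qed.

Lemma measM n (g h : 'rV[R]_n -> R) : meas g -> meas h -> meas (fun x => g x * h x).
Proof. exact: measurable_funM. Qed.

Lemma measB n (g h : 'rV[R]_n -> R) : meas g -> meas h -> meas (fun x => g x - h x).
Proof. exact: measurable_funB. Qed.

Lemma measN n (g : 'rV[R]_n -> R) : meas g -> meas (fun x => - g x).
Proof. by move=> mg; exact: (measurableT_comp (@oppr_measurable R setT)). Qed.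

Lemma meas_abs n (g : 'rV[R]_n -> R) : meas g -> meas (fun x => `|g x|).
Proof. by move=> mg; exact: (measurableT_comp (@normr_measurable R setT)). Qed.

Lemma meas_max n (g h : 'rV[R]_n -> R) :
  meas g -> meas h -> meas (fun x => Num.max (g x) (h x)).
Proof. exact: measurable_maxr. Qed.

Lemma L1_meas n (g : 'rV[R]_n -> R) : L1 g -> meas g.
Proof. by move=> /measurable_int/measurable_EFinP. Qed.

Lemma L1_le n (g h : 'rV[R]_n -> R) :
  meas g -> L1 h -> (forall x, `|g x| <= h x) -> L1 g.
Proof.
move=> mg ih gh; apply: (le_integrable measurableT _ _ ih) => //.
  exact/measurable_EFinP.
by move=> x _ /=; rewrite lee_fin (le_trans (gh x))// ler_norm.
Qed.

Lemma L1D n (g h : 'rV[R]_n -> R) : L1 g -> L1 h -> L1 (fun x => g x + h x).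
Proof. by move=> ig ih; have := integrableD measurableT ig ih. Qed.

Lemma L1B n (g h : 'rV[R]_n -> R) : L1 g -> L1 h -> L1 (fun x => g x - h x).
Proof. by move=> ig ih; have := integrableB measurableT ig ih. Qed.

Lemma L1N n (g : 'rV[R]_n -> R) : L1 g -> L1 (fun x => - g x).
Proof. by move=> ig; have := integrableN ig. Qed.

Lemma L1Z n (k : R) (g : 'rV[R]_n -> R) : L1 g -> L1 (fun x => k * g x).
Proof. by move=> ig; have := integrableZl measurableT k ig. Qed.

Lemma L1_abs n (g : 'rV[R]_n -> R) : L1 g -> L1 (fun x => `|g x|).
Proof. by move=> ig; have := integrable_abse ig. Qed.

Lemma L1_0 n : L1 (fun _ : 'rV[R]_n => 0).
Proof. exact: integrable0. Qed.

Lemma L1_ext n (g h : 'rV[R]_n -> R) : g =1 h -> L1 g -> L1 h.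
Proof. by move=> /funext ->. Qed.

Lemma L1_sum n (I : Type) (r : seq I) (P : pred I) (g : I -> 'rV[R]_n -> R) :
  (forall i, L1 (g i)) -> L1 (fun x => \sum_(i <- r | P i) g i x).
Proof.
move=> ig; elim: r => [|a r IH].
  by apply: L1_ext (@L1_0 n) => x; rewrite big_nil.
case Pa: (P a); last by apply: L1_ext IH => x; rewrite big_cons Pa.
by apply: L1_ext (L1D (ig a) IH) => x; rewrite big_cons Pa.
Qed.

Lemma L1_bounded n (g h : 'rV[R]_n -> R) M :
  meas g -> (forall x, `|g x| <= M) -> L1 h -> L1 (fun x => g x * h x).
Proof.
move=> mg gM ih; apply: (@L1_le _ _ (fun x => M * `|h x|)).
- by apply: measM => //; exact: L1_meas.
- exact/L1Z/L1_abs.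
- by move=> x; rewrite normrM ler_wpM2r.
Qed.

Lemma Int_E n (g : 'rV[R]_n -> R) : L1 g -> (\int[mu R n]_x (g x)%:E)%E = (Int g)%:E.
Proof. by move=> ig; rewrite /Int fineK//; exact: (integrable_fin_num measurableT ig). Qed.

Lemma eq_Int n (g h : 'rV[R]_n -> R) : g =1 h -> Int g = Int h.
Proof. by move=> /funext ->. Qed.

Lemma IntD n (g h : 'rV[R]_n -> R) : L1 g -> L1 h ->
  Int (fun x => g x + h x) = Int g + Int h.
Proof.
move=> ig ih; apply: EFin_inj; rewrite EFinD -!Int_E//; last exact: L1D.
by rewrite -integralD_EFin.
Qed.

Lemma IntZ n k (g : 'rV[R]_n -> R) : L1 g -> Int (fun x => k * g x) = k * Int g.
Proof.
move=> ig; apply: EFin_inj; rewrite EFinM -!Int_E//; last exact: L1Z.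
by rewrite -integralZl.
Qed.

Lemma IntN n (g : 'rV[R]_n -> R) : L1 g -> Int (fun x => - g x) = - Int g.
Proof.
move=> ig; rewrite -mulN1r -IntZ//; apply: eq_Int => x; by rewrite mulN1r.
Qed.

Lemma IntB n (g h : 'rV[R]_n -> R) : L1 g -> L1 h ->
  Int (fun x => g x - h x) = Int g - Int h.
Proof. by move=> ig ih; rewrite IntD ?IntN//; exact: L1N. Qed.

Lemma Int0 n : Int (fun _ : 'rV[R]_n => 0) = 0.
Proof. by rewrite /Int integral0. Qed.

Lemma Int_sum n (I : Type) (r : seq I) (P : pred I) (g : I -> 'rV[R]_n -> R) :
  (forall i, L1 (g i)) ->
  Int (fun x => \sum_(i <- r | P i) g i x) = \sum_(i <- r | P i) Int (g i).
Proof.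
move=> ig; elim: r => [|a r IH].
  by rewrite big_nil -[RHS](Int0 n); apply: eq_Int => x; rewrite big_nil.
rewrite big_cons; case: ifP => Pa.
  rewrite -IH -IntD//; last exact: L1_sum.
  by apply: eq_Int => x; rewrite big_cons Pa.
by rewrite -IH; apply: eq_Int => x; rewrite big_cons Pa.
Qed.

Lemma Int_le n (g h : 'rV[R]_n -> R) : L1 g -> L1 h ->
  (forall x, g x <= h x) -> Int g <= Int h.
Proof.
move=> ig ih gh; rewrite -lee_fin -!Int_E//; apply: le_integral => //.
by move=> x _; rewrite lee_fin.
Qed.

Lemma Int_ge0 n (g : 'rV[R]_n -> R) : (forall x, 0 <= g x) -> 0 <= Int g.
Proof. by move=> g0; apply: fine_ge0; apply: integral_ge0 => x _; rewrite lee_fin. Qed.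

Lemma Int_abs n (g : 'rV[R]_n -> R) : L1 g -> `|Int g| <= Int (fun x => `|g x|).
Proof.
move=> ig; rewrite ler_norml -IntN//; last exact: L1_abs.
rewrite !Int_le//; try exact: L1_abs; try exact/L1N/L1_abs.
  by move=> x; rewrite ler_norm.
by move=> x; rewrite lerNl -normrN ler_norm.
Qed.

Lemma Int_cvg n (g_ : nat -> 'rV[R]_n -> R) (g h : 'rV[R]_n -> R) :
  (forall j, meas (g_ j)) -> L1 h -> (forall j x, `|g_ j x| <= h x) ->
  (forall x, (g_ ^~ x) @ \oo --> g x) ->
  L1 g /\ (fun j => Int (g_ j)) @ \oo --> Int g.
Proof.
move=> mg ih gh gg.
have := @dominated_convergence _ (rVm R n) R (mu R n) setT measurableT
  (fun j => EFin \o g_ j) (EFin \o g) (EFin \o h).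
case.
- by move=> j; apply/measurable_EFinP; exact: mg.
- apply/measurable_EFinP; apply: (measurable_fun_cvg (fun j => mg j)) => x _.
  exact: gg.
- by apply: aeW => x _; apply: cvg_EFin; [exact: nearW|exact: gg].
- exact: ih.
- by apply: aeW => x j _ /=; rewrite lee_fin.
move=> ig _ cv; split => //.
by move: cv; rewrite (Int_E ig) => /fine_cvg.
Qed.

Lemma L1_ge0 n (g : 'rV[R]_n -> R) : meas g -> (forall x, 0 <= g x) ->
  (\int[mu R n]_x (g x)%:E < +oo)%E -> L1 g.
Proof.
move=> mg g0 fg; apply/integrableP; split; first exact/measurable_EFinP.
by under eq_integral do rewrite gee0_abs ?lee_fin//.
Qed.

Lemma cvgn_ge (v : nat -> R) l a : v @ \oo --> l -> (forall j, a <= v j) -> a <= l.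
Proof.
move=> vl va; rewrite -(cvg_lim (@Rhausdorff R) vl).
by apply: limr_ge; [apply/cvg_ex; exists l|exact: nearW].
Qed.

(** Serves where the limit is not yet known to be integrable: for the singular kernel [sing] and for
    the negative part of [u]. *)
Lemma L1_fatou n (g_ : nat -> 'rV[R]_n -> R) (g : 'rV[R]_n -> R) C :
  (forall j, L1 (g_ j)) -> (forall j x, 0 <= g_ j x) ->
  (forall j, Int (g_ j) <= C) ->
  (forall x, (g_ ^~ x) @ \oo --> g x) -> meas g -> L1 g.
Proof.
move=> ig g0 gC gg mg.
have gg0 x : 0 <= g x.
  by apply: (cvgn_ge (gg x)).
apply: L1_ge0 => //.
have mE j : measurable_fun setT (EFin \o (g_ j : rVm R n -> R)).
  by apply/measurable_EFinP; exact: L1_meas (ig j).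
have g0E j (x : rVm R n) : setT x -> (0 <= (EFin \o g_ j) x)%E.
  by move=> _ /=; rewrite lee_fin.
have := fatou (mu R n) measurableT mE g0E.
rewrite (@eq_integral _ (rVm R n) R (mu R n) setT (fun x : rVm R n => (g x)%:E)); last first.
  move=> x _.
  have cx : (fun j => (EFin \o g_ j) x) @ \oo --> (g x)%:E.
    by apply: cvg_EFin; [exact: nearW|exact: gg].
  rewrite is_cvg_limn_einfE; first exact/cvg_lim.
  by apply/cvg_ex; exists (g x)%:E.
move=> /le_lt_trans; apply; rewrite limn_einf_lim.
apply: (@le_lt_trans _ _ C%:E) (ltry _).
apply: lime_le; first exact: is_cvg_einfs.
apply: nearW => j; apply: (@le_trans _ _ (Int (g_ j))%:E); last by rewrite lee_fin.
by rewrite -Int_E//; apply: ereal_inf_lbound; exists j => /=.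
Qed.


Lemma iint_L1 n (g : 'rV[R]_n -> R) : meas g -> (forall x, 0 <= g x) ->
  (iint (fun x => (g x)%:E) < +oo)%E -> L1 g.
Proof.
move=> mg g0; rewrite iint_mu//; first exact: L1_ge0.
exact/measurable_EFinP.
Qed.

Lemma maxr_posneg (a : R) : a = Num.max a 0 - Num.max (- a) 0.
Proof.
by case: (leP 0 a) => h; [rewrite max_r ?oppr_le0// subr0|rewrite max_l ?oppr_ge0 ?ltW// opprK add0r].
Qed.

Lemma maxr0_le (a : R) : `|Num.max a 0| <= `|a|.
Proof. by case: (leP 0 a) => h //; rewrite normr0. Qed.

Lemma Rint_Int n (g : 'rV[R]_n -> R) : L1 g -> Defs.Rint g = Int g.
Proof.
move=> ig; have mg := L1_meas ig; have mg0 := @meas_cst n 0.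
rewrite /Defs.Rint !iint_mu; last first.
- by move=> x; rewrite lee_fin le_max lexx orbT.
- by apply/measurable_EFinP; exact: (meas_max mg mg0).
- by move=> x; rewrite lee_fin le_max lexx orbT.
- by apply/measurable_EFinP; exact: (meas_max (measN mg) mg0).
rewrite -/(Int _) -/(Int _) -IntB.
- by apply: eq_Int => x; rewrite -maxr_posneg.
- apply: L1_le (L1_abs ig) _; first exact: meas_max.
  by move=> x; exact: maxr0_le.
- apply: L1_le (L1_abs ig) _; first exact: (meas_max (measN mg)).
  by move=> x; rewrite -[leRHS]normrN; exact: maxr0_le.
Qed.

End IntegralAPI.


(** * Translation invariance and volumes of cubes *)

Section TranslationBoxes.
Variable R : realType.
Implicit Type n : nat.

(** The image of Lebesgue measure under the translation gives every half-open interval its length,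
    so it is Lebesgue measure by uniqueness. *)
Lemma lebesgue_translate (a : R) (g : R -> \bar R) :
  measurable_fun setT g -> (forall t, 0 <= g t)%E ->
  (\int[@lebesgue_measure R]_t g (t + a)%R = \int[@lebesgue_measure R]_t g t)%E.
Proof.
move=> mg g0.
have mT : measurable_fun setT ((fun t => t + a) : measurableTypeR R -> measurableTypeR R).
  by apply: measurable_funD => //; exact: measurable_cst.
have := @ge0_integral_pushforward _ _ (measurableTypeR R) (measurableTypeR R) R
  (fun t => t + a) mT (@lebesgue_measure R) setT g measurableT mg.
rewrite preimage_setT => /(_ (fun y _ => g0 y)) <-.
apply: eq_measure_integral => A mA _.
pose nu := measure_function_pushforward__canonical__measure_function_Measure
  (@lebesgue_measure R) mT.
rewrite /=; apply/esym.
apply: (@lebesgue_measure_unique R nu) => // _ [[b c] _ <-].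
rewrite /nu /= /pushforward.
rewrite (_ : _ @^-1` _ = `](b - a), (c - a)]%classic).
  by rewrite !lebesgue_measure_itv/= !lte_fin ltrD2r; case: ifP => // _;
    rewrite -!EFinB; congr EFin; ring.
by apply/seteqP; split => t /=; rewrite !in_itv/= ltrBlDr lerBrDr.
Qed.

Lemma rcons1_split n (a : 'rV[R]_n.+1) :
  exists p, a = rcons1 p.
Proof.
exists (a 0 (@lshift 1 n 0), \row_i a 0 (@rshift 1 n i)).
apply/rowP => i; rewrite -[i](@splitK 1 n).
by case: (@fintype.split 1 n i) => j; rewrite ?rcons1l ?rcons1r ?mxE// (ord1 j).
Qed.

Lemma rcons1D k (p q : R * 'rV[R]_k) : rcons1 p + rcons1 q = rcons1 (p + q).
Proof.
by apply/rowP => i; rewrite !mxE; case: fintype.split => j; rewrite !mxE.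
Qed.

Lemma iint_translate n (a : 'rV[R]_n) (g : 'rV[R]_n -> \bar R) :
  measurable_fun setT (g : rVm R n -> \bar R) -> (forall x, 0 <= g x)%E ->
  iint (fun x => g (x + a)) = iint g.
Proof.
elim: n a g => [|n IH] a g mg g0; first by rewrite /= add0r thinmx0.
have [[a0 a1] ->] := rcons1_split a.
rewrite -[LHS]/(\int[@lebesgue_measure R]_t iint (fun v => g (rcons1 (t, v) + rcons1 (a0, a1))%R))%E.
rewrite -[RHS]/(\int[@lebesgue_measure R]_t iint (fun v => g (rcons1 (t, v))))%E.
rewrite -[RHS](lebesgue_translate a0); last 2 first.
- rewrite (_ : (fun t => _) = (fun t => \int[mu R n]_v g (rcons1 (t, v))))%E.
    exact: measurable_integral_muS.
  by apply/funext => t; rewrite iint_mu//; exact: measurable_section.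
- move=> t; rewrite iint_mu//; last exact: measurable_section.
  by apply: integral_ge0 => v _.
apply: eq_integral => t _.
rewrite -[RHS](IH a1)//; last exact: measurable_section.
by congr iint; apply/funext => v; rewrite rcons1D.
Qed.

Lemma meas_translate n (a : 'rV[R]_n) (g : 'rV[R]_n -> R) :
  meas g -> meas (fun x => g (x + a)).
Proof.
move=> mg _ A mA; rewrite setTI.
have := mg measurableT A mA; rewrite setTI => h.
have mr : measurable_fun setT ((fun v => v + a) : rVm R n -> rVm R n).
  apply: continuous_measurable_rV => v; apply/continuous_rVP => e e0.
  by exists e => // w vw; rewrite opprD addrACA subrr addr0.
by have := mr measurableT _ h; rewrite setTI.
Qed.

Lemma ge0_translate n (a : 'rV[R]_n) (g : 'rV[R]_n -> R) :
  meas g -> (forall x, 0 <= g x) ->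
  (\int[mu R n]_x (g (x + a)%R)%:E = \int[mu R n]_x (g x)%:E)%E.
Proof.
move=> mg g0; rewrite -!iint_mu//.
- by rewrite (iint_translate a (g := fun x => (g x)%:E))//; exact/measurable_EFinP.
- exact/measurable_EFinP.
- by apply/measurable_EFinP; exact: meas_translate.
- by move=> x; rewrite lee_fin.
Qed.

Lemma L1_translate n (a : 'rV[R]_n) (g : 'rV[R]_n -> R) :
  L1 g -> L1 (fun x => g (x + a)).
Proof.
move=> ig; have mg := L1_meas ig.
have mga := meas_translate a mg.
have i2 : L1 (fun x => `|g (x + a)|).
  apply: L1_ge0 => //; first exact: meas_abs.
  rewrite (@ge0_translate _ a (fun x => `|g x|))//; last exact: meas_abs.
  by rewrite Int_E ?ltry//; exact: L1_abs.
by apply: (L1_le mga i2).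
Qed.

Lemma Int_translate n (a : 'rV[R]_n) (g : 'rV[R]_n -> R) :
  L1 g -> Int (fun x => g (x + a)) = Int g.
Proof.
move=> ig; have iga := L1_translate a ig.
pose p (g : 'rV[R]_n -> R) x := Num.max (g x) 0.
have ip h : L1 h -> L1 (p h).
  move=> ih; apply: L1_le (L1_abs ih) _; first by apply: meas_max; [exact: L1_meas|exact: meas_cst].
  by move=> x; exact: maxr0_le.
have key h : L1 h -> Int (fun x => p h (x + a)) = Int (p h).
  move=> ih; rewrite /Int ge0_translate//; first exact: L1_meas (ip _ ih).
  by move=> x; rewrite /p le_max lexx orbT.
have pE h x : h x = p h x - p (fun x => - h x) x.
  exact: maxr_posneg.
have ig' := ip _ ig; have ign := ip _ (L1N ig).
have -> : Int g = Int (p g) - Int (p (fun x => - g x)).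
  by rewrite -IntB//; apply: eq_Int => x; exact: pE.
rewrite -(key g)// -(key (fun x => - g x)); last exact: L1N.
rewrite -IntB; [|exact: L1_translate|exact: L1_translate].
by apply: eq_Int => x; exact: pE.
Qed.

(** Cubes of the max norm rather than Euclidean balls: their volume is the explicit [(2 * M) ^+ n],
    and every volume estimate below goes through it. *)
Definition boxi n (M : R) (y : 'rV[R]_n) : R := if `|y| <= M then 1 else 0.

Lemma boxi_out n (M : R) (y : 'rV[R]_n) : M < `|y| -> boxi M y = 0.
Proof. by move=> h; rewrite /boxi (leNgt `|y| M) h. Qed.

Lemma boxi_in n (M : R) (y : 'rV[R]_n) : `|y| <= M -> boxi M y = 1.
Proof. by move=> h; rewrite /boxi h. Qed.

Lemma boxi_ge0 n (M : R) (y : 'rV[R]_n) : 0 <= boxi M y.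
Proof. by rewrite /boxi; case: ifP. Qed.

Lemma meas_boxi n M : meas (@boxi n M).
Proof.
rewrite (_ : @boxi n M = fun x => if `[< [set y | `|y| <= M] x >] then 1 else 0).
  apply: meas_if_set; try exact: meas_cst; last exact: measurable_cst.
  apply: closed_measurable_rV.
  apply: (@closed_comp _ _ (fun y : 'rV[R]_n => `|y|) [set t | t <= M]).
    by move=> v _; exact: norm_continuous.
  exact: closed_le.
by apply/funext => x; rewrite /boxi; case: asboolP => /= h; [rewrite h|move/negP/negbTE: h => ->].
Qed.

Lemma rcons1_norm_le k (p : R * 'rV[R]_k) (e : R) :
  0 <= e -> (`|rcons1 p| <= e) = (`|p.1| <= e) && (`|p.2| <= e).
Proof.
move=> e0; apply/idP/andP => [h|[h1 h2]].
  split.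
    apply: le_trans h.
    by have := coord_le_mx_norm (rcons1 p) (@lshift 1 k 0); rewrite rcons1l.
  apply: mx_norm_coord_le => // i; apply: le_trans h.
  by have := coord_le_mx_norm (rcons1 p) (@rshift 1 k i); rewrite rcons1r.
apply: mx_norm_coord_le => // i; rewrite -[i](@splitK 1 k) /=.
case: (@fintype.split 1 k i) => j /=; first by rewrite rcons1l.
by rewrite rcons1r; apply: le_trans h2; exact: coord_le_mx_norm.
Qed.

Lemma integral_boxi n M : 0 <= M ->
  (\int[mu R n]_x (boxi M x)%:E = ((2 * M) ^+ n)%:E)%E.
Proof.
move=> M0; elim: n => [|n IH].
  rewrite integral_dirac//; last by apply/measurable_EFinP; exact: meas_boxi.
  rewrite diracE in_setT mul1e /boxi (_ : `|_| = 0) ?M0//.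
  exact: normr0.
rewrite /= integral_muS; last 2 first.
- by apply/measurable_EFinP; exact: meas_boxi.
- by move=> x; rewrite lee_fin /boxi; case: ifP.
transitivity (\int[@lebesgue_measure R]_t ((\1_(`[-M, M]%classic) t)%:E * ((2 * M) ^+ n)%:E))%E.
  apply: eq_integral => t _.
  rewrite -IH indicE mem_setE in_itv /=.
  have -> : (-M <= t <= M) = (`|t| <= M) by rewrite ler_norml.
  case: (boolP (`|t| <= M)) => tM.
    rewrite mul1e; apply: eq_integral => v _.
    by rewrite /boxi rcons1_norm_le//= tM.
  rewrite mul0e; apply: integral0_eq => v _.
  by rewrite /boxi rcons1_norm_le//= (negbTE tM).
rewrite ge0_integralZr//; last 2 first.
- by apply/measurable_EFinP; exact: measurable_indic.
- by rewrite lee_fin exprn_ge0// mulr_ge0.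
rewrite integral_indic// setIT/= lebesgue_measure_itv/= lte_fin.
rewrite -EFinB; case: ifP => h.
  by rewrite exprS -EFinM; congr EFin; congr (_ * _); lra.
rewrite mul0e exprS (_ : 2 * M = 0) ?mul0r//.
by move/negbT: h; rewrite -leNgt; lra.
Qed.

Lemma L1_boxi n M : 0 <= M -> L1 (@boxi n M).
Proof.
move=> M0; apply: L1_ge0; first exact: meas_boxi.
  by move=> x; rewrite /boxi; case: ifP.
by rewrite integral_boxi// ltry.
Qed.

Lemma Int_boxi n M : 0 <= M -> Int (@boxi n M) = (2 * M) ^+ n.
Proof. by move=> M0; rewrite /Int integral_boxi. Qed.

Lemma L1_bounded_supp n (g : 'rV[R]_n -> R) C M : 0 <= M ->
  meas g -> (forall x, `|g x| <= C) -> (forall x, M < `|x| -> g x = 0) -> L1 g.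
Proof.
move=> M0 mg gC gM; apply: (L1_le mg (L1Z C (@L1_boxi n M M0))) => x.
rewrite /boxi; case: (leP `|x| M) => h; first by rewrite mulr1.
by rewrite gM// normr0 mulr0.
Qed.

End TranslationBoxes.

(** * Functions of class C^k *)


(* [pd] is [partial], locked: otherwise comparing two derivatives up to conversion unfolds limits. *)
HB.lock Definition pd (R : realType) n (i : 'I_n) (g : 'rV[R]_n -> R) : 'rV[R]_n -> R :=
  partial i g.

Lemma pdE (R : realType) n (i : 'I_n) (g : 'rV[R]_n -> R) : pd i g = partial i g.
Proof. by rewrite pd.unlock. Qed.

Definition Dsq (R : realType) n (s : seq 'I_n) (g : 'rV[R]_n -> R) : 'rV[R]_n -> R :=
  foldr (@pd R n) g s.

Lemma DsqE (R : realType) n (s : seq 'I_n) (g : 'rV[R]_n -> R) : Dsq s g = Dseq s g.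
Proof. by elim: s => //= i s ->; rewrite pdE. Qed.

Section Calculus.
Variable R : realType.
Implicit Types (n k : nat).

(** Reduces directional derivatives to derivatives of one real variable along a line. *)
Lemma line_derive n (v x : 'rV[R]_n) (g : 'rV[R]_n -> R) (t d : R) :
  is_derive (t *: v + x) v g d <->
  is_derive t 1 (fun h : R => g (h *: v + x)) d.
Proof.
have E : (fun h : R => h^-1 *: ((g \o shift (t *: v + x)) (h *: v) - g (t *: v + x))) =
    (fun h : R => h^-1 *: (((fun h : R => g (h *: v + x)) \o shift t) (h *: 1) -
      (fun h : R => g (h *: v + x)) t)).
  by apply/funext => h /=; rewrite scalerDl addrA [_%:A]mulr1.
split=> -[].
  by rewrite /derivable /derive E => h1 h2; apply: DeriveDef.
by rewrite /derivable /derive -E => h1 h2; apply: DeriveDef.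
Qed.

Lemma line_derive0 n (v x : 'rV[R]_n) (g : 'rV[R]_n -> R) (d : R) :
  is_derive x v g d <-> is_derive (0 : R) 1 (fun h : R => g (h *: v + x)) d.
Proof. by rewrite -line_derive scale0r add0r. Qed.

Lemma is_derive_comp1 n (v x : 'rV[R]_n) (g : 'rV[R]_n -> R) (F : R -> R) (d e : R) :
  is_derive x v g d -> is_derive (g x) 1 F e ->
  is_derive x v (fun y => F (g y)) (e * d).
Proof.
move=> /line_derive0 hg hF; apply/line_derive0.
apply: (@is_derive1_comp _ F (fun h => g (h *: v + x))) => //.
by rewrite scale0r add0r.
Qed.

Lemma is_derive_affine n (v x b : 'rV[R]_n) (g : 'rV[R]_n -> R) (a d : R) :
  is_derive (a *: x + b) v g d ->
  is_derive x v (fun y => g (a *: y + b)) (d * a).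
Proof.
move=> /line_derive0 hg; apply/line_derive0.
rewrite (_ : (fun h => _) = (fun h => g (h *: v + (a *: x + b))) \o (fun h => h * a)); last first.
  by apply/funext => h /=; rewrite scalerDr addrA scalerA mulrC.
apply: is_derive1_comp; first by rewrite mul0r.
rewrite -[X in is_derive _ _ _ X]mulr1.
have -> : (fun h => h * a) = a *: (id : R -> R) by apply/funext => h; rewrite /= mulrC.
exact: is_deriveZ.
Qed.

Lemma pd_is_derive n (i : 'I_n) (g : 'rV[R]_n -> R) x :
  derivable g x (evec R i) -> is_derive x (evec R i) g (pd i g x).
Proof. by rewrite pdE; exact: derivableP. Qed.

Lemma pdP n (i : 'I_n) (g : 'rV[R]_n -> R) x d :
  is_derive x (evec R i) g d -> pd i g x = d.
Proof. by rewrite pdE => -[]. Qed.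

(** Recursive form of [Ck] (see [CC_Ck]): the innermost derivative is peeled off, so closure under
    products, compositions and the like follows by induction on [k]. *)
Fixpoint CC n k (O : set 'rV[R]_n) (g : 'rV[R]_n -> R) : Prop :=
  (forall x, O x -> {for x, continuous g}) /\
  match k with
  | 0 => True
  | k'.+1 => (forall x i, O x -> derivable g x (evec R i)) /\
             (forall i, CC k' O (pd i g))
  end.

Lemma CC_cont n k (O : set 'rV[R]_n) g : CC k O g ->
  forall x, O x -> {for x, continuous g}.
Proof. by case: k => [|k] []. Qed.

Lemma CC_derivable n k (O : set 'rV[R]_n) g : CC k.+1 O g ->
  forall x i, O x -> derivable g x (evec R i).
Proof. by case=> _ []. Qed.

Lemma CC_pd n k (O : set 'rV[R]_n) g i : CC k.+1 O g -> CC k O (pd i g).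
Proof. by case=> _ [_]; apply. Qed.

Lemma CC_S n k (O : set 'rV[R]_n) g : CC k.+1 O g -> CC k O g.
Proof.
elim: k g => [|k IH] g [cg [dg pg]]; first by split.
by split => //; split => // i; exact: (IH _ (pg i)).
Qed.

Lemma CC_leq n k l (O : set 'rV[R]_n) g : (l <= k)%N -> CC k O g -> CC l O g.
Proof.
by move=> /subnK <-; elim: (k - l)%N => // j IH; rewrite addSn => /CC_S.
Qed.

Lemma CC_sub n k (O O' : set 'rV[R]_n) g : O' `<=` O -> CC k O g -> CC k O' g.
Proof.
move=> s; elim: k g => [|k IH] g [cg]; first by split => // x /s; exact: cg.
move=> [dg pg]; split=> [x /s|]; first exact: cg.
by split=> [x i /s|i]; [exact: dg|exact: (IH _ (pg i))].
Qed.

Lemma Dsq_rcons n (s : seq 'I_n) i (g : 'rV[R]_n -> R) :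
  Dsq (rcons s i) g = Dsq s (pd i g).
Proof. by rewrite /Dsq foldr_rcons. Qed.

Lemma CC_Dsq n k (O : set 'rV[R]_n) g (s : seq 'I_n) :
  CC (size s + k) O g -> CC k O (Dsq s g).
Proof.
elim/last_ind: s g => // s i IH g; rewrite size_rcons Dsq_rcons.
by move=> h; apply: IH; exact: CC_pd h.
Qed.

Lemma CC_Ck n k (O : set 'rV[R]_n) g : CC k O g <-> Ck k O g.
Proof.
split.
  move=> h s sk x Ox; rewrite -DsqE; split.
    apply: (CC_cont (k := 0)) Ox; apply: CC_Dsq; apply: CC_leq h.
    by rewrite addn0.
  move=> sk' i; apply: (CC_derivable (k := 0)) Ox; apply: CC_Dsq.
  by apply: CC_leq h; rewrite addn1.
elim: k g => [|k IH] g h.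
  by split=> // x Ox; exact: (h [::] isT x Ox).1.
split=> [x Ox|]; first exact: (h [::] isT x Ox).1.
split=> [x i Ox|i]; first exact: ((h [::] isT x Ox).2 isT i).
apply: IH => s sk x Ox.
have := h (rcons s i); rewrite size_rcons => /(_ sk x Ox).
by rewrite -!DsqE Dsq_rcons.
Qed.

Lemma near_open n (O : set 'rV[R]_n) (f g : 'rV[R]_n -> R) x : open O -> O x ->
  (forall y, O y -> f y = g y) -> \near x, f x = g x.
Proof.
move=> oO Ox fg; have : nbhs x O by exact: open_nbhs_nbhs.
by apply: filterS => y Oy; exact: fg.
Qed.

Lemma pd_open n (O : set 'rV[R]_n) (f g : 'rV[R]_n -> R) i :
  open O -> (forall y, O y -> f y = g y) ->
  forall y, O y -> pd i f y = pd i g y.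
Proof.
by move=> oO fg x Ox; rewrite !pdE; apply: near_eq_derive; exact: near_open oO Ox fg.
Qed.

Lemma continuous_open n (O : set 'rV[R]_n) (f g : 'rV[R]_n -> R) x :
  open O -> O x -> (forall y, O y -> f y = g y) ->
  {for x, continuous f} -> {for x, continuous g}.
Proof.
move=> oO Ox fg cf; move: cf; rewrite /prop_for /continuous_at (fg x Ox) => cf.
apply: cvg_trans cf; apply: (@near_eq_cvg _ _ (nbhs x) (nbhs_filter x)).
exact: near_open oO Ox fg.
Qed.

Lemma CC_ext n k (O : set 'rV[R]_n) f g : open O ->
  (forall y, O y -> f y = g y) -> CC k O f -> CC k O g.
Proof.
move=> oO; elim: k f g => [|k IH] f g fg [cf].
  by split=> // x Ox; exact: continuous_open oO Ox fg (cf x Ox).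
move=> [df pf]; split=> [x Ox|]; first exact: continuous_open oO Ox fg (cf x Ox).
split=> [x i Ox|i].
  by apply: near_eq_derivable (df x i Ox); exact: near_open oO Ox fg.
by apply: IH (pf i); exact: pd_open.
Qed.

Lemma CC_intro n k (O : set 'rV[R]_n) g (dg : 'I_n -> 'rV[R]_n -> R) :
  open O -> (forall x, O x -> {for x, continuous g}) ->
  (forall x i, O x -> is_derive x (evec R i) g (dg i x)) ->
  (forall i, CC k O (dg i)) -> CC k.+1 O g.
Proof.
move=> oO cg hg hd; split=> //; split=> [x i Ox|i]; first by case: (hg x i Ox).
by apply: CC_ext (hd i) => // y Oy; rewrite (pdP (hg y i Oy)).
Qed.

Lemma CC_cst n k (O : set 'rV[R]_n) (c : R) : open O -> CC k O (fun=> c).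
Proof.
move=> oO; elim: k c => [|k IH] c; first by split=> // x _; exact: cst_continuous.
apply: (@CC_intro _ _ _ _ (fun _ _ => 0)) => //.
by move=> x _; exact: cst_continuous.
Qed.

Lemma CC_add n k (O : set 'rV[R]_n) f g : open O ->
  CC k O f -> CC k O g -> CC k O (fun x => f x + g x).
Proof.
move=> oO; elim: k f g => [|k IH] f g hf hg.
  split=> // x Ox; apply: (@continuousD _ _ _ f g x).
    exact: (CC_cont hf).
  exact: (CC_cont hg).
apply: (@CC_intro _ _ _ _ (fun i x => pd i f x + pd i g x)) => //.
- move=> x Ox; apply: (@continuousD _ _ _ f g x).
    exact: (CC_cont hf).
  exact: (CC_cont hg).
- move=> x i Ox; apply: (@is_deriveD _ _ _ f g).
    by apply: pd_is_derive; exact: (CC_derivable hf).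
  by apply: pd_is_derive; exact: (CC_derivable hg).
- by move=> i; apply: IH; exact: CC_pd.
Qed.

Lemma CC_mul n k (O : set 'rV[R]_n) f g : open O ->
  CC k O f -> CC k O g -> CC k O (fun x => f x * g x).
Proof.
move=> oO; elim: k f g => [|k IH] f g hf hg.
  split=> // x Ox; apply: (@continuousM _ _ f g x).
    exact: (CC_cont hf).
  exact: (CC_cont hg).
apply: (@CC_intro _ _ _ _ (fun i x => f x * pd i g x + g x * pd i f x)) => //.
- move=> x Ox; apply: (@continuousM _ _ f g x).
    exact: (CC_cont hf).
  exact: (CC_cont hg).
- move=> x i Ox; apply: (@is_deriveM _ _ f g).
    by apply: pd_is_derive; exact: (CC_derivable hf).
  by apply: pd_is_derive; exact: (CC_derivable hg).
- move=> i; apply: CC_add => //; apply: IH => //; try exact: CC_pd; exact: CC_S.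
Qed.

Lemma CC_scale n k (O : set 'rV[R]_n) c f : open O ->
  CC k O f -> CC k O (fun x => c * f x).
Proof. by move=> oO hf; apply: CC_mul => //; exact: CC_cst. Qed.

Lemma CC_opp n k (O : set 'rV[R]_n) f : open O ->
  CC k O f -> CC k O (fun x => - f x).
Proof.
move=> oO hf; apply: CC_ext (CC_scale (-1) oO hf) => // y _; by rewrite mulN1r.
Qed.

Lemma CC_sub_fun n k (O : set 'rV[R]_n) f g : open O ->
  CC k O f -> CC k O g -> CC k O (fun x => f x - g x).
Proof. by move=> oO hf hg; apply: CC_add => //; exact: CC_opp. Qed.

Lemma CC_sum n k (O : set 'rV[R]_n) (I : Type) (r : seq I) (P : pred I)
    (f : I -> 'rV[R]_n -> R) : open O ->
  (forall i, CC k O (f i)) -> CC k O (fun x => \sum_(i <- r | P i) f i x).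
Proof.
move=> oO hf; elim: r => [|a r IH].
  by apply: CC_ext (CC_cst k 0 oO) => // y _; rewrite big_nil.
case Pa: (P a); last by apply: CC_ext IH => // y _; rewrite big_cons Pa.
by apply: CC_ext (CC_add oO (hf a) IH) => // y _; rewrite big_cons Pa.
Qed.

Lemma CC_prod n k (O : set 'rV[R]_n) (I : Type) (r : seq I) (P : pred I)
    (f : I -> 'rV[R]_n -> R) : open O ->
  (forall i, CC k O (f i)) -> CC k O (fun x => \prod_(i <- r | P i) f i x).
Proof.
move=> oO hf; elim: r => [|a r IH].
  by apply: CC_ext (CC_cst k 1 oO) => // y _; rewrite big_nil.
case Pa: (P a); last by apply: CC_ext IH => // y _; rewrite big_cons Pa.
by apply: CC_ext (CC_mul oO (hf a) IH) => // y _; rewrite big_cons Pa.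
Qed.

Lemma CC_exp n k (O : set 'rV[R]_n) f j : open O ->
  CC k O f -> CC k O (fun x => f x ^+ j).
Proof.
move=> oO hf; elim: j => [|j IH].
  by apply: CC_ext (CC_cst k 1 oO) => // y _; rewrite expr0.
by apply: CC_ext (CC_mul oO hf IH) => // y _; rewrite exprS.
Qed.

Lemma is_derive_coord n (i j : 'I_n) (x : 'rV[R]_n) :
  is_derive x (evec R i) (fun y : 'rV[R]_n => y 0 j) (i == j)%:R.
Proof.
apply/line_derive0.
rewrite (_ : (fun h => _) = (fun h : R => h * (i == j)%:R + x 0 j)); last first.
  by apply/funext => h; rewrite !mxE.
have -> : (fun h : R => h * (i == j)%:R + x 0 j) = (i == j)%:R *: (id : R -> R) + cst (x 0 j).
  by apply/funext => h; rewrite /= mulrC.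
rewrite -[X in is_derive _ _ _ X]addr0; apply: is_deriveD.
by rewrite -[X in is_derive _ _ _ X]mulr1; exact: is_deriveZ.
Qed.

Lemma CC_coord n k (O : set 'rV[R]_n) j : open O -> CC k O (fun x => x 0 j).
Proof.
move=> oO; case: k => [|k]; first by split=> // x _; exact: coord_continuous.
apply: (@CC_intro _ _ _ _ (fun i _ => (i == j)%:R)) => //.
- by move=> x _; exact: coord_continuous.
- by move=> x i _; exact: is_derive_coord.
- by move=> i; exact: CC_cst.
Qed.

Fixpoint C1 k (U : set R) (F : R -> R) : Prop :=
  (forall t, U t -> {for t, continuous F}) /\
  match k with
  | 0 => True
  | k'.+1 => (forall t, U t -> derivable F t 1) /\ C1 k' U (derive1 F)
  end.

Lemma C1_cont k (U : set R) F : C1 k U F -> forall t, U t -> {for t, continuous F}.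
Proof. by case: k => [|k] []. Qed.

Lemma C1_S k (U : set R) F : C1 k.+1 U F -> C1 k U F.
Proof.
elim: k F => [|k IH] F [cF [dF pF]]; first by split.
by split => //; split => //; exact: (IH _ pF).
Qed.

Lemma C1_ext k (U : set R) F G : open U ->
  (forall t, U t -> F t = G t) -> C1 k U F -> C1 k U G.
Proof.
move=> oU.
have near_U (F' G' : R -> R) t : U t -> (forall t, U t -> F' t = G' t) -> \near t, F' t = G' t.
  move=> Ut FG; have : nbhs t U by exact: open_nbhs_nbhs.
  by apply: filterS => y; exact: FG.
have cont_U (F' G' : R -> R) t : U t -> (forall t, U t -> F' t = G' t) ->
    {for t, continuous F'} -> {for t, continuous G'}.
  move=> Ut FG; rewrite /prop_for /continuous_at (FG t Ut) => cF.
  by apply: cvg_trans cF; apply: near_eq_cvg; exact: near_U.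
elim: k F G => [|k IH] F G FG [cF].
  by split=> // x Ux; apply: cont_U (cF x Ux).
move=> [dF pF]; split=> [x Ux|]; first by apply: cont_U (cF x Ux).
split=> [x Ux|].
  by apply: near_eq_derivable (dF x Ux); exact: near_U.
apply: IH pF => t Ut; rewrite !derive1E; apply: near_eq_derive; exact: near_U.
Qed.

Lemma C1_intro k (U : set R) F dF : open U ->
  (forall t, U t -> is_derive t 1 F (dF t)) -> C1 k U dF -> C1 k.+1 U F.
Proof.
move=> oU hF hd; split=> [t Ut|].
  apply/differentiable_continuous/derivable1_diffP; by case: (hF t Ut).
split=> [t Ut|]; first by case: (hF t Ut).
by apply: C1_ext hd => // t Ut; rewrite derive1E; case: (hF t Ut).
Qed.

Lemma C1_is_derive k (U : set R) F t : C1 k.+1 U F -> U t -> is_derive t 1 F ((derive1 F) t).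
Proof. by move=> [_ [dF _]] Ut; rewrite derive1E; apply: derivableP; exact: dF. Qed.

Lemma C1_derive k (U : set R) F : C1 k.+1 U F -> C1 k U (derive1 F).
Proof. by move=> [_ [_]]. Qed.

Lemma CC_comp1 n k (O : set 'rV[R]_n) (U : set R) (g : 'rV[R]_n -> R) F :
  open O -> C1 k U F -> CC k O g -> (forall x, O x -> U (g x)) ->
  CC k O (fun x => F (g x)).
Proof.
move=> oO; elim: k F => [|k IH] F hF hg gU.
  split=> // x Ox; apply: (@continuous_comp _ _ _ g F x).
    exact: (CC_cont hg).
  exact: (C1_cont hF (gU x Ox)).
apply: (@CC_intro _ _ _ _ (fun i x => (derive1 F) (g x) * pd i g x)) => //.
- move=> x Ox; apply: (@continuous_comp _ _ _ g F x).
    exact: (CC_cont hg).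
  exact: (C1_cont hF (gU x Ox)).
- move=> x i Ox; apply: is_derive_comp1.
    by apply: pd_is_derive; exact: (CC_derivable hg).
  exact: C1_is_derive hF (gU x Ox).
- move=> i; apply: CC_mul => //; last exact: CC_pd.
  by apply: IH => //; [exact: C1_derive|exact: CC_S].
Qed.

Lemma affine_continuous n (a : R) (b : 'rV[R]_n) :
  continuous (fun x : 'rV[R]_n => a *: x + b).
Proof.
move=> x; apply: continuousD; last exact: cst_continuous.
exact: scaler_continuous.
Qed.

Lemma CC_affine n k (O O' : set 'rV[R]_n) g (a : R) (b : 'rV[R]_n) :
  open O' -> CC k O g -> (forall x, O' x -> O (a *: x + b)) ->
  CC k O' (fun x => g (a *: x + b)).
Proof.
move=> oO'; elim: k g => [|k IH] g hg s.
  split=> // x O'x; apply: (@continuous_comp _ _ _ (fun x : 'rV[R]_n => a *: x + b) g x).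
    exact: affine_continuous.
  exact: (CC_cont hg (s x O'x)).
apply: (@CC_intro _ _ _ _ (fun i x => pd i g (a *: x + b) * a)) => //.
- move=> x O'x; apply: (@continuous_comp _ _ _ (fun x : 'rV[R]_n => a *: x + b) g x).
    exact: affine_continuous.
  exact: (CC_cont hg (s x O'x)).
- move=> x i O'x; apply: is_derive_affine.
  by apply: pd_is_derive; exact: (@CC_derivable _ _ _ _ hg _ i (s x O'x)).
- move=> i; apply: CC_mul => //; last exact: CC_cst.
  by apply: IH => //; exact: CC_pd.
Qed.

Lemma pd_affine n k (O : set 'rV[R]_n) g (a : R) (b : 'rV[R]_n) i x :
  CC k.+1 O g -> O (a *: x + b) ->
  pd i (fun x => g (a *: x + b)) x = pd i g (a *: x + b) * a.
Proof.
move=> hg Ox.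
have := is_derive_affine (pd_is_derive (@CC_derivable _ _ _ _ hg _ i Ox)).
exact: pdP.
Qed.

Lemma open_bigU n (O O' : set 'rV[R]_n) k g :
  open O -> open O' -> CC k O g -> CC k O' g -> CC k (O `|` O') g.
Proof.
move=> oO oO'; elim: k g => [|k IH] g hg hg'.
  by split=> // x [] Ox; [exact: (CC_cont hg)|exact: (CC_cont hg')].
split=> [x [] Ox|]; [exact: (CC_cont hg)|exact: (CC_cont hg')|].
split=> [x i [] Ox|i]; [exact: (CC_derivable hg)|exact: (CC_derivable hg')|].
by apply: IH; exact: CC_pd.
Qed.

(** [O] and the complement of [K] are open, cover the space, and the function is smooth on each. *)
Lemma CC_glue n k (O K : set 'rV[R]_n) g : open O -> closed K -> K `<=` O ->
  CC k O g -> (forall x, ~ K x -> g x = 0) -> CC k setT g.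
Proof.
move=> oO cK KO hg g0.
have oK : open (~` K) by exact: closed_openC.
have h : CC k (~` K) g.
  by apply: CC_ext (CC_cst k 0 oK) => // y Ky; rewrite g0.
apply: CC_sub (open_bigU oO oK hg h) => x _ /=.
by have [/KO Ox|nK] := pselect (K x); [left|right].
Qed.

End Calculus.

(** * Powers of the Laplacian *)


Section Calculus2.
Variable R : realType.
Implicit Types (n k m : nat).

Definition mlap n (g : 'rV[R]_n -> R) : 'rV[R]_n -> R :=
  fun x => - \sum_i pd i (pd i g) x.

Definition plm n m (g : 'rV[R]_n -> R) : 'rV[R]_n -> R := iter m (@mlap n) g.

Lemma plmE n m (g : 'rV[R]_n -> R) : plm m g = mlapm n m g.
Proof.
rewrite /plm /mlapm; elim: m => //= m ->.
by apply/funext => x; rewrite /mlap /lap; under eq_bigr do rewrite !pdE.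
Qed.

Lemma plmSr n m (g : 'rV[R]_n -> R) : plm m.+1 g = plm m (mlap g).
Proof. by rewrite /plm iterSr. Qed.

Lemma plm0 n (g : 'rV[R]_n -> R) : plm 0 g = g.
Proof. by []. Qed.

Lemma mlapE n (g : 'rV[R]_n -> R) x : mlap g x = - \sum_i pd i (pd i g) x.
Proof. by []. Qed.

Lemma mlap_open n (O : set 'rV[R]_n) f g : open O ->
  (forall y, O y -> f y = g y) -> forall y, O y -> mlap f y = mlap g y.
Proof.
move=> oO fg y Oy; rewrite !mlapE; congr (- _); apply: eq_bigr => i _.
by apply: (pd_open (O := O)) Oy => // z Oz; exact: (pd_open (O := O)).
Qed.

Lemma plm_open n m (O : set 'rV[R]_n) f g : open O ->
  (forall y, O y -> f y = g y) -> forall y, O y -> plm m f y = plm m g y.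
Proof.
move=> oO; elim: m f g => [|m IH] f g fg y Oy; first by rewrite !plm0 fg.
 rewrite !plmSr.
by apply: IH Oy; exact: mlap_open.
Qed.

Lemma plm_eq n m (O : set 'rV[R]_n) f g x : open O -> O x ->
  (forall y, O y -> f y = g y) -> plm m f x = plm m g x.
Proof. by move=> oO Ox fg; exact: (plm_open m oO fg Ox). Qed.

Lemma CC_mlap n k (O : set 'rV[R]_n) g : open O -> CC k.+2 O g -> CC k O (mlap g).
Proof.
move=> oO hg.
apply: (@CC_ext _ _ _ _ (fun x => - \sum_i pd i (pd i g) x)) => //.
apply: CC_opp => //; apply: CC_sum => // i.
exact/CC_pd/CC_pd.
Qed.

Lemma CC_plm n m k (O : set 'rV[R]_n) g : open O ->
  CC (2 * m + k) O g -> CC k O (plm m g).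
Proof.
move=> oO; elim: m g => [|m IH] g hg; first by rewrite plm0.
rewrite plmSr; apply: IH.
apply: CC_mlap => //; apply: CC_leq hg; lia.
Qed.

Lemma pd_add n k (O : set 'rV[R]_n) f g i x : CC k.+1 O f -> CC k.+1 O g -> O x ->
  pd i (fun x => f x + g x) x = pd i f x + pd i g x.
Proof.
move=> hf hg Ox; have := @is_deriveD _ _ _ f g x (evec R i) _ _
  (pd_is_derive (@CC_derivable _ _ _ _ _ hf _ i Ox))
  (pd_is_derive (@CC_derivable _ _ _ _ _ hg _ i Ox)).
exact: pdP.
Qed.

Lemma pd_mul n k (O : set 'rV[R]_n) f g i x : CC k.+1 O f -> CC k.+1 O g -> O x ->
  pd i (fun x => f x * g x) x = f x * pd i g x + g x * pd i f x.
Proof.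
move=> hf hg Ox; have := @is_deriveM _ _ f g x (evec R i) _ _
  (pd_is_derive (@CC_derivable _ _ _ _ _ hf _ i Ox))
  (pd_is_derive (@CC_derivable _ _ _ _ _ hg _ i Ox)).
exact: pdP.
Qed.

Lemma pd_cst n (c : R) i (x : 'rV[R]_n) : pd i (fun=> c) x = 0.
Proof. by rewrite pdE; exact: derive_cst. Qed.

Lemma pd_scale n k (O : set 'rV[R]_n) c f i x : open O -> CC k.+1 O f -> O x ->
  pd i (fun x => c * f x) x = c * pd i f x.
Proof.
move=> oO hf Ox; rewrite (pd_mul i (CC_cst k.+1 c oO) hf Ox).
by rewrite pd_cst mulr0 addr0.
Qed.

Lemma mlap_add n (O : set 'rV[R]_n) f g x : open O -> CC 2 O f -> CC 2 O g -> O x ->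
  mlap (fun x => f x + g x) x = mlap f x + mlap g x.
Proof.
move=> oO hf hg Ox; rewrite !mlapE -opprD -big_split /=.
apply/eqP; rewrite eqr_opp; apply/eqP; apply: eq_bigr => i _.
rewrite (pd_open (g := fun x => pd i f x + pd i g x) i oO _ Ox); last first.
  by move=> y Oy; exact: (pd_add i hf hg Oy).
by rewrite (pd_add i (CC_pd i hf) (CC_pd i hg) Ox).
Qed.

Lemma mlap_scale n (O : set 'rV[R]_n) c f x : open O -> CC 2 O f -> O x ->
  mlap (fun x => c * f x) x = c * mlap f x.
Proof.
move=> oO hf Ox; rewrite !mlapE mulrN mulr_sumr.
apply/eqP; rewrite eqr_opp; apply/eqP; apply: eq_bigr => i _.
rewrite (pd_open (g := fun x => c * pd i f x) i oO _ Ox); last first.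
  by move=> y Oy; exact: (pd_scale c i oO hf Oy).
by rewrite (pd_scale c i oO (CC_pd i hf) Ox).
Qed.

Lemma plm_add n m (O : set 'rV[R]_n) f g x : open O ->
  CC (2 * m) O f -> CC (2 * m) O g -> O x ->
  plm m (fun x => f x + g x) x = plm m f x + plm m g x.
Proof.
move=> oO; elim: m f g x => [|m IH] f g x hf hg Ox; first by rewrite !plm0.
rewrite !plmSr.
have -> : plm m (mlap (fun x => f x + g x)) x = plm m (fun x => mlap f x + mlap g x) x.
  apply: (plm_eq _ oO Ox) => y Oy.
  by apply: (mlap_add oO) => //; [apply: CC_leq hf|apply: CC_leq hg]; lia.
by apply: IH => //; apply: CC_mlap => //; [apply: CC_leq hf|apply: CC_leq hg]; lia.
Qed.

Lemma plm_scale n m (O : set 'rV[R]_n) c f x : open O ->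
  CC (2 * m) O f -> O x ->
  plm m (fun x => c * f x) x = c * plm m f x.
Proof.
move=> oO; elim: m f x => [|m IH] f x hf Ox; first by rewrite !plm0.
rewrite !plmSr.
have -> : plm m (mlap (fun x => c * f x)) x = plm m (fun x => c * mlap f x) x.
  apply: (plm_eq _ oO Ox) => y Oy.
  by apply: (mlap_scale c oO) => //; apply: CC_leq hf; lia.
by apply: IH => //; apply: CC_mlap => //; apply: CC_leq hf; lia.
Qed.

Lemma plm_cst0 n m (x : 'rV[R]_n) : plm m (fun=> 0) x = 0.
Proof.
have h := @plm_scale n m setT 0 (fun=> 0) x openT (CC_cst _ _ openT) I.
by rewrite [X in plm m X](_ : _ = (fun=> 0 * 0)) ?h ?mul0r//; apply/funext => y; rewrite mul0r.
Qed.

Lemma plm_zero n m (O : set 'rV[R]_n) f x : open O ->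
  (forall y, O y -> f y = 0) -> O x -> plm m f x = 0.
Proof.
move=> oO f0 Ox; rewrite -[RHS](plm_cst0 m x).
exact: (plm_eq m oO Ox).
Qed.

Lemma plm_sub n m (O : set 'rV[R]_n) f g x : open O ->
  CC (2 * m) O f -> CC (2 * m) O g -> O x ->
  plm m (fun x => f x - g x) x = plm m f x - plm m g x.
Proof.
move=> oO hf hg Ox; rewrite -mulN1r -(plm_scale (-1) oO hg Ox).
rewrite -(plm_add oO hf (CC_scale (-1) oO hg) Ox).
by apply: (plm_eq m oO Ox) => // y _; rewrite mulN1r.
Qed.

Lemma plm_sum n m (O : set 'rV[R]_n) (I : Type) (r : seq I) (P : pred I)
    (f : I -> 'rV[R]_n -> R) x : open O ->
  (forall i, CC (2 * m) O (f i)) -> O x ->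
  plm m (fun x => \sum_(i <- r | P i) f i x) x = \sum_(i <- r | P i) plm m (f i) x.
Proof.
move=> oO hf Ox; elim: r => [|a r IH].
  by rewrite big_nil -[RHS](plm_cst0 m x); apply: (plm_eq m (O := setT) openT) => // y _; rewrite big_nil.
rewrite big_cons -IH; case: ifP => Pa.
  rewrite -(plm_add oO (hf a) (CC_sum r P oO hf) Ox).
  by apply: (plm_eq m (O := setT) openT) => // y _; rewrite big_cons Pa.
by apply: (plm_eq m (O := setT) openT) => // y _; rewrite big_cons Pa.
Qed.

Lemma mlap_affine n (O O' : set 'rV[R]_n) g (a : R) (b : 'rV[R]_n) x :
  open O' -> CC 2 O g -> (forall x, O' x -> O (a *: x + b)) -> O' x ->
  mlap (fun x => g (a *: x + b)) x = a ^+ 2 * mlap g (a *: x + b).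
Proof.
move=> oO' hg s O'x; rewrite !mlapE mulrN mulr_sumr.
apply/eqP; rewrite eqr_opp; apply/eqP; apply: eq_bigr => i _.
rewrite (pd_open (g := fun x => a * pd i g (a *: x + b)) i oO' _ O'x); last first.
  by move=> y O'y; rewrite (pd_affine i hg (s _ O'y)) mulrC.
have hp := CC_pd i hg.
rewrite (pd_scale a i oO' (CC_affine (a := a) (b := b) oO' hp s) O'x).
by rewrite (pd_affine i hp (s _ O'x)) expr2; ring.
Qed.

Lemma plm_affine n m (O O' : set 'rV[R]_n) g (a : R) (b : 'rV[R]_n) x :
  open O -> open O' -> CC (2 * m) O g -> (forall x, O' x -> O (a *: x + b)) -> O' x ->
  plm m (fun x => g (a *: x + b)) x = a ^+ (2 * m) * plm m g (a *: x + b).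
Proof.
move=> oO oO'; elim: m g x => [|m IH] g x hg s O'x; first by rewrite !plm0 muln0 expr0 mul1r.
have hg2 : CC 2 O g by apply: CC_leq hg; lia.
rewrite !plmSr.
have -> : plm m (mlap (fun x => g (a *: x + b))) x =
          plm m (fun x => a ^+ 2 * mlap g (a *: x + b)) x.
  by apply: (plm_eq _ oO' O'x) => y O'y; rewrite (mlap_affine oO' hg2 s O'y).
have hl : CC (2 * m) O (mlap g) by apply: CC_mlap => //; apply: CC_leq hg; lia.
rewrite (plm_scale _ oO' (CC_affine (a := a) (b := b) oO' hl s) O'x).
by rewrite IH// mulrA -exprD; congr (_ ^+ _ * _); lia.
Qed.

Lemma evecZ_norm n (i : 'I_n) (a : R) : `|a *: evec R i| <= `|a|.
Proof.
apply: mx_norm_coord_le => // j; rewrite !mxE.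
by case: (i == j); rewrite ?mulr1 ?mulr0 ?normr0.
Qed.

Lemma line_mvt n (i : 'I_n) (g : 'rV[R]_n -> R) (x : 'rV[R]_n) (t : R) :
  (forall s : R, 0 <= s <= 1 -> derivable g ((s * t) *: evec R i + x) (evec R i)) ->
  exists2 s : R, 0 <= s <= 1 &
    g (t *: evec R i + x) - g x = t * pd i g ((s * t) *: evec R i + x).
Proof.
move=> dg.
pose f := (fun h => g (h *: evec R i + x)) \o (fun s => s * t).
have der (s : R) : 0 <= s <= 1 -> is_derive s 1 f (pd i g ((s * t) *: evec R i + x) * t).
  move=> hs; apply: is_derive1_comp.
    by apply/line_derive/pd_is_derive/dg.
  rewrite -[X in is_derive _ _ _ X]mulr1.
  have -> : (fun h => h * t) = t *: (id : R -> R) by apply/funext => h; rewrite /= mulrC.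
  exact: is_deriveZ.
have [||s] := @MVT_segment R f (fun s => pd i g ((s * t) *: evec R i + x) * t) 0 1
  ler01.
- by move=> s; rewrite in_itv/= => /andP[? ?]; apply: der; rewrite !ltW.
- apply: derivable_within_continuous => s; rewrite in_itv/= => hs.
  by case: (der s hs).
rewrite in_itv/= => hs E; exists s => //.
by move: E; rewrite /f/= mul1r mul0r scale0r add0r => ->; ring.
Qed.

(** The mean value theorem along [i], applied to the difference of [g] along [j], and then along
    [j], applied to [pd i g]. *)
Lemma double_diff n (i j : 'I_n) (O : set 'rV[R]_n) g (x : 'rV[R]_n) (h : R) :
  CC 2 O g -> open O ->
  (forall a b : R, 0 <= a <= 1 -> 0 <= b <= 1 ->
     O ((a * h) *: evec R i + ((b * h) *: evec R j + x))) ->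
  exists a b : R, [/\ 0 <= a <= 1, 0 <= b <= 1 &
    g (h *: evec R i + (h *: evec R j + x)) - g (h *: evec R j + x)
    - (g (h *: evec R i + x) - g x) =
    h ^+ 2 * pd j (pd i g) ((a * h) *: evec R i + ((b * h) *: evec R j + x))].
Proof.
move=> hg oO s.
have s1 (a : R) : 0 <= a <= 1 -> O ((a * h) *: evec R i + (h *: evec R j + x)).
  by move=> ha; have := s a 1 ha; rewrite mul1r; apply; rewrite ler01 lexx.
have s0 (a : R) : 0 <= a <= 1 -> O ((a * h) *: evec R i + x).
  by move=> ha; have := s a 0 ha; rewrite mul0r scale0r add0r; apply; rewrite ler01 lexx.
have shiftE y : h *: evec R j + y = 1 *: y + h *: evec R j by rewrite scale1r addrC.
have dd z : O z -> O (h *: evec R j + z) -> is_derive z (evec R i)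
    (fun y => g (h *: evec R j + y) - g y)
    (pd i g (h *: evec R j + z) - pd i g z).
  move=> Oz Ohz; apply: (@is_deriveB _ _ _ (fun y => g (h *: evec R j + y)) g).
    rewrite (_ : (fun y => _) = (fun y => g (1 *: y + h *: evec R j))); last first.
      by apply/funext => y; rewrite shiftE.
    rewrite -[X in is_derive _ _ _ X]mulr1; apply: is_derive_affine; rewrite -shiftE.
    exact/pd_is_derive/(@CC_derivable _ _ _ _ _ hg).
  exact/pd_is_derive/(@CC_derivable _ _ _ _ _ hg).
have swap a y : a *: evec R i + (h *: evec R j + y) = h *: evec R j + (a *: evec R i + y).
  by rewrite addrCA.
have [a ha Ea] := @line_mvt n i (fun y => g (h *: evec R j + y) - g y) x h
  (fun a ha => @ex_derive _ _ _ _ _ _ _ (dd _ (s0 a ha) (eq_ind _ O (s1 a ha) _ (swap _ _)))).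
have E2 : pd i (fun y => g (h *: evec R j + y) - g y) ((a * h) *: evec R i + x) =
   pd i g (h *: evec R j + ((a * h) *: evec R i + x)) - pd i g ((a * h) *: evec R i + x).
  have O1 := s1 a ha; rewrite swap in O1.
  exact: pdP (dd _ (s0 a ha) O1).
have [b hb Eb] := @line_mvt n j (pd i g) ((a * h) *: evec R i + x) h
  (fun b hb => @CC_derivable _ _ _ _ _ (CC_pd i hg) _ j
     (eq_ind _ O (s a b ha hb) _ (addrCA _ _ _))).
exists a, b; split => //.
rewrite [LHS](_ : _ = (g (h *: evec R j + (h *: evec R i + x)) - g (h *: evec R i + x)) -
  (g (h *: evec R j + x) - g x)); last by rewrite swap; ring.
by rewrite Ea E2 Eb addrCA expr2 mulrA.
Qed.

(** The second difference of [g] is symmetric in [i] and [j]. By [double_diff] used in both orders,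
    the two mixed derivatives take a common value at points arbitrarily close to [x]; continuity
    concludes. *)
Lemma schwarz n (i j : 'I_n) (O : set 'rV[R]_n) g x : open O -> CC 2 O g -> O x ->
  pd i (pd j g) x = pd j (pd i g) x.
Proof.
move=> oO hg Ox; apply/eqP; rewrite -subr_eq0 -normr_le0.
apply/ler_addgt0Pr => e e0; rewrite add0r.
have ca : {for x, continuous (pd j (pd i g))}.
  exact: (CC_cont (CC_pd j (CC_pd i hg))).
have cb : {for x, continuous (pd i (pd j g))}.
  exact: (CC_cont (CC_pd i (CC_pd j hg))).
have e4 : 0 < e / 4 by lra.
have [d1 d10 H1] := iffLR (continuous_rVP _ _) ca _ e4.
have [d2 d20 H2] := iffLR (continuous_rVP _ _) cb _ e4.
have /nbhs_ballP[d3 /= d30] : nbhs x O by exact: open_nbhs_nbhs.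
rewrite mx_norm_ball => H3.
pose d := Num.min d1 (Num.min d2 d3).
have d0 : 0 < d by rewrite !lt_min d10 d20.
have [dd1 [dd2 dd3]] : d <= d1 /\ d <= d2 /\ d <= d3 by rewrite /d !ge_min !lexx !orbT.
(* The evaluation points are displaced by at most [2 h], which must stay below [d]. *)
pose h : R := d / 3; have h0 : 0 < h by rewrite /h; lra.
have near i' j' (a b : R) : 0 <= a <= 1 -> 0 <= b <= 1 ->
    `|x - ((a * h) *: evec R i' + ((b * h) *: evec R j' + x))| < d.
  move=> /andP[a0 a1] /andP[b0 b1].
  rewrite addrA opprD addrCA subrr addr0 normrN.
  apply: le_lt_trans (ler_normD _ _) _.
  have hc (c : R) : 0 <= c -> c <= 1 -> `|c * h| <= h.
    move=> c0 c1; rewrite ler_norml; apply/andP; split; nra.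
  have h1 := le_trans (evecZ_norm i' (a * h)) (hc a a0 a1).
  have h2 := le_trans (evecZ_norm j' (b * h)) (hc b b0 b1).
  apply: le_lt_trans (lerD h1 h2) _.
  by rewrite /h; lra.
have [a [b [ha hb E1]]] := double_diff hg oO
  (fun a b ha hb => H3 _ (lt_le_trans (near i j a b ha hb) dd3)).
have [a' [b' [ha' hb' E2]]] := double_diff hg oO
  (fun a b ha hb => H3 _ (lt_le_trans (near j i a b ha hb) dd3)).
have h20 : h ^+ 2 != 0 by rewrite expf_neq0// gt_eqF.
have E : pd j (pd i g) ((a * h) *: evec R i + ((b * h) *: evec R j + x)) =
  pd i (pd j g) ((a' * h) *: evec R j + ((b' * h) *: evec R i + x)).
  apply: (mulfI h20); rewrite -E1 -E2.
  by rewrite [h *: evec R j + (_ + _)]addrCA; ring.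
have K1 := H1 _ (lt_le_trans (near i j a b ha hb) dd1).
have K2 := H2 _ (lt_le_trans (near j i a' b' ha' hb') dd2).
rewrite E in K1.
set p := pd i (pd j g) _ in K1 K2.
move: K1 K2; rewrite !ltr_norml ler_norml.
set A := pd i (pd j g) x; set B := pd j (pd i g) x.
by move=> /andP[? ?] /andP[? ?]; apply/andP; split; lra.
Qed.

End Calculus2.

(** * Derivative bounds and Taylor estimates *)


Section Bounds.
Variable R : realType.
Implicit Types (n k m : nat).

Definition trunc n (j : nat) (w : 'rV[R]_n) : 'rV[R]_n :=
  \row_(l < n) (if (l < j)%N then w 0 l else 0).

Lemma truncS n (j : 'I_n) (w : 'rV[R]_n) :
  trunc j.+1 w = w 0 j *: evec R j + trunc j w.
Proof.
apply/rowP => l; rewrite !mxE ltnS leq_eqVlt.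
have [<-|ne] := eqVneq j l; first by rewrite eqxx ltnn mulr1 addr0.
by rewrite mulr0 add0r [(_ == _) in LHS]eq_sym (negbTE ne : (nat_of_ord j == l) = false).
Qed.

(** Only partial derivatives are at hand, so the point [x] is moved to [w + x] one coordinate at a
    time through the vectors [trunc j w]. For the max norm all intermediate points stay within [|w|]
    of [x], so a bound on that cube suffices. *)
Lemma mv_ineq n (O : set 'rV[R]_n) g (x w : 'rV[R]_n) (M : R) :
  CC 1 O g ->
  (forall z, `|z - x| <= `|w| -> O z /\ forall i, `|pd i g z| <= M) ->
  `|g (w + x) - g x| <= n%:R * M * `|w|.
Proof.
move=> hg H.
have key j : (j <= n)%N -> `|g (trunc j w + x) - g x| <= j%:R * M * `|w|.
  elim: j => [|j IH] jn.
    rewrite (_ : trunc 0 w = 0) ?add0r ?subrr ?normr0 ?mul0r//.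
    by apply/rowP => l; rewrite !mxE.
  pose jo := Ordinal jn.
  have near (s : R) : 0 <= s <= 1 -> `|(s * w 0 jo) *: evec R jo + (trunc j w + x) - x| <= `|w|.
    move=> /andP[s0 s1]; rewrite addrA addrK; apply: mx_norm_coord_le => // l; rewrite !mxE.
    have [<-|ne] := eqVneq jo l.
      rewrite /= ltnn mulr1 addr0 normrM (ger0_norm s0).
      apply: le_trans (coord_le_mx_norm w jo).
      by rewrite ler_piMl.
    rewrite mulr0 add0r; case: ifP => _; first exact: coord_le_mx_norm.
    by rewrite normr0.
  have [s hs E] := @line_mvt R n jo g (trunc j w + x) (w 0 jo)
    (fun s hs => @CC_derivable _ _ _ _ _ hg _ jo (H _ (near s hs)).1).
  rewrite (truncS jo) -addrA.
  rewrite (_ : _ - g x = (g (w 0 jo *: evec R jo + (trunc j w + x)) - g (trunc j w + x)) +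
    (g (trunc j w + x) - g x)); last by rewrite subrKA.
  apply: le_trans (ler_normD _ _) _.
  rewrite -natr1 mulrDl mul1r mulrDl addrC; apply: lerD; first exact: IH (ltnW jn).
  rewrite E normrM mulrC; apply: ler_pM => //; last exact: coord_le_mx_norm.
  by have [_] := H _ (near s hs); apply.
have := key n (leqnn n); rewrite (_ : trunc n w = w)//.
by apply/rowP => l; rewrite mxE ltn_ord.
Qed.

Lemma bounded_compact n (K : set 'rV[R]_n) (g : 'rV[R]_n -> R) (L : R) :
  closed K -> (forall x, K x -> `|x| <= L) ->
  (forall x, K x -> {for x, continuous g}) ->
  exists2 M : R, 0 <= M & forall x, K x -> `|g x| <= M.
Proof.
move=> cK bK cg.
have [->|K0] := eqVneq K set0; first by exists 0.
have coK : compact K.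
  apply: bounded_closed_compact => //.
  exists L; split; first exact: num_real.
  by move=> M LM x Kx; exact: le_trans (bK x Kx) (ltW LM).
have [|c Kc H] := @EVT_max_rV R n (fun x => `|g x|) K (ltac:(exact/set0P)) coK.
- apply: continuous_in_subspaceT => x; rewrite inE => Kx.
  apply: (@continuous_comp _ _ _ g (fun t => `|t|) x); first exact: cg.
  exact: norm_continuous.
by exists `|g c| => // x Kx; apply: H; rewrite inE.
Qed.

Fixpoint Bd n k (O : set 'rV[R]_n) (g : 'rV[R]_n -> R) (M : R) : Prop :=
  (forall x, O x -> `|g x| <= M) /\
  match k with
  | 0 => True
  | k'.+1 => forall i, Bd k' O (pd i g) M
  end.

Lemma Bd_val n k (O : set 'rV[R]_n) g M : Bd k O g M -> forall x, O x -> `|g x| <= M.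
Proof. by case: k => [|k] []. Qed.

Lemma Bd_S n k (O : set 'rV[R]_n) g M : Bd k.+1 O g M -> Bd k O g M.
Proof.
elim: k g => [|k IH] g [h1 h2]; first by split.
by split=> // i; exact: (IH _ (h2 i)).
Qed.

Lemma Bd_le n k (O : set 'rV[R]_n) g M M' : M <= M' -> Bd k O g M -> Bd k O g M'.
Proof.
move=> MM; elim: k g => [|k IH] g [h1 h2]; split => //.
- by move=> x Ox; exact: le_trans (h1 x Ox) MM.
- by move=> x Ox; exact: le_trans (h1 x Ox) MM.
- by move=> i; exact: (IH _ (h2 i)).
Qed.

Lemma Bd_sub n k (O O' : set 'rV[R]_n) g M : O' `<=` O -> Bd k O g M -> Bd k O' g M.
Proof.
move=> s; elim: k g => [|k IH] g [h1 h2]; split => //.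
- by move=> x /s; exact: h1.
- by move=> x /s; exact: h1.
- by move=> i; exact: (IH _ (h2 i)).
Qed.

Lemma Bd_ext n k (O : set 'rV[R]_n) f g M : open O ->
  (forall y, O y -> f y = g y) -> Bd k O f M -> Bd k O g M.
Proof.
move=> oO; elim: k f g => [|k IH] f g fg [h1 h2].
  by split => // x Ox; rewrite -fg//; exact: h1.
split=> [x Ox|i]; first by rewrite -fg//; exact: h1.
by apply: IH (h2 i); exact: pd_open.
Qed.

Lemma Bd_add n k (O : set 'rV[R]_n) f g M M' : open O -> CC k O f -> CC k O g ->
  Bd k O f M -> Bd k O g M' -> Bd k O (fun x => f x + g x) (M + M').
Proof.
move=> oO; elim: k f g => [|k IH] f g hf hg [h1 h2] [h1' h2'].
  by split => // x Ox; apply: le_trans (ler_normD _ _) (lerD (h1 _ Ox) (h1' _ Ox)).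
split=> [x Ox|i]; first by apply: le_trans (ler_normD _ _) (lerD (h1 _ Ox) (h1' _ Ox)).
apply: (@Bd_ext _ _ _ (fun x => pd i f x + pd i g x)) => //.
  by move=> y Oy; rewrite (pd_add i hf hg Oy).
by apply: IH (h2 i) (h2' i); exact: CC_pd.
Qed.

(** Each derivative doubles the number of terms in the product rule, whence [2 ^+ k]. *)
Lemma Bd_mul n k (O : set 'rV[R]_n) f g M M' : open O -> 0 <= M -> 0 <= M' ->
  CC k O f -> CC k O g ->
  Bd k O f M -> Bd k O g M' -> Bd k O (fun x => f x * g x) (2 ^+ k * (M * M')).
Proof.
move=> oO M0 M'0; elim: k f g => [|k IH] f g hf hg bf bg.
  by split => // x Ox; rewrite mul1r normrM ler_pM// ?(Bd_val bf)// ?(Bd_val bg).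
have h0 : 0 <= M * M' by exact: mulr_ge0.
split=> [x Ox|i].
  rewrite normrM; apply: (@le_trans _ _ (M * M')).
    by rewrite ler_pM// ?(Bd_val bf)// ?(Bd_val bg).
  by rewrite ler_peMl// exprn_ege1// ler1n.
apply: (@Bd_ext _ _ _ (fun x => f x * pd i g x + g x * pd i f x)) => //.
  by move=> y Oy; rewrite (pd_mul i hf hg Oy).
rewrite exprS -mulrA mulr_natl mulr2n.
have hfi := CC_pd i hf; have hgi := CC_pd i hg.
have [hf' hg'] := (CC_S hf, CC_S hg).
have bfi : Bd k O (pd i f) M by case: bf => _; apply.
have bgi : Bd k O (pd i g) M' by case: bg => _; apply.
apply: Bd_add => //; try exact: CC_mul.
  by apply: IH => //; exact: Bd_S.
by rewrite [M * M']mulrC; apply: Bd_le (lexx _) _; rewrite [M' * M]mulrC;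
  apply: (@Bd_ext _ _ _ (fun x => pd i f x * g x)) => // [y _|];
  [rewrite mulrC|apply: IH => //; exact: Bd_S].
Qed.

Lemma Bd_sum n k (O : set 'rV[R]_n) (I : Type) (r : seq I)
    (f : I -> 'rV[R]_n -> R) M : open O ->
  (forall i, CC k O (f i)) -> (forall i, Bd k O (f i) M) ->
  Bd k O (fun x => \sum_(i <- r) f i x) ((size r)%:R * M).
Proof.
move=> oO hf bf; elim: r => [|a r IH] /=.
  apply: (@Bd_ext _ _ _ (fun=> 0)) => // [y _|]; first by rewrite big_nil.
  rewrite mul0r; elim: k {hf bf} => [|k IH]; split => //; try by move=> *; rewrite normr0.
  by move=> i; apply: Bd_ext IH => // y _; rewrite pd_cst.
apply: (@Bd_ext _ _ _ (fun x => f a x + \sum_(i <- r) f i x)) => // [y _|]; first by rewrite big_cons.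
rewrite -natr1 mulrDl mul1r addrC; apply: Bd_add => //.
exact: CC_sum.
Qed.

Lemma Bd_scale n k (O : set 'rV[R]_n) (c : R) f M : open O -> CC k O f ->
  Bd k O f M -> Bd k O (fun x => c * f x) (`|c| * M).
Proof.
move=> oO; elim: k f => [|k IH] f hf [h1 h2].
  by split => // x Ox; rewrite normrM ler_wpM2l//; exact: h1.
split=> [x Ox|i]; first by rewrite normrM ler_wpM2l//; exact: h1.
apply: (@Bd_ext _ _ _ (fun x => c * pd i f x)) => //.
  by move=> y Oy; rewrite (pd_scale c i oO hf Oy).
by apply: IH (h2 i); exact: CC_pd.
Qed.

Lemma Bd_mlap n k (O : set 'rV[R]_n) g M : open O -> CC k.+2 O g ->
  Bd k.+2 O g M -> Bd k O (mlap g) (n%:R * M).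
Proof.
move=> oO hg [_ h].
have hii i : CC k O (pd i (pd i g)) by exact: CC_pd (CC_pd i hg).
apply: (@Bd_ext _ _ _ (fun x => -1 * \sum_i pd i (pd i g) x)) => //.
  by move=> y _; rewrite mulN1r.
have -> : n%:R * M = `|-1 : R| * (n%:R * M) by rewrite normrN1 mul1r.
apply: Bd_scale => //; first exact: CC_sum.
have -> : n%:R = (size (index_enum 'I_n))%:R :> R.
  by rewrite /index_enum -enumT size_enum_ord.
by apply: Bd_sum => // i; have [_] := h i; apply.
Qed.

Lemma Bd_plm n m (O : set 'rV[R]_n) g M : open O -> CC (2 * m) O g ->
  Bd (2 * m) O g M -> forall x, O x -> `|plm m g x| <= n%:R ^+ m * M.
Proof.
move=> oO; elim: m g M => [|m IH] g M hg bg x Ox.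
  by rewrite plm0 expr0 mul1r; exact: Bd_val bg x Ox.
rewrite plmSr exprSr -mulrA.
have E : (2 * m.+1 = (2 * m).+2)%N by lia.
rewrite E in hg bg.
by apply: IH => //; [exact: CC_mlap|exact: Bd_mlap].
Qed.

Lemma Bd_compact n k (O K : set 'rV[R]_n) g (L : R) : CC k O g ->
  closed K -> (forall x, K x -> `|x| <= L) -> K `<=` O ->
  exists2 M : R, 0 <= M & Bd k K g M.
Proof.
move=> hg cK bK KO; elim: k g hg => [|k IH] g hg.
  have [M M0 h] := bounded_compact cK bK (fun x Kx => CC_cont hg (KO x Kx)).
  by exists M.
have [M M0 h] := bounded_compact cK bK (fun x Kx => CC_cont hg (KO x Kx)).
have /choice[N hN] : forall i, exists M : R, 0 <= M /\ Bd k K (pd i g) M.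
  by move=> i; have [M' ? ?] := IH _ (CC_pd i hg); exists M'.
exists (M + \sum_i N i).
  by rewrite addr_ge0// sumr_ge0// => i _; have [] := hN i.
have sN0 : 0 <= \sum_i N i by rewrite sumr_ge0// => i _; have [] := hN i.
split=> [x Kx|i]; first by apply: le_trans (h x Kx) _; rewrite lerDl.
have [_] := hN i; apply: Bd_le; rewrite (bigD1 i)//= addrCA lerDl.
by rewrite addr_ge0// sumr_ge0// => j _; have [] := hN j.
Qed.

(** The condition satisfied at the origin by a Taylor remainder of order [k]. *)
Fixpoint Van n k (g : 'rV[R]_n -> R) : Prop :=
  match k with
  | 0 => True
  | k'.+1 => g 0 = 0 /\ forall i, Van k' (pd i g)
  end.

Lemma fin_min_pos (I : finType) (P : I -> R -> Prop) :
  (forall i r r', P i r -> 0 < r' -> r' <= r -> P i r') ->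
  (forall i, exists2 r : R, 0 < r & P i r) -> exists2 r : R, 0 < r & forall i, P i r.
Proof.
move=> mono H.
have /choice[r hr] : forall i, exists r : R, 0 < r /\ P i r.
  by move=> i; have [r0 ? ?] := H i; exists r0.
have r0 : 0 < \big[Num.min/1]_i r i.
  by apply/bigmin_gtP; split => // i _; have [] := hr i.
exists (\big[Num.min/1]_i r i) => // i; have [_ h] := hr i.
by apply: mono h r0 _; exact: bigmin_le_cond.
Qed.

Definition cube n (r : R) : set 'rV[R]_n := [set z | `|z| < r].

Lemma open_cube n r : open (@cube n r).
Proof.
apply: (@open_comp _ _ (fun y : 'rV[R]_n => `|y|) [set t | t < r]).
  by move=> v _; exact: norm_continuous.
exact: open_lt.
Qed.

Lemma cubeZ n (d r L : R) (z : 'rV[R]_n) : 0 < d -> 0 < L -> d <= r / L -> cube L z -> cube r (d *: z).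
Proof.
rewrite /cube /= => d0 L0 dr zL.
rewrite mx_normZ (gtr0_norm d0).
have : d * L <= r by move: dr; rewrite ler_pdivlMr.
by apply: lt_le_trans; rewrite ltr_pM2l.
Qed.

(** Taylor's estimate for all derivatives up to order [k] at once, after zooming in at scale [d]. A
    derivative of the rescaled function gains a factor [d] while the order of vanishing drops by
    one, so induction handles the derivatives; the value itself is recovered from [g 0 = 0] and the
    mean value inequality. The cube of radius 5 leaves room for cutoffs that vanish beyond Euclidean
    norm 4. *)
Lemma taylor_scaled n k (O : set 'rV[R]_n) g : open O -> O 0 -> CC k O g -> Van k g ->
  exists C : R, 0 <= C /\ exists2 r : R, 0 < r & cube (5 * r) `<=` O /\
    forall d : R, 0 < d -> d <= r -> Bd k (@cube n 5) (fun z => g (d *: z)) (C * d ^+ k).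
Proof.
move=> oO O0 hg.
have /nbhs_ballP[r0 /= r00] : nbhs (0 : 'rV[R]_n) O by exact: open_nbhs_nbhs.
rewrite mx_norm_ball => H0.
have r0O : cube r0 `<=` O by move=> z; rewrite /cube/= => zr; apply: H0; rewrite /ball_/= sub0r normrN.
elim: k g hg => [|k IH] g hg vg.
  have [r1 r10 H1] := iffLR (continuous_rVP _ _) (CC_cont hg O0) 1 ltr01.
  exists (`|g 0| + 1); split; first by rewrite addr_ge0.
  exists (Num.min r0 r1 / 5); first by rewrite divr_gt0// lt_min r00.
  split.
    move=> z; rewrite /cube/= mulrC divfK// lt_min => /andP[zr _]; exact: r0O.
  move=> d d0 dr; split => // z z5.
  have dz : cube (Num.min r0 r1) (d *: z) by apply: cubeZ z5.
  have : `|g 0 - g (d *: z)| < 1.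
    by apply: H1; rewrite sub0r normrN; move: dz; rewrite /cube/= lt_min => /andP[].
  rewrite expr0 mulr1 distrC => h.
  rewrite -[g (d *: z)](subrK (g 0)) addrC; apply: le_trans (ler_normD _ _) _.
  by rewrite lerD2l ltW.
have [g0 vgi] := vg.
have /choice[C hC] : forall i, exists C : R, 0 <= C /\ exists2 r : R, 0 < r & cube (5 * r) `<=` O /\
    forall d : R, 0 < d -> d <= r -> Bd k (@cube n 5) (fun z => pd i g (d *: z)) (C * d ^+ k).
  by move=> i; exact: IH (CC_pd i hg) (vgi i).
pose D := \sum_i C i.
have D0 : 0 <= D by rewrite sumr_ge0// => i _; have [] := hC i.
have CD i : C i <= D.
  by rewrite /D (bigD1 i)//= lerDl sumr_ge0// => j _; have [] := hC j.
have [r1 r10 H1] := @fin_min_pos 'I_n (fun i r =>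
    forall d : R, 0 < d -> d <= r -> Bd k (@cube n 5) (fun z => pd i g (d *: z)) (C i * d ^+ k))
  (fun i r r' h r'0 r'r d d0 dr => h d d0 (le_trans dr r'r))
  (fun i => let: conj _ (ex_intro2 r a (conj _ b)) := hC i in ex_intro2 _ _ r a b).
pose r := Num.min (r0 / 5) r1.
have rO : cube (5 * r) `<=` O.
  move=> z; rewrite /cube/= => zr; apply: r0O; apply: lt_le_trans zr _.
  by rewrite mulrC -ler_pdivlMr// /r ge_min lexx.
(* The part [5 n] comes from the mean value inequality on the cube of radius 5; the added 1 makes
   the constant dominate the bound [D] on the derivatives. *)
exists ((5 * n%:R + 1) * D); split; first by rewrite mulr_ge0// addr_ge0// mulr_ge0.
exists r; first by rewrite lt_min r10 divr_gt0.
split=> // d d0 dr.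
have sub z : cube 5 z -> O (d *: z + 0).
  rewrite addr0 => z5; apply: rO; apply: cubeZ z5 => //.
  by rewrite mulrAC divff// mul1r.
have gE (f : 'rV[R]_n -> R) : (fun z => f (d *: z)) = (fun z => f (d *: z + 0)).
  by apply/funext => z; rewrite addr0.
have pE i z : cube 5 z -> pd i (fun z => g (d *: z)) z = d * pd i g (d *: z).
  by move=> z5; rewrite gE (pd_affine i hg (sub z z5)) addr0 mulrC.
have cgd : CC k.+1 (@cube n 5) (fun z => g (d *: z)).
  by rewrite gE; apply: CC_affine hg sub; exact: open_cube.
have bpd i : Bd k (@cube n 5) (pd i (fun z => g (d *: z))) (D * d ^+ k.+1).
  apply: (@Bd_ext _ _ _ (fun z => d * pd i g (d *: z))) => [|y y5|]; first exact: open_cube.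
    by rewrite pE.
  have rr1 : r <= r1 by rewrite /r ge_min lexx orbT.
  have b := H1 i d d0 (le_trans dr rr1).
  have ccp : CC k (@cube n 5) (fun z => pd i g (d *: z)).
    by rewrite gE; apply: CC_affine (CC_pd i hg) sub; exact: open_cube.
  apply: Bd_le (Bd_scale d (@open_cube n 5) ccp b).
  rewrite (gtr0_norm d0) mulrCA -exprS ler_wpM2r//.
  by rewrite exprn_ge0// ltW.
split=> [z z5|i].
  have := @mv_ineq n (@cube n 5) (fun z => g (d *: z)) 0 z (D * d ^+ k.+1)
    (CC_leq (ltn0Sn _) cgd).
  rewrite addr0 scaler0 g0 subr0 => h; apply: le_trans (h _) _.
    move=> z'; rewrite subr0 => zz; have z'5 : cube 5 z' by exact: le_lt_trans zz z5.
    by split => // i; exact: (Bd_val (bpd i)).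
  rewrite -mulrA; apply: (@le_trans _ _ (n%:R * (D * d ^+ k.+1 * 5))).
    by rewrite ler_wpM2l// ler_wpM2l ?mulr_ge0 ?exprn_ge0 ?(ltW d0)// ltW.
  have : 0 <= D * d ^+ k.+1 by rewrite mulr_ge0 ?exprn_ge0 ?(ltW d0).
  by move=> X0; rewrite -[leRHS]mulrA; move: (D * d ^+ k.+1) X0 => X X0; lra.
apply: Bd_le (bpd i); rewrite -mulrA ler_peMl ?mulr_ge0 ?exprn_ge0 ?(ltW d0)//.
by rewrite lerDr mulr_ge0.
Qed.

(** [taylor_scaled] at scale [|y|], evaluated at the unit vector [y / |y|]. *)
Lemma taylor_pointwise n k (O : set 'rV[R]_n) g : open O -> O 0 -> CC k O g -> Van k g ->
  exists C : R, 0 <= C /\ exists2 r : R, 0 < r & cube r `<=` O /\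
    forall y, `|y| < r -> `|g y| <= C * `|y| ^+ k.
Proof.
move=> oO O0 hg vg; have [C [C0 [r r0 [rO H]]]] := taylor_scaled oO O0 hg vg.
(* The summand [|g 0|] covers [y = 0] when [k = 0], where no positive scale is available. *)
exists (C + `|g 0|); split; first by rewrite addr_ge0.
exists r => //; split.
  by move=> z; rewrite /cube/= => zr; apply: rO; apply: lt_le_trans zr _; lra.
move=> y yr; have [->|y0] := eqVneq y 0.
  rewrite normr0; case: k {hg H} vg => [|k] vg; first by rewrite expr0 mulr1 lerDr.
  by have [-> _] := vg; rewrite normr0 expr0n/= mulr0.
have ny0 : 0 < `|y| by rewrite normr_gt0.
have := Bd_val (H `|y| ny0 (ltW yr)) (x := `|y|^-1 *: y).
rewrite scalerA divff ?gt_eqF// scale1r => h; apply: le_trans (h _) _.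
  by rewrite /cube/= mx_normZ normfV normr_id mulVf ?gt_eqF// ltr1n.
by rewrite ler_wpM2r ?exprn_ge0// lerDl.
Qed.

Lemma Dsq_open n (O : set 'rV[R]_n) (s : seq 'I_n) f g : open O ->
  (forall y, O y -> f y = g y) -> forall y, O y -> Dsq s f y = Dsq s g y.
Proof.
move=> oO fg; elim: s => [|i s IH] y Oy /=; first exact: fg.
exact: (pd_open i oO IH Oy).
Qed.

Lemma Dsq_swap n (O : set 'rV[R]_n) (s : seq 'I_n) i j f : open O ->
  CC (size s).+2 O f -> forall y, O y -> Dsq (i :: j :: s) f y = Dsq (j :: i :: s) f y.
Proof.
move=> oO hf y Oy /=; apply: (schwarz i j oO _ Oy).
by apply: CC_Dsq; rewrite addn2.
Qed.

(** [Dmulti] differentiates along a sorted list of directions, whereas derivatives are met along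
    arbitrary lists. The head of [s] is brought to the front of [t] by adjacent exchanges. *)
Lemma Dsq_perm n (O : set 'rV[R]_n) (s t : seq 'I_n) f : open O -> perm_eq s t ->
  CC (size s) O f -> forall y, O y -> Dsq s f y = Dsq t f y.
Proof.
move=> oO; elim: {s}(size s) {-2}s (leqnn (size s)) t => [|N IH] s sN t.
  case: s sN => // _; rewrite perm_sym => /perm_nilP -> //.
case: s sN => [|i s] sN; first by rewrite perm_sym => /perm_nilP ->.
move=> pst hf y Oy.
have it : i \in t by rewrite -(perm_mem pst) mem_head.
have sE : size (i :: s) = size t := perm_size pst.
have front : forall t : seq 'I_n, i \in t -> CC (size t) O f -> forall y, O y ->
    Dsq t f y = Dsq (i :: rem i t) f y.
  elim=> // j t' IHt jt ct z Oz.
  rewrite /rem -/(rem i t'); have [->//|ji] := eqVneq j i.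
  have it' : i \in t' by move: jt; rewrite in_cons eq_sym (negbTE ji).
  have ct' : CC (size t') O f by exact: CC_leq ct.
  transitivity (Dsq (j :: i :: rem i t') f z).
    by apply: (pd_open j oO _ Oz) => w Ow; exact: IHt.
  apply: (Dsq_swap j i oO _ Oz); apply: CC_leq ct => /=.
  by rewrite size_rem//; case: t' it' {IHt jt ct'}.
rewrite (front t it _ y Oy); last by rewrite -sE.
have prem : perm_eq s (rem i t).
  by rewrite -(perm_cons i) (permPl pst) perm_to_rem.
apply: (pd_open i oO _ Oy) => z Oz; apply: IH => //.
by exact: CC_leq hf => /=.
Qed.

End Bounds.

(** * Integration by parts *)


Section IBP.
Variable R : realType.
Implicit Types (n k m : nat).

Lemma cvg_inv_succ : (fun j : nat => j.+1%:R^-1 : R) @ \oo --> (0 : R).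
Proof.
exact: cvg_harmonic.
Qed.

Lemma CC0_continuous n k (g : 'rV[R]_n -> R) : CC k setT g -> continuous g.
Proof. by move=> hg x; exact: (CC_cont hg). Qed.

Lemma bounded_supp n (g : 'rV[R]_n -> R) (M : R) : continuous g ->
  (forall x : 'rV[R]_n, M < `|x| -> g x = 0) -> exists2 C : R, 0 <= C & forall x, `|g x| <= C.
Proof.
move=> cg gM.
have cK : closed [set x : 'rV[R]_n | `|x| <= M].
  apply: (@closed_comp _ _ (fun y : 'rV[R]_n => `|y|) [set t | t <= M]).
    by move=> v _; exact: norm_continuous.
  exact: closed_le.
have [C C0 H] := @bounded_compact R n _ g M cK (fun x Kx => Kx) (fun x _ => cg x).
exists C => // x; case: (leP `|x| M) => h; first exact: H.
by rewrite gM// normr0.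
Qed.

Lemma L1_continuous_supp n (g : 'rV[R]_n -> R) (M : R) : 0 <= M -> continuous g ->
  (forall x : 'rV[R]_n, M < `|x| -> g x = 0) -> L1 g.
Proof.
move=> M0 cg gM; have [C C0 H] := bounded_supp cg gM.
by apply: L1_bounded_supp M0 _ H gM; exact: meas_continuous.
Qed.

Lemma pd_zero n (O : set 'rV[R]_n) g i : open O -> (forall x, O x -> g x = 0) ->
  forall x, O x -> pd i g x = 0.
Proof.
move=> oO g0 x Ox; rewrite (pd_open (g := fun=> 0) i oO _ Ox) ?pd_cst//.
Qed.

Lemma open_norm_gt n (M : R) : open [set x : 'rV[R]_n | M < `|x|].
Proof.
apply: (@open_comp _ _ (fun y : 'rV[R]_n => `|y|) [set t | M < t]).
  by move=> v _; exact: norm_continuous.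
exact: open_gt.
Qed.

(** Difference quotients have integral 0 by translation invariance. The mean value theorem bounds
    them uniformly, and steps of length at most 1 keep their support in the cube of radius [M + 1],
    so dominated convergence passes to the derivative. *)
Lemma Int_pd0 n (G : 'rV[R]_n -> R) i (M : R) : 0 <= M -> CC 1 setT G ->
  (forall x : 'rV[R]_n, M < `|x| -> G x = 0) -> Int (pd i G) = 0.
Proof.
move=> M0 hG GM.
have cp : continuous (pd i G) := CC0_continuous (CC_pd i hG).
have pM : forall x, M < `|x| -> pd i G x = 0 := pd_zero i (@open_norm_gt n M) GM.
have [C C0 H] := bounded_supp cp pM.
have iG : L1 G by apply: L1_continuous_supp M0 _ GM; exact: (CC0_continuous hG).
pose h (j : nat) : R := j.+1%:R^-1.
have h0 j : 0 < h j by rewrite invr_gt0.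
have h1 j : h j <= 1 by rewrite invf_le1// ler1n.
pose g j (x : 'rV[R]_n) := (h j)^-1 * (G (x + h j *: evec R i) - G x).
have mv j (x : 'rV[R]_n) : exists2 s : R, 0 <= s <= 1 & g j x = pd i G ((s * h j) *: evec R i + x).
  have [s hs E] := @line_mvt R n i G x (h j)
    (fun s hs => @CC_derivable _ _ _ _ _ hG _ i Logic.I).
  by exists s => //; rewrite /g [x + _]addrC E mulrA mulVf ?mul1r// gt_eqF.
have [||||_] := @Int_cvg R n g (pd i G) (fun x => C * boxi (M + 1) x).
- move=> j; apply: measM; first exact: meas_cst.
  by apply: measB; [apply: meas_translate|]; exact: L1_meas.
- by apply: L1Z; apply: L1_boxi; lra.
- move=> j x; rewrite /boxi; case: (leP `|x| (M + 1)) => hx.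
    by rewrite mulr1; have [s hs ->] := mv j x.
  have xM : M < `|x| by lra.
  rewrite /g (GM x)// (GM (x + _)) ?subrr ?mulr0 ?normr0//.
  have : `|h j *: evec R i| <= 1.
    by apply: le_trans (evecZ_norm _ _) _; rewrite gtr0_norm.
  have : `|x| <= `|x + h j *: evec R i| + `|h j *: evec R i|.
    by rewrite -{1}[x](addrK (h j *: evec R i)); apply: le_trans (ler_normB _ _) _.
  by lra.
- move=> x; apply/cvgrPdist_lt => e e0.
  have [d d0 Hd] := iffLR (continuous_rVP _ _) (cp x) e e0.
  have : \forall j \near \oo, h j < d.
    have /cvgrPdist_lt /(_ d d0) := cvg_inv_succ.
    by apply: filterS => j /=; rewrite sub0r normrN gtr0_norm.
  apply: filterS => j hj; have [s /andP[s0 s1] ->] := mv j x.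
  apply: Hd; rewrite opprD addrCA subrr addr0 normrN.
  apply: le_lt_trans (evecZ_norm _ _) _.
  rewrite ger0_norm ?mulr_ge0// ?(ltW (h0 j))//; apply: le_lt_trans hj.
  by rewrite ler_piMl// ltW.
have E j : Int (g j) = 0.
  rewrite IntZ; last by apply: L1B => //; exact: L1_translate.
  by rewrite IntB ?Int_translate ?subrr ?mulr0//; exact: L1_translate.
rewrite (_ : (fun j => Int (g j)) = fun=> 0); last exact/funext.
by move=> /(cvg_lim (@Rhausdorff R)) <-; rewrite lim_cst.
Qed.

(** The bounded closed set is kept as an explicit parameter because derivatives of [h], and products
    with [h], keep the same one. *)
Definition csupp n (O K : set 'rV[R]_n) (h : 'rV[R]_n -> R) : Prop :=
  [/\ closed K, K `<=` O, (exists M : R, forall x, K x -> `|x| <= M) &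
      forall x, ~ K x -> h x = 0].

Lemma csupp_bound n (O K : set 'rV[R]_n) h : csupp O K h ->
  exists2 M : R, 0 <= M & forall x, M < `|x| -> ~ K x.
Proof.
move=> [_ _ [M HM] _]; exists `|M| => // x Mx Kx.
have := HM x Kx; have := ler_norm M; lra.
Qed.

Lemma csupp_pd n (O K : set 'rV[R]_n) h i : csupp O K h -> csupp O K (pd i h).
Proof.
move=> [cK KO bK h0]; split => // x nK.
by apply: (@pd_zero n (~` K)) nK => //; exact: closed_openC.
Qed.

Lemma csupp_mlap n (O K : set 'rV[R]_n) h : csupp O K h -> csupp O K (mlap h).
Proof.
move=> hh; have [cK KO bK h0] := hh; split => // x nK; rewrite mlapE big1 ?oppr0// => i _.
by have [_ _ _] := csupp_pd i (csupp_pd i hh); apply.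
Qed.

Lemma csupp_plm n m (O K : set 'rV[R]_n) h : csupp O K h -> csupp O K (plm m h).
Proof. by move=> hh; elim: m => //= m IH; exact: csupp_mlap. Qed.

Lemma csupp_mulr n (O K : set 'rV[R]_n) g h : csupp O K h -> csupp O K (fun x => g x * h x).
Proof. by move=> [cK KO bK h0]; split => // x nK; rewrite h0 ?mulr0. Qed.

Lemma csupp_CC n k (O K : set 'rV[R]_n) h : open O -> csupp O K h -> CC k O h -> CC k setT h.
Proof. by move=> oO [cK KO bK h0] ch; exact: CC_glue oO cK KO ch h0. Qed.

Lemma csupp_L1 n (O K : set 'rV[R]_n) h : open O -> csupp O K h -> CC 0 O h -> L1 h.
Proof.
move=> oO hh ch; have [M M0 HM] := csupp_bound hh.
apply: L1_continuous_supp M0 _ _; first exact: CC0_continuous (csupp_CC oO hh ch).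
by move=> x /HM nK; have [_ _ _] := hh; apply.
Qed.

(** The function [g] may be arbitrary off [O]: there [h] and its derivative vanish, so the product
    [g h] is a globally [C^1] function with compact support, to which [Int_pd0] applies. *)
Lemma ibp n (O K : set 'rV[R]_n) g h i : open O -> csupp O K h ->
  CC 1 O g -> CC 1 O h ->
  Int (fun x => pd i g x * h x) = - Int (fun x => g x * pd i h x).
Proof.
move=> oO hh cg ch.
have hG := csupp_mulr g hh.
have cG : CC 1 setT (fun x => g x * h x) by exact: (csupp_CC oO hG (CC_mul oO cg ch)).
have [M M0 HM] := csupp_bound hh.
have := Int_pd0 i M0 cG (fun x Mx => (let: And4 _ _ _ e := hG in e) x (HM x Mx)).
have i1 : L1 (fun x => g x * pd i h x).
  apply: (csupp_L1 oO (csupp_mulr g (csupp_pd i hh))).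
  exact: (CC_mul oO (CC_S cg) (CC_pd i ch)).
have i2 : L1 (fun x => pd i g x * h x).
  apply: (csupp_L1 oO (csupp_mulr (pd i g) hh)).
  exact: (CC_mul oO (CC_pd i cg) (CC_S ch)).
rewrite (eq_Int (h := fun x => g x * pd i h x + pd i g x * h x)) => [|x].
  by rewrite IntD// addrC => /eqP; rewrite addr_eq0 => /eqP.
have [Ox|nO] := pselect (O x).
  by rewrite (pd_mul i cg ch Ox) [h x * _]mulrC.
have nK : ~ K x by move=> Kx; apply: nO; have [_ + _ _] := hh; apply.
have [_ _ _ ->//] := csupp_pd i hG; have [_ _ _ ->//] := csupp_pd i hh.
by have [_ _ _ ->//] := hh; rewrite !mulr0 addr0.
Qed.

Lemma green n (O K : set 'rV[R]_n) g h : open O -> csupp O K h ->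
  CC 2 O g -> CC 2 O h ->
  Int (fun x => g x * mlap h x) = Int (fun x => mlap g x * h x).
Proof.
move=> oO hh cg ch.
have L1l i : L1 (fun x => g x * pd i (pd i h) x).
  apply: (csupp_L1 oO (csupp_mulr g (csupp_pd i (csupp_pd i hh)))).
  exact: (CC_mul oO (CC_leq (isT : (0 <= 2)%N) cg) (CC_pd i (CC_pd i ch))).
have L1r i : L1 (fun x => pd i (pd i g) x * h x).
  apply: (csupp_L1 oO (csupp_mulr _ hh)).
  exact: (CC_mul oO (CC_pd i (CC_pd i cg)) (CC_leq (isT : (0 <= 2)%N) ch)).
rewrite (eq_Int (h := fun x => - \sum_i (g x * pd i (pd i h) x))) => [|x]; last first.
  by rewrite mlapE mulrN mulr_sumr.
rewrite [RHS](eq_Int (h := fun x => - \sum_i (pd i (pd i g) x * h x))) => [|x]; last first.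
  by rewrite mlapE mulNr mulr_suml.
rewrite !IntN; [|exact: L1_sum|exact: L1_sum].
rewrite !Int_sum//; congr (- _); apply: eq_bigr => i _.
have e1 := ibp i oO hh (CC_pd i cg) (CC_S ch).
have e2 := ibp i oO (csupp_pd i hh) (CC_S cg) (CC_pd i ch).
by rewrite e1 e2 opprK.
Qed.

Lemma ibp_plm n m (O K : set 'rV[R]_n) g h : open O -> csupp O K h ->
  CC (2 * m) O g -> CC (2 * m) O h ->
  Int (fun x => g x * plm m h x) = Int (fun x => plm m g x * h x).
Proof.
move=> oO; elim: m h => [|m IH] h hh cg ch //.
rewrite plmSr IH; [|exact: csupp_mlap|by apply: CC_leq cg; lia|].
- apply: (green oO hh); last by apply: CC_leq ch; lia.
  by apply: CC_plm => //; apply: CC_leq cg; lia.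
- by apply: CC_mlap => //; apply: CC_leq ch; lia.
Qed.

End IBP.

(** * Smooth functions of one variable *)


Section OneDim.
Variable R : realType.
Implicit Types (k j : nat) (U : set R) (F G : R -> R).

Lemma C1_cst k U (c : R) : open U -> C1 k U (fun=> c).
Proof.
move=> oU; elim: k c => [|k IH] c; first by split=> // x _; exact: cst_continuous.
by apply: (@C1_intro _ _ _ _ (fun=> 0)).
Qed.

Lemma C1_id k U : open U -> C1 k U id.
Proof.
move=> oU; case: k => [|k]; first by split=> // x _; exact: cvg_id.
apply: (@C1_intro _ _ _ _ (fun=> 1)) => //; exact: C1_cst.
Qed.

Lemma C1_add k U F G : open U -> C1 k U F -> C1 k U G -> C1 k U (fun t => F t + G t).
Proof.
move=> oU; elim: k F G => [|k IH] F G hF hG.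
  split=> // x Ux; apply: (@continuousD _ _ _ F G x).
    exact: (C1_cont hF).
  exact: (C1_cont hG).
apply: (@C1_intro _ _ _ _ (fun t => derive1 F t + derive1 G t) oU).
  move=> t Ut; apply: (@is_deriveD _ _ _ F G); [exact: C1_is_derive hF Ut|exact: C1_is_derive hG Ut].
by apply: IH; exact: C1_derive.
Qed.

Lemma C1_mul k U F G : open U -> C1 k U F -> C1 k U G -> C1 k U (fun t => F t * G t).
Proof.
move=> oU; elim: k F G => [|k IH] F G hF hG.
  split=> // x Ux; apply: (@continuousM _ _ F G x).
    exact: (C1_cont hF).
  exact: (C1_cont hG).
apply: (@C1_intro _ _ _ _ (fun t => F t * derive1 G t + G t * derive1 F t) oU).
  move=> t Ut; apply: (@is_deriveM _ _ F G); [exact: C1_is_derive hF Ut|exact: C1_is_derive hG Ut].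
by apply: C1_add => //; apply: IH; first [exact: C1_derive|exact: C1_S].
Qed.

Lemma C1_scale k U (c : R) F : open U -> C1 k U F -> C1 k U (fun t => c * F t).
Proof. by move=> oU hF; apply: C1_mul => //; exact: C1_cst. Qed.

Lemma C1_comp k U V F G : open U -> C1 k V F -> C1 k U G -> (forall t, U t -> V (G t)) ->
  C1 k U (fun t => F (G t)).
Proof.
move=> oU; elim: k F => [|k IH] F hF hG GV.
  split=> // x Ux; apply: (@continuous_comp _ _ _ G F x).
    exact: (C1_cont hG).
  exact: (C1_cont hF (GV x Ux)).
apply: (@C1_intro _ _ _ _ (fun t => derive1 F (G t) * derive1 G t) oU).
  move=> t Ut; apply: is_derive1_comp; last exact: C1_is_derive hG Ut.
  exact: C1_is_derive hF (GV t Ut).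
apply: C1_mul => //; last exact: C1_derive.
by apply: IH => //; [exact: C1_derive|exact: C1_S].
Qed.

Lemma C1_expR k : C1 k setT (@expR R).
Proof.
elim: k => [|k IH]; first by split=> // t _; exact: continuous_expR.
by apply: (@C1_intro _ _ _ _ (@expR R)) => //; exact: openT.
Qed.

Lemma open_pos : open [set t : R | 0 < t].
Proof. exact: open_gt. Qed.

Lemma is_derive_inv (t : R) : t != 0 -> is_derive t 1 (fun s : R => s^-1) (- (t^-1 * t^-1)).
Proof.
move=> t0; have := @is_deriveV R id t 1 1 t0 (is_derive_id _ _).
by move=> /is_derive_eq; apply; rewrite -exprVn expr2 scaleNr [_ *: _]mulr1.
Qed.

Lemma C1_inv k : C1 k [set t : R | 0 < t] (fun t => t^-1).
Proof.
elim: k => [|k IH].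
  by split=> // t t0; apply: continuousV; [rewrite gt_eqF|exact: cvg_id].
apply: (@C1_intro _ _ _ _ (fun t => -1 * (t^-1 * t^-1)) open_pos).
  by move=> t t0; rewrite mulN1r; apply: is_derive_inv; rewrite gt_eqF.
by apply: C1_scale; [exact: open_pos|apply: C1_mul => //; exact: open_pos].
Qed.

Lemma C1_ln k : C1 k [set t : R | 0 < t] (@ln R).
Proof.
case: k => [|k]; first by split=> // t t0; exact: continuous_ln.
apply: (@C1_intro _ _ _ _ (fun t => t^-1) open_pos).
exact: C1_inv.
Qed.

Lemma is_derive_flat (f : R -> R) (C : R) : f 0 = 0 -> 0 <= C ->
  (forall t : R, `|t| <= 1 -> `|f t| <= C * t ^+ 2) -> is_derive (0 : R) 1 f 0.
Proof.
move=> f0 C0 H.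
have cv : (fun h : R => h^-1 *: ((f \o shift 0) (h *: 1) - f 0)) @ (0 : R)^' --> (0 : R).
  apply/cvgrPdist_lt => e e0; near=> h.
  have h0 : h != 0 by near: h; exact: nbhs_dnbhs_neq.
  rewrite /= f0 subr0 addr0 sub0r normrN [_%:A]mulr1 [_ *: _]/(_ * _) normrM normfV.
  have h1 : `|h| <= 1 by near: h; apply: dnbhs0_le.
  rewrite mulrC ltr_pdivrMr ?normr_gt0//.
  apply: le_lt_trans (H h h1) _.
  rewrite -real_normK ?num_real// expr2 mulrA ltr_pM2r ?normr_gt0//.
  apply: (@le_lt_trans _ _ ((C + 1) * `|h|)).
    by rewrite ler_wpM2r// lerDl.
  rewrite mulrC -ltr_pdivlMr; last by lra.
  near: h; apply: dnbhs0_lt; rewrite divr_gt0//; lra.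
split; first by apply/cvg_ex; exists 0.
exact: (cvg_lim (@Rhausdorff R) cv).
Unshelve. all: by end_near. Qed.

Lemma is_derive_near (f g : R -> R) (t d : R) U : open U -> U t ->
  (forall s, U s -> f s = g s) -> is_derive t 1 f d -> is_derive t 1 g d.
Proof.
move=> oU Ut fg; apply: near_eq_is_derive.
have : nbhs t U by exact: open_nbhs_nbhs.
by apply: filterS => s; exact: fg.
Qed.

Lemma open_neg : open [set t : R | t < 0].
Proof. exact: open_lt. Qed.

(** Extension by zero to the left: the quadratic bound makes the derivative at 0 exist and vanish.
    Common source of the derivatives of [posp] and [flat]. *)
Lemma is_derive_pospart (f df : R -> R) (C : R) : 0 <= C ->
  (forall t : R, 0 < t -> is_derive t 1 f (df t)) ->
  (forall t : R, 0 < t -> t <= 1 -> `|f t| <= C * t ^+ 2) ->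
  forall t : R, is_derive t 1 (fun s : R => if 0 < s then f s else 0)
                          (if 0 < t then df t else 0).
Proof.
move=> C0 hf hC t; case: (ltgtP 0 t) => t0.
- apply: (is_derive_near open_pos t0) (hf t t0) => s /= s0; by rewrite s0.
- have : is_derive t 1 (fun=> 0 : R) 0 by exact: is_derive_cst.
  by apply: (is_derive_near open_neg t0) => s /= s0; rewrite ltNge (ltW s0).
- rewrite -t0; apply: (@is_derive_flat _ C) => //; first by rewrite ltxx.
  move=> s s1; case: (ltP 0 s) => s0; last by rewrite normr0 mulr_ge0 ?sqr_ge0.
  by apply: hC => //; move: s1; rewrite gtr0_norm.
Qed.

Definition posp j (t : R) : R := if 0 < t then t ^+ j else 0.

Lemma posp_ge0 j t : 0 <= posp j t.
Proof. by rewrite /posp; case: ltP => // t0; rewrite exprn_ge0 ?ltW. Qed.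

Lemma is_derive_posp j (t : R) : is_derive t 1 (posp j.+2) (j.+2%:R * posp j.+1 t).
Proof.
have := @is_derive_pospart (fun s => s ^+ j.+2) (fun s => j.+2%:R * s ^+ j.+1) 1 ler01 _ _ t.
rewrite /posp (_ : j.+2%:R * (if _ then _ else _) = if 0 < t then j.+2%:R * t ^+ j.+1 else 0); last first.
  by case: ifP => // _; rewrite mulr0.
apply.
- move=> s s0; have := @is_deriveX R R id j.+2 s 1 1 (is_derive_id _ _).
  rewrite (_ : id ^+ j.+2 = (fun s : R => s ^+ j.+2)); last first.
    by apply/funext => u; elim: j.+2 => // i IHi; rewrite !exprS -IHi.
  by move=> /is_derive_eq; apply; rewrite [_ *: _]mulr1.
- move=> s s0 s1; rewrite mul1r ger0_norm ?exprn_ge0 ?(ltW s0)//.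
  by apply: ler_wiXn2l; rewrite ?(ltW s0).
Qed.

Lemma C1_posp k j : (k < j)%N -> C1 k setT (posp j).
Proof.
elim: k j => [|k IH] [|[|j]]// kj.
- split=> // t _; rewrite /posp.
  rewrite (_ : (fun _ => _) = (fun s : R => Num.max s 0)); last first.
    by apply/funext => s; rewrite expr1; case: (ltP 0 s).
  by apply: continuous_max; [exact: cvg_id|exact: cst_continuous].
- split=> // t _; apply/differentiable_continuous/derivable1_diffP.
  by case: (is_derive_posp j t).
- apply: (@C1_intro _ _ _ _ (fun t => j.+2%:R * posp j.+1 t)); first exact: openT.
    by move=> t _; exact: is_derive_posp.
  by apply: C1_scale; [exact: openT|exact: IH].
Qed.

(** The functions [t^(-j) exp(-1/t)], extended by zero, are stable under differentiation up to
    linear combinations; keeping [j] free makes smoothness an induction on the order. *)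
Definition flat j (t : R) : R := if 0 < t then t ^- j * expR (- t^-1) else 0.

(** From the term of degree [j + 2] in the series of [exp(1/t)]. *)
Lemma flat_bound j (t : R) : 0 < t -> `|t ^- j * expR (- t^-1)| <= (j.+2)`!%:R * t ^+ 2.
Proof.
move=> t0; rewrite ger0_norm ?mulr_ge0 ?expR_ge0 ?invr_ge0 ?exprn_ge0 ?(ltW t0)//.
rewrite expRN mulrC ler_pdivrMr ?exprn_gt0//.
have ti0 : 0 <= t^-1 by rewrite invr_ge0 ltW.
have h : t^-1 ^+ j.+2 / (j.+2)`!%:R <= expR t^-1.
  by apply: le_trans (expR_ge1Dxn j.+1 ti0); rewrite lerDr.
have f0 : 0 < (j.+2)`!%:R :> R by rewrite ltr0n fact_gt0.
have p0 : 0 < (j.+2)`!%:R * t ^+ j.+2 by rewrite mulr_gt0// exprn_gt0.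
rewrite -mulrA -exprD add2n -[leRHS]invrK lef_pV2 ?posrE ?invr_gt0 ?expR_gt0//.
by rewrite invfM mulrC -exprVn.
Qed.

Lemma is_derive_flat_fun j (t : R) :
  is_derive t 1 (flat j) (flat j.+2 t + (- j%:R) * flat j.+1 t).
Proof.
have := @is_derive_pospart (fun s => s ^- j * expR (- s^-1))
  (fun s => s ^- j.+2 * expR (- s^-1) + (- j%:R) * (s ^- j.+1 * expR (- s^-1)))
  (j.+2)`!%:R _ _ _ t.
have E : flat j.+2 t + - j%:R * flat j.+1 t = if 0 < t then
   t ^- j.+2 * expR (- t^-1) + (- j%:R) * (t ^- j.+1 * expR (- t^-1)) else 0.
  by rewrite /flat; case: ifP => // _; rewrite mulr0 addr0.
rewrite -E; apply => //.
- move=> s s0; have sn : s != 0 by rewrite gt_eqF.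
  have d1 : is_derive s 1 (fun s : R => s ^- j) (- j%:R * s ^- j.+1).
    have := @is_deriveX R R (fun s => s^-1) j s 1 _ (is_derive_inv sn).
    have -> : (fun s : R => s^-1) ^+ j = (fun s : R => s ^- j).
      by apply/funext => u; rewrite -exprVn; elim: j {E} => // i IHi; rewrite !exprS -IHi.
    move=> /is_derive_eq; apply.
    rewrite [LHS](_ : _ = j%:R * s^-1 ^+ j.-1 * - (s^-1 * s^-1))// -exprVn.
    case: j {E} => [|j] /=; first by rewrite !mul0r mulNr mul0r oppr0.
    by rewrite !exprS; ring.
  have d2 : is_derive s 1 (fun s : R => expR (- s^-1)) (expR (- s^-1) * (s^-1 * s^-1)).
    apply: (@is_derive1_comp _ expR (fun s => - s^-1)).
    have := @is_deriveN R R R (fun s => s^-1) s 1 _ (is_derive_inv sn).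
    by rewrite opprK.
  have := @is_deriveM R R (fun s : R => s ^- j) (fun s : R => expR (- s^-1)) s 1 _ _ d1 d2.
  move=> /is_derive_eq; apply.
  rewrite [LHS](_ : _ = s ^- j * (expR (- s^-1) * (s^-1 * s^-1)) +
    expR (- s^-1) * (- j%:R * s ^- j.+1))// -!exprVn !exprS.
  by ring.
- by move=> s s0 _; exact: flat_bound.
Qed.

Lemma C1_flat k j : C1 k setT (flat j).
Proof.
elim: k j => [|k IH] j.
  split=> // t _; apply/differentiable_continuous/derivable1_diffP.
  by case: (is_derive_flat_fun j t).
apply: (@C1_intro _ _ _ _ (fun t => flat j.+2 t + (- j%:R) * flat j.+1 t)); first exact: openT.
  by move=> t _; exact: is_derive_flat_fun.
by apply: C1_add; [exact: openT|exact: IH|apply: C1_scale; [exact: openT|exact: IH]].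
Qed.

Definition bmp (t : R) : R := flat 0 t.

Lemma bmpE t : bmp t = if 0 < t then expR (- t^-1) else 0.
Proof. by rewrite /bmp /flat expr0 invr1 mul1r. Qed.

Lemma bmp_ge0 t : 0 <= bmp t.
Proof. by rewrite bmpE; case: ifP => // _; exact: expR_ge0. Qed.

Lemma bmp_gt0 t : 0 < t -> 0 < bmp t.
Proof. by move=> t0; rewrite bmpE t0; exact: expR_gt0. Qed.

Lemma bmp_le0 t : t <= 0 -> bmp t = 0.
Proof. by move=> t0; rewrite bmpE ltNge t0. Qed.

Lemma bmp_mono s t : s <= t -> bmp s <= bmp t.
Proof.
move=> st; rewrite [bmp s]bmpE; case: (ltP 0 s) => s0; last exact: bmp_ge0.
have t0 : 0 < t by exact: lt_le_trans st.
by rewrite bmpE t0 ler_expR lerN2 lef_pV2.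
Qed.

(** A smooth transition from 1 on [t <= 0] to 0 on [t >= 1]: the inner [bmp] vanishes on the left,
    and on the right the outer argument is nonpositive because [bmp] is monotone. The denominator is
    a constant, so no quotient of functions has to be differentiated. *)
Definition step (t : R) : R := bmp (bmp 1 - bmp t) / bmp (bmp 1).

Lemma C1_step k : C1 k setT step.
Proof.
have oT := @openT R.
rewrite /step; apply: (C1_ext (F := fun t => (bmp (bmp 1))^-1 * bmp (bmp 1 + (-1) * bmp t))) => //.
  by move=> t _; rewrite mulN1r mulrC.
apply: C1_scale => //; apply: (@C1_comp _ _ setT) => //; first exact: C1_flat.
by apply: C1_add => //; [exact: C1_cst|apply: C1_scale => //; exact: C1_flat].
Qed.

Lemma step_le0 t : t <= 0 -> step t = 1.
Proof.
by move=> t0; rewrite /step (bmp_le0 t0) subr0 divff// gt_eqF// bmp_gt0// bmp_gt0.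
Qed.

Lemma step_ge1 t : 1 <= t -> step t = 0.
Proof.
by move=> t1; rewrite /step bmp_le0 ?mul0r// subr_le0; exact: bmp_mono.
Qed.

Lemma step_bnd t : 0 <= step t <= 1.
Proof.
have p : 0 < bmp (bmp 1) by rewrite !bmp_gt0.
rewrite /step divr_ge0 ?bmp_ge0//= ler_pdivrMr// mul1r; apply: bmp_mono.
by rewrite lerBlDr lerDl bmp_ge0.
Qed.

End OneDim.

(** * The fundamental solution *)


Section Radial.
Variable R : realType.
Implicit Types (n k m : nat).

(** The squared norm is a polynomial, hence smooth also at the origin; radial functions are
    therefore written in the variable $t=|x|^2$. *)
Definition qf n (x : 'rV[R]_n) : R := \sum_i x 0 i ^+ 2.

Lemma qf_ge0 n (x : 'rV[R]_n) : 0 <= qf x.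
Proof. by apply: sumr_ge0 => i _; exact: sqr_ge0. Qed.

Lemma enormE n (x : 'rV[R]_n) : enorm x = Num.sqrt (qf x).
Proof. by []. Qed.

Lemma enorm_ge0 n (x : 'rV[R]_n) : 0 <= enorm x.
Proof. exact: sqrtr_ge0. Qed.

Lemma enorm_sqr n (x : 'rV[R]_n) : enorm x ^+ 2 = qf x.
Proof. by rewrite enormE sqr_sqrtr// qf_ge0. Qed.

Lemma norm_le_enorm n (x : 'rV[R]_n) : `|x| <= enorm x.
Proof.
apply: mx_norm_coord_le => [|i]; first exact: enorm_ge0.
rewrite enormE -sqrtr_sqr ler_wsqrtr// /qf (bigD1 i)//= lerDl.
by apply: sumr_ge0 => j _; exact: sqr_ge0.
Qed.

Lemma enorm_le_norm n (x : 'rV[R]_n) : enorm x <= n%:R * `|x|.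
Proof.
rewrite -[leRHS]ger0_norm ?mulr_ge0// -sqrtr_sqr enormE ler_wsqrtr//.
apply: (@le_trans _ _ (\sum_(i < n) `|x| ^+ 2)).
  by apply: ler_sum => i _; rewrite -real_normK ?num_real// lerXn2r// ?nnegrE// coord_le_mx_norm.
rewrite sumr_const card_ord -[X in X <= _]mulr_natl exprMn ler_wpM2r ?sqr_ge0//.
by case: n x => [|n] x; rewrite ?expr0n// expr2 -natrM ler_nat leq_pmulr.
Qed.

Lemma enorm_eq0 n (x : 'rV[R]_n) : (enorm x == 0) = (x == 0).
Proof.
apply/eqP/eqP => [h|->].
  by apply/eqP; rewrite -normr_eq0 eq_le normr_ge0 andbT -h norm_le_enorm.
apply/eqP; rewrite eq_le enorm_ge0 andbT.
by have := enorm_le_norm (0 : 'rV[R]_n); rewrite normr0 mulr0.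
Qed.

Lemma enorm_gt0 n (x : 'rV[R]_n) : (0 < enorm x) = (x != 0).
Proof. by rewrite lt_def enorm_eq0 enorm_ge0 andbT. Qed.

Lemma qf_gt0 n (x : 'rV[R]_n) : (0 < qf x) = (x != 0).
Proof. by rewrite -enorm_sqr exprn_even_gt0 //= enorm_eq0. Qed.

Lemma qf0 n : qf (0 : 'rV[R]_n) = 0.
Proof. by rewrite /qf big1// => i _; rewrite mxE expr0n. Qed.

Lemma qfZ n (d : R) (x : 'rV[R]_n) : qf (d *: x) = d ^+ 2 * qf x.
Proof. by rewrite /qf mulr_sumr; apply: eq_bigr => i _; rewrite mxE exprMn. Qed.

Lemma qfN n (x : 'rV[R]_n) : qf (- x) = qf x.
Proof. by apply: eq_bigr => i _; rewrite mxE sqrrN. Qed.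

Lemma enormZ n (d : R) (x : 'rV[R]_n) : enorm (d *: x) = `|d| * enorm x.
Proof. by rewrite !enormE qfZ sqrtrM ?sqr_ge0// sqrtr_sqr. Qed.

Lemma CC_qf n k (O : set 'rV[R]_n) : open O -> CC k O (@qf n).
Proof.
move=> oO; apply: CC_sum => // i; apply: CC_exp => //; exact: CC_coord.
Qed.

Lemma is_derive_qf n (i : 'I_n) (x : 'rV[R]_n) : is_derive x (evec R i) (@qf n) (2 * x 0 i).
Proof.
rewrite [@qf n](_ : _ = \sum_(j < n) (fun y : 'rV[R]_n => y 0 j ^+ 2)); last first.
  by apply/funext => y; rewrite fct_sumE.
have -> : 2 * x 0 i = \sum_(j < n) (2 * x 0 j * (i == j)%:R).
  rewrite (bigD1 i)//= eqxx mulr1 big1 ?addr0// => j ji.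
  by rewrite eq_sym (negbTE ji) mulr0.
apply: is_derive_sum => j.
have := @is_deriveX R _ (fun y : 'rV[R]_n => y 0 j) 2 x (evec R i) _ (is_derive_coord i j x).
by rewrite expr1.
Qed.

Lemma continuous_qf n : continuous (@qf n).
Proof. exact: CC0_continuous (CC_qf 0 openT). Qed.

Lemma continuous_enorm n : continuous (@enorm R n).
Proof.
move=> x; apply: (@continuous_comp _ _ _ (@qf n) (@Num.sqrt R) x); first exact: continuous_qf.
exact: sqrt_continuous.
Qed.

Lemma open_enorm_lt n r : open [set x : 'rV[R]_n | enorm x < r].
Proof.
apply: (@open_comp _ _ (@enorm R n) [set t | t < r]); last exact: open_lt.
by move=> v _; exact: continuous_enorm.
Qed.

Lemma open_enorm_gt n r : open [set x : 'rV[R]_n | r < enorm x].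
Proof.
apply: (@open_comp _ _ (@enorm R n) [set t | r < t]); last exact: open_gt.
by move=> v _; exact: continuous_enorm.
Qed.

Lemma closed_enorm_le n r : closed [set x : 'rV[R]_n | enorm x <= r].
Proof.
apply: (@closed_comp _ _ (@enorm R n) [set t | t <= r]); last exact: closed_le.
by move=> v _; exact: continuous_enorm.
Qed.

Lemma closed_enorm_ge n r : closed [set x : 'rV[R]_n | r <= enorm x].
Proof.
apply: (@closed_comp _ _ (@enorm R n) [set t | r <= t]); last exact: closed_ge.
by move=> v _; exact: continuous_enorm.
Qed.

Definition punct n : set 'rV[R]_n := [set x | x != 0].

Lemma open_punct n : open (@punct n).
Proof.
rewrite (_ : @punct n = [set x | 0 < enorm x]); first exact: open_enorm_gt.
by apply/seteqP; split => x /=; rewrite /punct /= enorm_gt0.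
Qed.

Lemma open_pball n : open (@pball1 R n).
Proof.
rewrite (_ : @pball1 R n = [set x | enorm x < 1] `&` @punct n).
  by apply: openI; [exact: open_enorm_lt|exact: open_punct].
by apply/seteqP; split => x.
Qed.

Lemma CC_radial n k F : C1 k [set t : R | 0 < t] F -> CC k (@punct n) (fun x => F (qf x)).
Proof.
move=> hF; apply: CC_comp1 hF _ _; [exact: open_punct|apply: CC_qf; exact: open_punct|].
by move=> x; rewrite /punct/= qf_gt0.
Qed.

Lemma CC_radialT n k F : C1 k setT F -> CC k setT (fun x : 'rV[R]_n => F (qf x)).
Proof.
by move=> hF; apply: CC_comp1 hF _ _ => //; [exact: openT|apply: CC_qf; exact: openT].
Qed.

Lemma mlap_radial n (F F1 F2 : R -> R) (x : 'rV[R]_n) :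
  (forall t : R, 0 < t -> is_derive t 1 F (F1 t)) ->
  (forall t : R, 0 < t -> is_derive t 1 F1 (F2 t)) -> x != 0 ->
  mlap (fun x => F (qf x)) x = - (4 * (qf x) * F2 (qf x) + 2 * n%:R * F1 (qf x)).
Proof.
move=> h1 h2 x0; rewrite mlapE; congr (- _).
have e1 i (y : 'rV[R]_n) : y != 0 -> pd i (fun x => F (qf x)) y = F1 (qf y) * (2 * y 0 i).
  move=> y0; apply: pdP; apply: is_derive_comp1; first exact: is_derive_qf.
  by apply: h1; rewrite qf_gt0.
have e2 i : pd i (pd i (fun x => F (qf x))) x =
    4 * F2 (qf x) * (x 0 i ^+ 2) + 2 * F1 (qf x).
  rewrite (pd_open (g := fun y => F1 (qf y) * (2 * y 0 i)) i (@open_punct n) _ x0); last first.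
    by move=> y y0; exact: e1.
  apply: pdP.
  have d1 : is_derive x (evec R i) (fun y => F1 (qf y)) (F2 (qf x) * (2 * x 0 i)).
    by apply: is_derive_comp1; [exact: is_derive_qf|apply: h2; rewrite qf_gt0].
  have d2 := @is_deriveZ R _ _ (fun y : 'rV[R]_n => y 0 i) 2 x (evec R i) _ (is_derive_coord i i x).
  have := @is_deriveM R _ (fun y => F1 (qf y)) (fun y => 2 * y 0 i) x (evec R i) _ _ d1 d2.
  move=> /is_derive_eq; apply.
  rewrite eqxx [LHS](_ : _ = F1 (qf x) * (2 * 1) + (2 * x 0 i) * (F2 (qf x) * (2 * x 0 i)))//.
  by ring.
rewrite (eq_bigr _ (fun i _ => e2 i)) big_split /= -mulr_sumr sumr_const card_ord.
by rewrite -/(qf x) -mulr_natl; ring.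
Qed.

(** Real powers through the exponential, since the exponent $m-n/2$ of $|x|^2$ in the fundamental
    solution may be negative and half-integral. *)
Definition pw (p t : R) : R := expR (p * ln t).

Lemma pwB1 p (t : R) : 0 < t -> pw (p - 1) t = pw p t / t.
Proof. by move=> t0; rewrite /pw mulrBl mul1r expRB lnK. Qed.

Lemma is_derive_pw p (t : R) : 0 < t -> is_derive t 1 (pw p) (p * pw (p - 1) t).
Proof.
move=> t0; have h : is_derive t 1 (fun s => p * ln s) (p * t^-1).
  have := @is_deriveZ R R R (@ln R) p t 1 _ (is_derive1_ln t0).
  by [].
have := @is_derive1_comp R expR (fun s => p * ln s) t _ _ (is_derive_expR _) h.
move=> /is_derive_eq; apply.
by rewrite pwB1// /pw; ring.
Qed.

Lemma C1_pw k p : C1 k [set t : R | 0 < t] (pw p).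
Proof.
apply: (@C1_comp R k _ setT (@expR R) (fun t => p * ln t)) => //.
- exact: C1_expR.
- by apply: C1_scale; [exact: open_pos|exact: C1_ln].
Qed.

Lemma is_derive_cmul (a : R) (f : R -> R) (t d : R) : is_derive t 1 f d ->
  is_derive t 1 (fun s => a * f s) (a * d).
Proof. by move=> h; have := @is_deriveZ R R R f a t 1 _ h. Qed.

Lemma mlap_pw n p (x : 'rV[R]_n) : x != 0 ->
  mlap (fun x => pw p (qf x)) x = - (4 * p * (p - 1 + n%:R / 2)) * pw (p - 1) (qf x).
Proof.
move=> x0; have t0 : 0 < qf x by rewrite qf_gt0.
have h1 (t : R) : 0 < t -> is_derive t 1 (pw p) (p * pw (p - 1) t) by exact: is_derive_pw.
have h2 (t : R) : 0 < t ->
    is_derive t 1 (fun t => p * pw (p - 1) t) (p * ((p - 1) * pw (p - 1 - 1) t)).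
  by move=> t0'; apply: is_derive_cmul; exact: is_derive_pw.
rewrite (mlap_radial h1 h2 x0) pwB1//.
by have := gt_eqF t0; move: (qf x) => t /negbT tn; field.
Qed.

Lemma CC_pw n k p : CC k (@punct n) (fun x => pw p (qf x)).
Proof. exact/CC_radial/C1_pw. Qed.

Lemma plm_pw n j p (x : 'rV[R]_n) : x != 0 ->
  plm j (fun x => pw p (qf x)) x =
  (\prod_(i < j) (- (4 * (p - i%:R) * (p - i%:R - 1 + n%:R / 2)))) * pw (p - j%:R) (qf x).
Proof.
elim: j p x => [|j IH] p x x0; first by rewrite big_ord0 mul1r subr0.
rewrite plmSr.
rewrite (plm_eq j (@open_punct n) x0 (g := fun x => (- (4 * p * (p - 1 + n%:R / 2))) * pw (p - 1) (qf x))).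
  rewrite (plm_scale _ (@open_punct n) (CC_pw n _ _) x0) IH// big_ord_recl mulrA subr0.
  have E (i : nat) : p - 1 - i%:R = p - i.+1%:R by rewrite -natr1; ring.
  rewrite E; under eq_bigr do rewrite E.
  by under [in RHS]eq_bigr do rewrite lift0.
by move=> y y0; rewrite mlap_pw.
Qed.

Variables (m n : nat) (c : R).
Hypotheses (m0 : (0 < m)%N) (mn : (2 * m <= n)%N).

(** The profile of [phi] in the variable $t=|x|^2$, which halves the exponent $2m-n$ and puts the
    factor $-1/2$ before the logarithm. *)
Definition phiF (t : R) : R :=
  if (2 * m < n)%N then c * pw (m%:R - n%:R / 2) t else c * (ln 5 + (- 2^-1) * ln t).

Lemma sqrt_pw (t : R) : 0 < t -> Num.sqrt t = expR (ln t / 2).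
Proof.
move=> t0; rewrite -[RHS]ger0_norm ?expR_ge0// -sqrtr_sqr -expRM_natl.
by rewrite (_ : 2%:R * (ln t / 2) = ln t) ?lnK//; field.
Qed.

Lemma fundsolE (x : 'rV[R]_n) : x != 0 -> fundsol m n c x = phiF (qf x).
Proof.
rewrite -qf_gt0 /fundsol /phiF enormE => t0; case: ifP => mn'; congr (c * _).
  rewrite sqrt_pw// -expRM_natl -expRN /pw; congr expR.
  by rewrite natrB// natrM; field.
rewrite ln_div ?posrE ?sqrtr_gt0// sqrt_pw// expRK; by field.
Qed.

Lemma C1_phiF k : C1 k [set t : R | 0 < t] phiF.
Proof.
have op := @open_pos R; rewrite /phiF.
case: (2 * m < n)%N; apply: C1_scale => //.
  exact: C1_pw.
apply: C1_add => //; first exact: C1_cst.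
by apply: C1_scale => //; exact: C1_ln.
Qed.

Lemma CC_phi k : CC k (@punct n) (fundsol m n c).
Proof.
apply: CC_ext (CC_radial n (C1_phiF k)); first exact: open_punct.
by move=> y y0; rewrite fundsolE.
Qed.

(** For $n>2m$ the product in [plm_pw] contains, at [i = m - 1], the factor $(m-n/2)-(m-1)-1+n/2=0$.
    For $n=2m$ one Laplacian turns $\ln t$ into $(4-2n)/t$: this is 0 if [m = 1], and otherwise the
    factor at [i = m - 2] of the remaining product vanishes. *)
Lemma plm_phi (x : 'rV[R]_n) : x != 0 -> plm m (fundsol m n c) x = 0.
Proof.
move=> x0; have op := @open_punct n.
rewrite (plm_eq m op x0 (g := fun x => phiF (qf x))); last by move=> y y0; rewrite fundsolE.
rewrite /phiF; case: (boolP (2 * m < n)%N) => mn'.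
  rewrite (plm_scale _ op (CC_pw _ _ _) x0) plm_pw//.
  have -> : m = m.-1.+1 by rewrite prednK.
  rewrite big_ord_recr /= (_ : _ - 1 + _ = 0); first by rewrite mulr0 oppr0 mulr0 mul0r mulr0.
  by rewrite -natr1; field.
have nE : n = (2 * m)%N by apply/eqP; rewrite eqn_leq mn leqNgt (negbTE mn').
have hl k : CC k (@punct n) (fun x => ln (qf x)) by exact: CC_radial (@C1_ln R k).
rewrite (plm_scale _ op) //; last first.
  apply: CC_add => //; first exact: CC_cst.
  by apply: CC_scale.
rewrite (plm_add op (CC_cst _ _ op) (CC_scale _ op (hl _)) x0).
rewrite (plm_scale _ op (hl _) x0).
have z1 : plm m (fun=> ln 5) x = 0.
  rewrite -(prednK m0) plmSr; apply: (plm_zero _ (@openT 'rV[R]_n)) => // y _.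
  rewrite mlapE big1 ?oppr0// => i _.
  rewrite (pd_open (g := fun=> 0) i (@openT 'rV[R]_n)) ?pd_cst// => z _; exact: pd_cst.
have z2 : plm m (fun x : 'rV[R]_n => ln (qf x)) x = 0.
  rewrite -(prednK m0) plmSr.
  rewrite (plm_eq _ op x0 (g := fun x => (4 - 2 * n%:R) * pw (-1) (qf x))).
    rewrite (plm_scale _ op (CC_pw _ _ _) x0) plm_pw//.
    have nR : n%:R = 2 * m%:R :> R by rewrite {1}nE natrM.
    case: (m) m0 nR => // -[|m'] _ nR; rewrite nR.
      by rewrite (_ : 4 - _ = 0) ?mul0r//; ring.
    rewrite big_ord_recr /= (_ : _ - 1 + _ = 0); first by rewrite mulr0 oppr0 mulr0 mul0r mulr0.
    by rewrite -[m'.+2%:R]natr1 -[m'.+1%:R]natr1; field.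
  move=> y y0; have ty : 0 < qf y by rewrite qf_gt0.
  rewrite (mlap_radial (fun t t0 => is_derive1_ln t0)
    (fun t (t0 : 0 < t) => is_derive_inv (lt0r_neq0 t0)) y0).
  rewrite /pw mulN1r expRN lnK//; have := gt_eqF ty; move: (qf y) => t /negbT tn; by field.
by rewrite z1 z2 mulr0 addr0 mulr0.
Qed.

Lemma fundsolN (x : 'rV[R]_n) : fundsol m n c (- x) = fundsol m n c x.
Proof. by rewrite /fundsol !enormE qfN. Qed.

Lemma fundsolZ (d : R) (z : 'rV[R]_n) : 0 < d -> z != 0 ->
  fundsol m n c (d *: z) = (d ^+ (n - 2 * m))^-1 * fundsol m n c z +
    (if (2 * m < n)%N then 0 else c * (- ln d)).
Proof.
move=> d0 z0; rewrite /fundsol enormZ (gtr0_norm d0); case: ifP => mn'.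
  by rewrite addr0 exprMn invfM; ring.
have -> : (n - 2 * m = 0)%N by apply/eqP; rewrite subn_eq0 leqNgt mn'.
have e0 : 0 < enorm z by rewrite enorm_gt0.
rewrite expr0 invr1 mul1r -mulrDr; congr (c * _).
rewrite !ln_div ?posrE ?mulr_gt0// lnM ?posrE//; by ring.
Qed.

End Radial.


(** * Integrability of the singularity of the fundamental solution *)

Section Singular.
Variable R : realType.
Implicit Types (n k m : nat).

(** One majorant for both forms of [phi]: the power has exponent $n-2m\le n-1$, and the logarithm is
    bounded by a multiple of $1/|x|$ with $1\le n-1$. It is still locally integrable. *)
Definition sing n (x : 'rV[R]_n) : R := (`|x| ^+ n.-1)^-1.

Lemma sing_ge0 n (x : 'rV[R]_n) : 0 <= sing x.
Proof. by rewrite invr_ge0 exprn_ge0. Qed.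

Lemma sing0 n : (1 < n)%N -> sing (0 : 'rV[R]_n) = 0.
Proof.
by move=> n1; rewrite /sing normr0 expr0n (_ : (n.-1 == 0)%N = false) ?invr0//; lia.
Qed.

(** The largest value of [sing] on the shell between [r / 2] and [r], times the volume of the cube
    of radius [r], is proportional to [r]. *)
Lemma shell_weight n (r : R) : (0 < n)%N -> 0 < r ->
  ((r / 2) ^+ n.-1)^-1 * (2 * r) ^+ n = 2 ^+ n.-1 * 2 ^+ n * r.
Proof.
case: n => // n _ r0 /=; rewrite !exprMn [r ^+ n.+1]exprS invfM exprVn invrK.
have : r ^+ n != 0 by rewrite expf_neq0// gt_eqF.
by move: (r ^+ n) => z z0; field.
Qed.

Lemma meas_sing n : (1 < n)%N -> meas (@sing n).
Proof.
move=> n1.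
rewrite (_ : @sing n = fun x => if `[< @punct R n x >] then sing x else 0).
  apply: meas_if_open; first exact: open_punct.
  move=> x x0; apply: continuousV; first by rewrite expf_neq0// normr_eq0.
  apply: (@continuous_comp _ _ _ (fun x : 'rV[R]_n => `|x|) (fun t : R => t ^+ n.-1) x).
    exact: norm_continuous.
  exact: exprn_continuous.
apply/funext => x; case: asboolP => //; rewrite /punct/= => /negP; rewrite negbK => /eqP ->.
exact: sing0.
Qed.

Lemma sum_half (K : nat) : \sum_(k < K) (2^-1 : R) ^+ k <= 2.
Proof.
have : \sum_(k < K) (2^-1 : R) ^+ k = 2 - 2 * 2^-1 ^+ K.
  elim: K => [|K IH]; first by rewrite big_ord0 expr0; ring.
  by rewrite big_ord_recr /= IH exprS; field.
move=> ->; have : 0 <= (2^-1 : R) ^+ K by rewrite exprn_ge0.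
by lra.
Qed.

(** Dyadic decomposition: by [shell_weight] the shells contribute a geometric series, which bounds
    the integrals of the truncations [g K]; Fatou's lemma removes the truncation. *)
Lemma L1_sing n (M : R) : (1 < n)%N -> 0 < M -> L1 (fun x : 'rV[R]_n => boxi M x * sing x).
Proof.
move=> n1 M0.
pose rr k : R := M * 2^-1 ^+ k.
have rr0 k : 0 < rr k by rewrite mulr_gt0// exprn_gt0// invr_gt0.
(* An upper bound of [sing] on the shell between [rr k.+1] and [rr k]. *)
pose a k : R := (rr k.+1 ^+ n.-1)^-1.
have a0 k : 0 <= a k by rewrite invr_ge0 exprn_ge0// ltW.
pose g K (x : 'rV[R]_n) := if `|x| <= rr K then 0 else boxi M x * sing x.
have mg K : meas (g K).
  rewrite (_ : g K = fun x => (1 - boxi (rr K) x) * (boxi M x * sing x)).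
    apply: measM; first by apply: measB; [exact: meas_cst|exact: meas_boxi].
    by apply: measM; [exact: meas_boxi|exact: meas_sing].
  by apply/funext => x; rewrite /g /boxi; case: ifP => _; rewrite ?subrr ?mul0r// subr0 mul1r.
have g0 K x : 0 <= g K x.
  rewrite /g; case: ifP => // _; rewrite mulr_ge0 ?sing_ge0// /boxi; by case: ifP.
pose S K (x : 'rV[R]_n) : R := \sum_(k < K) a k * boxi (rr k) x.
have gS K x : g K x <= S K x.
  elim: K => [|K IH].
    rewrite /S big_ord0 /g /boxi /rr expr0 mulr1.
    by case: ifP => // ->; rewrite mul0r.
  rewrite /S big_ord_recr /= -/(S K x) /g; case: (leP `|x| (rr K.+1)) => h1.
    apply: addr_ge0; first by apply: le_trans (g0 K x) IH.
    by rewrite mulr_ge0// /boxi; case: ifP.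
  case: (leP `|x| (rr K)) => h2; last first.
    rewrite [boxi (rr K) x]/boxi (leNgt `|x| (rr K)) h2 /= mulr0 addr0.
    by move: IH; rewrite /g (leNgt `|x| (rr K)) h2.
  rewrite [boxi (rr K) x]/boxi h2 mulr1 -[leLHS]add0r; apply: lerD.
    exact: le_trans (g0 K x) IH.
  apply: (@le_trans _ _ (sing x)).
    by rewrite -[leRHS]mul1r ler_wpM2r ?sing_ge0// /boxi; case: ifP.
  rewrite /sing /a lef_pV2 ?posrE ?exprn_gt0//; last by apply: lt_trans h1.
  by rewrite lerXn2r ?nnegrE// ltW.
have iS K : L1 (S K).
  by apply: L1_sum => k; apply: L1Z; apply: L1_boxi; exact: ltW.
have ig K : L1 (g K).
  by apply: L1_le (mg K) (iS K) _ => x; rewrite ger0_norm.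
have E k : a k * (2 * rr k) ^+ n = 2 ^+ n.-1 * 2 ^+ n * M * 2^-1 ^+ k.
  rewrite /a; have -> : rr k.+1 = rr k / 2 by rewrite /rr exprS; ring.
  by rewrite shell_weight ?(ltnW n1)// /rr; ring.
apply: (@L1_fatou R n g _ (2 ^+ n.-1 * 2 ^+ n * M * 2)) => //.
- move=> K; apply: le_trans (Int_le (ig K) (iS K) (gS K)) _.
  rewrite Int_sum; last by move=> k; apply: L1Z; apply: L1_boxi; exact: ltW.
  rewrite (eq_bigr (fun k : 'I_K => 2 ^+ n.-1 * 2 ^+ n * M * 2^-1 ^+ k)); last first.
    by move=> k _; rewrite IntZ ?Int_boxi ?E//; [exact: ltW|apply: L1_boxi; exact: ltW].
  by rewrite -mulr_sumr ler_wpM2l ?sum_half// !mulr_ge0 ?exprn_ge0// ltW.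
- move=> x; apply/cvgrPdist_lt => e e0.
  have [->|x0] := eqVneq x 0.
    by apply: nearW => K; rewrite /g normr0 (ltW (rr0 K)) sing0// mulr0 subr0 normr0.
  have nx : 0 < `|x| by rewrite normr_gt0.
  have /cvgrPdist_lt /(_ (`|x| / M)) : (2^-1 : R) ^+ k @[k --> \oo] --> (0 : R).
    by apply: cvg_expr; rewrite ger0_norm ?invr_ge0// invf_lt1// ltr1n.
  rewrite divr_gt0// => /(_ isT); apply: filterS => K.
  rewrite sub0r normrN ger0_norm ?exprn_ge0// ltr_pdivlMr// mulrC => h.
  by rewrite /g leNgt h /= subrr normr0.
- by apply: measM; [exact: meas_boxi|exact: meas_sing].
Qed.

Lemma abs_ln_le (s : R) : 0 < s -> `|ln s| <= s + s^-1.
Proof.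
have key (t : R) : 0 < t -> ln t <= t.
  move=> t0; rewrite -{1}(subrK 1 t) addrC.
  by apply: le_trans (le_ln1Dx _) _; lra.
move=> s0; have si : 0 < s^-1 by rewrite invr_gt0.
have h1 := key s s0; have := key _ si; rewrite lnV ?posrE// => h2.
rewrite ler_norml; apply/andP; split; lra.
Qed.

Section Phi.
Variables (m n : nat) (c : R).
Hypotheses (m0 : (0 < m)%N) (mn : (2 * m <= n)%N).
Let phi := fundsol m n c : 'rV[R]_n -> R.

Let n1 : (1 < n)%N. Proof. lia. Qed.

Lemma fundsol0 : phi 0 = 0.
Proof.
have e0 : enorm (0 : 'rV[R]_n) = 0 by apply/eqP; rewrite enorm_eq0.
rewrite /phi /fundsol e0; case: ifP => h.
  by rewrite expr0n subn_eq0 leqNgt h /= invr0 mulr0.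
by rewrite invr0 mulr0 ln0 ?mulr0.
Qed.

Lemma phi_bound (M : R) : 0 < M -> exists2 C : R, 0 <= C &
  forall x, `|x| <= M -> `|phi x| <= C * sing x.
Proof.
move=> M0.
have key (K : R) : 0 <= K -> (forall x : 'rV[R]_n, x != 0 -> `|x| <= M ->
    exists2 j : nat, (j <= n.-1)%N & `|phi x| <= K * (`|x| ^+ j)^-1) ->
  exists2 C : R, 0 <= C & forall x, `|x| <= M -> `|phi x| <= C * sing x.
  (* The sum of all powers of [M] dominates each factor $|x|^{n-1-j}$, whichever [j] occurs; the
     summand 1 makes this work for small [M] too. *)
  move=> K0 H; pose D := \sum_(i < n) M ^+ i.
  have D0 : 0 <= D by apply: sumr_ge0 => i _; rewrite exprn_ge0// ltW.
  exists (K * D); first exact: mulr_ge0.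
  move=> x xM; have [->|x0] := eqVneq x 0.
    by rewrite fundsol0 normr0 !mulr_ge0// sing_ge0.
  have [j jn h] := H x x0 xM; apply: le_trans h _.
  rewrite -mulrA ler_wpM2l// /sing.
  have nx : 0 < `|x| by rewrite normr_gt0.
  have -> : (`|x| ^+ j)^-1 = `|x| ^+ (n.-1 - j) * (`|x| ^+ n.-1)^-1.
    rewrite -{2}(subnK jn) exprD invfM mulrA divff ?mul1r// expf_neq0// gt_eqF//.
  rewrite ler_wpM2r ?invr_ge0 ?exprn_ge0//.
  have jo : (n.-1 - j < n)%N by lia.
  rewrite /D (bigD1 (Ordinal jo))//= -[leLHS]addr0; apply: lerD.
    by rewrite lerXn2r ?nnegrE// ltW.
  by apply: sumr_ge0 => i _; rewrite exprn_ge0// ltW.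
case: (boolP (2 * m < n)%N) => h.
  apply: (key `|c|) => // x x0 xM; exists (n - 2 * m)%N; first lia.
  rewrite /phi /fundsol h normrM ler_wpM2l// ger0_norm ?invr_ge0 ?exprn_ge0 ?enorm_ge0//.
  have nx : 0 < `|x| by rewrite normr_gt0.
  rewrite lef_pV2 ?posrE ?exprn_gt0 ?enorm_gt0//.
  by rewrite lerXn2r ?nnegrE ?enorm_ge0// norm_le_enorm.
(* From $|\ln s|\le s+1/s$ at $s=5/|x|$, multiplied by the Euclidean norm, which is at most
   [n M]. *)
apply: (key (`|c| * (5 + (n%:R * M) ^+ 2))).
  by rewrite mulr_ge0// addr_ge0// sqr_ge0.
move=> x x0 xM; exists 1%N; first lia.
rewrite /phi /fundsol (negbTE h) normrM -mulrA ler_wpM2l//.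
have nx : 0 < `|x| by rewrite normr_gt0.
have ex : 0 < enorm x by rewrite enorm_gt0.
have d5 : 0 < 5 / enorm x by rewrite divr_gt0.
apply: le_trans (abs_ln_le d5) _.
have h1 := norm_le_enorm x.
have h2 : enorm x <= n%:R * M.
  by apply: le_trans (enorm_le_norm x) _; rewrite ler_wpM2l.
rewrite expr1 invfM invrK -(ler_pM2r ex) mulrDl divfK ?gt_eqF//.
have : (5 + (n%:R * M) ^+ 2) * 1 <= (5 + (n%:R * M) ^+ 2) * (`|x|^-1 * enorm x).
  rewrite ler_wpM2l//; first by rewrite addr_ge0// sqr_ge0.
  by rewrite mulrC ler_pdivlMr// mul1r.
rewrite mulr1 !mulrA; apply: le_trans; rewrite lerD2l.
have : enorm x * enorm x <= n%:R * M * (n%:R * M) by apply: ler_pM; rewrite ?enorm_ge0.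
rewrite -expr2 => h3; have : 0 <= enorm x ^+ 2 by exact: sqr_ge0.
by rewrite -mulrA -expr2 [(n%:R * M) ^+ 2]expr2; lra.
Qed.

Lemma meas_phi : meas phi.
Proof.
rewrite (_ : phi = fun x => if `[< @punct R n x >] then phi x else 0).
  apply: meas_if_open; first exact: open_punct.
  exact: (CC_cont (@CC_phi R m n c mn 0)).
apply/funext => x; case: asboolP => //; rewrite /punct/= => /negP; rewrite negbK => /eqP ->.
exact: fundsol0.
Qed.

Lemma L1_phi_box (M : R) : 0 < M -> L1 (fun x => phi x * boxi M x).
Proof.
move=> M0; have [C C0 H] := phi_bound M0.
apply: L1_le (L1Z C (L1_sing n1 M0)) _.
  by apply: measM; [exact: meas_phi|exact: meas_boxi].
move=> x; rewrite /boxi; case: (leP `|x| M) => h; last by rewrite !(mulr0, mul0r) normr0.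
by rewrite mulr1 mul1r; exact: H.
Qed.

Lemma L1_phi_bounded (x : 'rV[R]_n) g (C M : R) : 0 < M -> meas g -> (forall y, `|g y| <= C) ->
  (forall y, M < `|y| -> g y = 0) -> L1 (fun y => phi (x - y) * g y).
Proof.
move=> M0 mg gC gM.
have M'0 : 0 < M + `|x| by rewrite ltr_pwDl.
have := L1_translate (- x) (L1_phi_box M'0).
move=> /(L1_bounded mg gC); apply: L1_ext => y.
case: (leP `|y| M) => h; last by rewrite gM// mul0r mulr0.
rewrite /boxi (_ : `|y - x| <= M + `|x|) ?mulr1.
  by rewrite -opprB /phi fundsolN mulrC.
by apply: le_trans (ler_normB _ _) _; rewrite lerD2r.
Qed.

End Phi.
End Singular.

(** * Cutoffs and the representation formula *)


Section Cutoff.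
Variable R : realType.
Implicit Types (n k m : nat).

(** The transition takes place in the squared norm, which keeps the cutoff smooth at the origin: 1
    for $|x|\le a$ and 0 for $|x|\ge b$. *)
Definition cutoff n (a b : R) (x : 'rV[R]_n) : R := step ((qf x - a ^+ 2) / (b ^+ 2 - a ^+ 2)).

Section CutProps.
Variables (n : nat) (a b : R).
Hypotheses (a0 : 0 <= a) (ab : a < b).

Let ba2 : 0 < b ^+ 2 - a ^+ 2.
Proof. by rewrite subr_gt0 ltrXn2r ?nnegrE// (le_trans a0 (ltW ab)). Qed.

Lemma CC_cut k : CC k setT (@cutoff n a b).
Proof.
apply: (@CC_radialT R n k (fun t => step ((t - a ^+ 2) / (b ^+ 2 - a ^+ 2)))).
apply: (@C1_comp R k setT setT) => //; first exact: openT.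
  exact: C1_step.
apply: (C1_ext (F := fun t => (b ^+ 2 - a ^+ 2)^-1 * (t + - a ^+ 2))) => //; first exact: openT.
  by move=> t _; rewrite mulrC.
apply: C1_scale; first exact: openT.
by apply: C1_add; [exact: openT|apply: C1_id; exact: openT|apply: C1_cst; exact: openT].
Qed.

Lemma cut_in (x : 'rV[R]_n) : enorm x <= a -> cutoff a b x = 1.
Proof.
move=> xa; apply: step_le0; rewrite mulr_le0_ge0 ?invr_ge0 ?(ltW ba2)//.
by rewrite subr_le0 -enorm_sqr lerXn2r ?nnegrE// enorm_ge0.
Qed.

Lemma cut_out (x : 'rV[R]_n) : b <= enorm x -> cutoff a b x = 0.
Proof.
move=> xb; apply: step_ge1; rewrite ler_pdivlMr// mul1r lerD2r -enorm_sqr.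
by rewrite lerXn2r ?nnegrE ?enorm_ge0// (le_trans a0 (ltW ab)).
Qed.

Lemma cut_bnd (x : 'rV[R]_n) : 0 <= cutoff a b x <= 1.
Proof. exact: step_bnd. Qed.

Lemma cut_abs (x : 'rV[R]_n) : `|cutoff a b x| <= 1.
Proof. by have /andP[h0 h1] := cut_bnd x; rewrite ger0_norm. Qed.

Lemma cutC_abs (x : 'rV[R]_n) : `|1 - cutoff a b x| <= 1.
Proof. have /andP[h0 h1] := cut_bnd x; rewrite ger0_norm; lra. Qed.

End CutProps.

Lemma cutZ n (a b d : R) (z : 'rV[R]_n) : 0 < d -> cutoff (d * a) (d * b) (d *: z) = cutoff a b z.
Proof.
move=> d0; rewrite /cutoff qfZ !exprMn -!mulrBr; congr step.
have : d ^+ 2 != 0 by rewrite expf_neq0// gt_eqF.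
by move: (d ^+ 2) => e e0; rewrite invfM mulrACA divff// mul1r.
Qed.

Lemma CC_cutC n k (a b : R) : CC k setT (fun x : 'rV[R]_n => 1 - cutoff a b x).
Proof.
have oT := @openT 'rV[R]_n.
by apply: CC_sub_fun => //; [exact: CC_cst|exact: CC_cut].
Qed.

Lemma plm_cst n m (e : R) (x : 'rV[R]_n) : (0 < m)%N -> plm m (fun=> e) x = 0.
Proof.
move=> m0; rewrite -(prednK m0) plmSr; apply: (plm_zero _ (@openT 'rV[R]_n)) => // y _.
rewrite mlapE big1 ?oppr0// => i _.
by rewrite (pd_open (g := fun=> 0) i (@openT 'rV[R]_n)) ?pd_cst// => z _; exact: pd_cst.
Qed.

End Cutoff.

(** * Representation of compactly supported functions by convolution *)

Section Rep.
Variables (R : realType) (m n : nat) (c : R).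
Hypotheses (m0 : (0 < m)%N) (mn : (2 * m <= n)%N).
Hypothesis hc : normalizing_const m n c.
Let phi := fundsol m n c : 'rV[R]_n -> R.
Let oT := @openT 'rV[R]_n.
Let op := @open_punct R n.

Lemma CC_away k (f : 'rV[R]_n -> R) (a b : R) : 0 < a -> a < b ->
  CC k (@punct R n) f -> CC k setT (fun x => f x * (1 - cutoff a b x)).
Proof.
move=> a0 ab hf.
have h1 : CC k (@punct R n) (fun x => f x * (1 - cutoff a b x)).
  by apply: CC_mul => //; apply: CC_sub (CC_cutC n k a b).
have oa := @open_enorm_lt R n a.
have h2 : CC k [set x : 'rV[R]_n | enorm x < a] (fun x => f x * (1 - cutoff a b x)).
  apply: CC_ext (CC_cst k 0 oa) => // y /= ya.
  by rewrite cut_in ?(ltW a0)// ?(ltW ya)// subrr mulr0.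
apply: CC_sub (open_bigU op oa h1 h2) => x _ /=.
have [->|x0] := eqVneq x 0; last by left.
by right; rewrite (_ : enorm 0 = 0)//; apply/eqP; rewrite enorm_eq0.
Qed.

(** [A] and [B] are models at unit scale: by [phi_cut_scaled], [phi] cut off at scale [d] is, after
    rescaling, a combination of the two with coefficients depending on [d] alone. *)
Let A z := phi z * (1 - cutoff 1 2 z).
Let B (z : 'rV[R]_n) : R := 1 - cutoff 1 2 z.

Let ltr12 : (1 : R) < 2. Proof. lra. Qed.

(** Beyond radius 2, [A] is [phi] and [B] is constant, both annihilated by $(-\Delta)^m$; inside the
    unit ball both vanish. *)
Lemma plm_A_B_supp (z : 'rV[R]_n) : enorm z < 1 \/ 2 < enorm z ->
  plm m A z = 0 /\ plm m B z = 0.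
Proof.
case=> hz.
  have oa := @open_enorm_lt R n 1.
  by split; apply: (plm_zero _ oa) => // y /= y1; rewrite /A /B cut_in ?(ltW y1) ?subrr ?mulr0.
have oa := @open_enorm_gt R n 2.
have z0 : z != 0 by rewrite -enorm_gt0; apply: lt_trans hz.
split.
  rewrite (plm_eq m oa hz (g := phi)); first exact: plm_phi.
  by move=> y /= y2; rewrite /A cut_out ?(ltW y2)// subr0 mulr1.
rewrite (plm_eq m oa hz (g := fun=> 1)); first exact: plm_cst.
by move=> y /= y2; rewrite /B cut_out ?(ltW y2)// subr0.
Qed.

(** The additive constant by which the logarithm fails to be homogeneous; absent in the case of a
    power. *)
Let kap (d : R) : R := if (2 * m < n)%N then 0 else c * (- ln d).

Lemma phi_cut_scaled (d : R) (z : 'rV[R]_n) : 0 < d ->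
  phi (d *: z) * (1 - cutoff d (d * 2) (d *: z)) =
  (d ^+ (n - 2 * m))^-1 * A z + kap d * B z.
Proof.
move=> d0; have := cutZ 1 2 z d0; rewrite mulr1 => ->.
have [->|z0] := eqVneq z 0; last by rewrite {1}/phi fundsolZ// mulrDl -mulrA.
have c1 : cutoff 1 2 (0 : 'rV[R]_n) = 1.
  by apply: cut_in => //; rewrite (_ : enorm 0 = 0)//; apply/eqP; rewrite enorm_eq0.
by rewrite /A /B c1 subrr !mulr0 addr0.
Qed.

Lemma plm_phi_cut (d : R) (z : 'rV[R]_n) : 0 < d ->
  d ^+ (2 * m) * plm m (fun y => phi y * (1 - cutoff d (d * 2) y)) (d *: z) =
  (d ^+ (n - 2 * m))^-1 * plm m A z + kap d * plm m B z.
Proof.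
move=> d0.
have dd : d < d * 2 by rewrite ltr_pMr.
have hF := CC_away d0 dd (@CC_phi R m n c mn (2 * m)).
have hA : CC (2 * m) setT A := CC_away ltr01 ltr12 (@CC_phi R m n c mn (2 * m)).
have hB : CC (2 * m) setT B := CC_cutC n _ 1 2.
have := @plm_affine R n m setT setT _ d 0 z oT oT hF (fun _ _ => Logic.I) Logic.I.
rewrite addr0 => <-.
apply: (etrans (plm_eq m oT Logic.I (g := fun z => (d ^+ (n - 2 * m))^-1 * A z + kap d * B z) _)).
  by move=> y _; rewrite addr0 phi_cut_scaled.
rewrite (plm_add oT (CC_scale _ oT hA) (CC_scale _ oT hB) Logic.I).
by rewrite (plm_scale _ oT hA Logic.I) (plm_scale _ oT hB Logic.I).
Qed.

Lemma plm_phi_cut_ex : exists pA pB : 'rV[R]_n -> R,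
  [/\ continuous pA, continuous pB, (forall x : 'rV[R]_n, 2 < `|x| -> pA x = 0 /\ pB x = 0) &
    forall (d : R) (z : 'rV[R]_n), 0 < d ->
    d ^+ (2 * m) * plm m (fun y => phi y * (1 - cutoff d (d * 2) y)) (d *: z) =
    (d ^+ (n - 2 * m))^-1 * pA z + kap d * pB z].
Proof.
exists (plm m A), (plm m B); split.
- apply: (@CC0_continuous _ _ 0); apply: CC_plm => //; rewrite addn0.
  exact: (CC_away ltr01 ltr12 (@CC_phi R m n c mn (2 * m))).
- by apply: (@CC0_continuous _ _ 0); apply: CC_plm => //; rewrite addn0; exact: (CC_cutC n _ 1 2).
- move=> x h; exact: (@plm_A_B_supp x (or_intror (lt_le_trans h (norm_le_enorm x)))).
- by move=> d z; exact: plm_phi_cut.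
Qed.

(** Size $d^{-n}$, up to a logarithm, on a cube of volume of order $d^n$: integrated against a
    function that is $O(|y|)$ at the origin, this tends to 0 with [d]. *)
Lemma plm_phi_cut_bound : exists2 C : R, 0 <= C & forall (d : R) (y : 'rV[R]_n),
  0 < d -> `|plm m (fun y => phi y * (1 - cutoff d (d * 2) y)) y| <=
   C * (1 + `|ln d|) * (d ^+ n)^-1 * boxi (2 * d) y.
Proof.
have [pA [pB [cA cB sAB EAB]]] := plm_phi_cut_ex.
have [MA MA0 HA] := bounded_supp cA (fun x h => (sAB x h).1).
have [MB MB0 HB] := bounded_supp cB (fun x h => (sAB x h).2).
exists (MA + `|c| * MB); first by rewrite addr_ge0// mulr_ge0.
move=> d y d0.
have dn0 : d != 0 by rewrite gt_eqF.
have := EAB d (d^-1 *: y) d0; rewrite scalerA divff// scale1r.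
set P := plm _ _ _ => E.
case: (leP `|y| (2 * d)) => hy; last first.
  have : `|d^-1 *: y| > 2.
    by rewrite mx_normZ normfV gtr0_norm// mulrC ltr_pdivlMr.
  move=> h; have [e1 e2] := sAB _ h; rewrite e1 e2 !mulr0 addr0 in E.
  move/eqP: E; rewrite mulf_eq0 expf_eq0 (negbTE dn0) andbF /= => /eqP ->.
  by rewrite (boxi_out hy) mulr0 normr0.
rewrite /boxi hy mulr1.
have d2m : 0 < d ^+ (2 * m) by rewrite exprn_gt0.
have dnm : 0 < d ^+ (n - 2 * m) by rewrite exprn_gt0.
have -> : P =
  (d ^+ n)^-1 * (pA (d^-1 *: y) + d ^+ (n - 2 * m) * kap d * pB (d^-1 *: y)).
  apply: (mulfI (lt0r_neq0 d2m)); rewrite E.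
  rewrite -[in (d ^+ n)^-1](subnK mn) exprD invfM.
  move: (lt0r_neq0 d2m) (lt0r_neq0 dnm).
  by move: (d ^+ (n - 2 * m)) (d ^+ (2 * m)) => u v u0 v0; field; apply/andP.
rewrite normrM [leRHS]mulrC ger0_norm ?invr_ge0 ?exprn_ge0 ?(ltW d0)//.
rewrite ler_wpM2l ?invr_ge0 ?exprn_ge0 ?(ltW d0)//.
apply: le_trans (ler_normD _ _) _.
have l0 : 0 <= `|ln d| by [].
have h1 := HA (d^-1 *: y).
have h2 : `|d ^+ (n - 2 * m) * kap d * pB (d^-1 *: y)| <= `|c| * `|ln d| * MB.
  rewrite normrM ler_pM//; rewrite /kap; case: (boolP (2 * m < n)%N) => h.
    by rewrite mulr0 normr0 mulr_ge0.
  have -> : (n - 2 * m = 0)%N by apply/eqP; rewrite subn_eq0 leqNgt.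
  by rewrite expr0 mul1r normrM normrN.
apply: le_trans (lerD h1 h2) _.
have : 0 <= `|c| * MB by rewrite mulr_ge0.
by nra.
Qed.

(** The bump equal to 1 at the origin through which the normalisation of [c] enters. *)
Definition chi (x : 'rV[R]_n) : R := bmp (1 - qf x) / bmp 1.

Lemma CC_chi k : CC k setT chi.
Proof.
apply: (@CC_radialT R n k (fun t => bmp (1 - t) / bmp 1)).
apply: (C1_ext (F := fun t => (bmp 1)^-1 * bmp (1 + (-1) * t))); first exact: openT.
  by move=> t _; rewrite mulN1r mulrC.
apply: C1_scale; first exact: openT.
apply: (@C1_comp R k setT setT) => //; first exact: openT.
  exact: C1_flat.
apply: C1_add; [exact: openT|apply: C1_cst; exact: openT|].
by apply: C1_scale; [exact: openT|apply: C1_id; exact: openT].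
Qed.

Lemma chi0 : chi 0 = 1.
Proof. by rewrite /chi qf0 subr0 divff// gt_eqF// bmp_gt0. Qed.

Lemma chi_out (x : 'rV[R]_n) : 1 <= enorm x -> chi x = 0.
Proof.
move=> x1; rewrite /chi bmp_le0 ?mul0r// subr_le0 -enorm_sqr.
by rewrite -{1}(expr1n R 2) lerXn2r ?nnegrE// enorm_ge0.
Qed.

Lemma L1_phi_plm (x : 'rV[R]_n) g (M : R) : 0 < M -> CC (2 * m) setT g ->
  (forall y : 'rV[R]_n, M < `|y| -> g y = 0) -> L1 (fun y => phi (x - y) * plm m g y).
Proof.
move=> M0 hg gM.
have cg : continuous (plm m g) by apply: (@CC0_continuous _ _ 0); apply: CC_plm => //; rewrite addn0.
have sg (y : 'rV[R]_n) : M < `|y| -> plm m g y = 0.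
  by move=> h; apply: (plm_zero _ (@open_norm_gt R n M)).
have [C C0 H] := bounded_supp cg sg.
by apply: (L1_phi_bounded c m0 mn x M0 (meas_continuous cg) H sg).
Qed.

Lemma L1_phi_plm0 g (M : R) : 0 < M -> CC (2 * m) setT g ->
  (forall y : 'rV[R]_n, M < `|y| -> g y = 0) -> L1 (fun y => phi y * plm m g y).
Proof.
move=> M0 hg gM; apply: L1_ext (L1_phi_plm 0 M0 hg gM) => y.
by rewrite sub0r /phi fundsolN.
Qed.

Lemma Int_phi_chi : Int (fun y => phi y * plm m chi y) = 1.
Proof.
have sup (y : 'rV[R]_n) : 1 < `|y| -> chi y = 0.
  by move=> h; apply: chi_out; apply: le_trans (ltW h) (norm_le_enorm y).
have iL := L1_phi_plm0 ltr01 (CC_chi (2 * m)) sup.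
rewrite -Rint_Int// -chi0 plmE; have [_] := hc; apply.
split; first by move=> k; apply/CC_Ck; exact: CC_chi.
by exists 1 => y h; apply: chi_out; exact: ltW.
Qed.

(** With [phi] replaced by [phi] times $1-\xi_d$, a global [C^(2m)] function, integration by parts
    puts $(-\Delta)^m$ on it. Then [plm_phi_cut_bound] and $|g(y)|\le D|y|$ make the integral vanish
    in the limit, while dominated convergence restores [phi]. *)
Lemma rep_zero g (M : R) : 0 < M -> CC (2 * m) setT g ->
  (forall y : 'rV[R]_n, M < `|y| -> g y = 0) -> g 0 = 0 ->
  Int (fun y => phi y * plm m g y) = 0.
Proof.
move=> M0 hg gM g0.
have iL := L1_phi_plm0 M0 hg gM.
pose h (j : nat) : R := j.+1%:R^-1.
have h0 j : 0 < h j by rewrite invr_gt0.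
have h1 j : h j <= 1 by rewrite invf_le1// ler1n.
(* The scale is a square so that the crude bound $|\ln h|\le h+1/h$ already gives $d\,|\ln
   d|=O(h)$. *)
pose d j : R := h j ^+ 2.
have d0 j : 0 < d j by rewrite exprn_gt0.
have dh j : d j <= h j by rewrite /d expr2 ler_piMl// ltW.
have dE j : d j = h j ^+ 2 by [].
clearbody d.
have dd j : d j < d j * 2 by rewrite ltr_pMr.
pose F j (y : 'rV[R]_n) := (1 - cutoff (d j) (d j * 2) y) * (phi y * plm m g y).
have mc j : meas (fun y : 'rV[R]_n => 1 - cutoff (d j) (d j * 2) y).
  by apply: meas_continuous; exact: (CC0_continuous (CC_cutC n 0 _ _)).
have [||||_ cv] := @Int_cvg R n F (fun y => phi y * plm m g y) (fun y => `|phi y * plm m g y|).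
- by move=> j; apply: measM => //; exact: L1_meas.
- exact: L1_abs.
- by move=> j y; rewrite normrM ler_piMl// cutC_abs.
- move=> y; apply/cvgrPdist_lt => e e0.
  have [->|y0] := eqVneq y 0.
    by apply: nearW => j; rewrite /F /phi fundsol0// !(mul0r, mulr0) subrr normr0.
  have ey : 0 < enorm y by rewrite enorm_gt0.
  have /cvgrPdist_lt /(_ (enorm y / 2)) := @cvg_inv_succ R.
  rewrite divr_gt0// => /(_ isT); apply: filterS => j.
  rewrite sub0r normrN gtr0_norm// -/(h j) => hj.
  rewrite /F cut_out ?subr0 ?mul1r ?subrr ?normr0//; first exact: ltW.
  by have := dh j; lra.
have [C C0 HC] := plm_phi_cut_bound.
have m21 : (1 <= 2 * m)%N by lia.
have [D [D0 [r r0 [_ HD]]]] := @taylor_pointwise R n 1 setT g oT Logic.I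
  (CC_leq m21 hg) (conj g0 (fun _ => Logic.I)).
have FE j : Int (F j) = Int (fun y => plm m (fun y => phi y * (1 - cutoff (d j) (d j * 2) y)) y * g y).
  have hF := CC_away (d0 j) (dd j) (@CC_phi R m n c mn (2 * m)).
  rewrite -(@ibp_plm R n m setT [set y | `|y| <= M] _ g oT)//.
    by apply: eq_Int => y; rewrite /F; ring.
  split => //.
  - apply: (@closed_comp _ _ (fun y : 'rV[R]_n => `|y|) [set t | t <= M]).
      by move=> v _; exact: norm_continuous.
    exact: closed_le.
  - by exists M.
  - by move=> y /negP; rewrite -ltNge; exact: gM.
(* The factor [2 D] comes from $|g|\le D\cdot 2d$ on the cube of radius [2 d], [4 ^+ n] from its
   volume $(4d)^n$, and 5 from $h^2+2h^3+2h\le 5h$ for $h\le 1$. *)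
pose E := C * D * 2 * 4 ^+ n * 5.
have E0 : 0 <= E by rewrite !mulr_ge0// exprn_ge0.
have bound : \forall j \near \oo, `|Int (F j)| <= E * h j.
  have /cvgrPdist_lt /(_ (r / 2)) := @cvg_inv_succ R.
  rewrite divr_gt0// => /(_ isT); apply: filterS => j.
  rewrite sub0r normrN gtr0_norm// -/(h j) => hj.
  rewrite FE.
  pose W := C * (1 + `|ln (d j)|) * (d j ^+ n)^-1 * (D * (2 * d j)).
  have dj0 := ltW (d0 j).
  have W0 : 0 <= W.
    apply: mulr_ge0; last by rewrite !mulr_ge0.
    by apply: mulr_ge0; [apply: mulr_ge0 => //; exact: addr_ge0|rewrite invr_ge0 exprn_ge0].
  have wb y : `|plm m (fun y => phi y * (1 - cutoff (d j) (d j * 2) y)) y * g y| <= W * boxi (2 * d j) y.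
    rewrite normrM; case: (leP `|y| (2 * d j)) => hy; last first.
      have := HC (d j) y (d0 j); rewrite (boxi_out hy) !mulr0 normr_le0 => /eqP ->.
      by rewrite normr0 mul0r.
    have := HC (d j) y (d0 j); rewrite /boxi hy !mulr1 => hb.
    apply: ler_pM => //.
    have := HD y; rewrite expr1 => hg'; apply: le_trans (hg' _) _; first by have := dh j; lra.
    by rewrite ler_wpM2l.
  have iW : L1 (fun y : 'rV[R]_n => W * boxi (2 * d j) y).
    by apply: L1Z; apply: L1_boxi; rewrite mulr_ge0 ?(ltW (d0 j)).
  have iP : L1 (fun y => plm m (fun y => phi y * (1 - cutoff (d j) (d j * 2) y)) y * g y).
    apply: L1_le iW wb; apply: meas_continuous.
    apply: (@CC0_continuous _ _ 0); apply: CC_mul => //; last by apply: CC_leq hg.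
    apply: CC_plm => //; rewrite addn0.
    exact: CC_away (d0 j) (dd j) (@CC_phi R m n c mn (2 * m)).
  apply: le_trans (Int_abs iP) _.
  apply: le_trans (Int_le (L1_abs iP) iW wb) _.
  rewrite IntZ; last by apply: L1_boxi; rewrite mulr_ge0 ?(ltW (d0 j)).
  rewrite Int_boxi; last by rewrite mulr_ge0 ?(ltW (d0 j)).
  have -> : W * (2 * (2 * d j)) ^+ n = C * D * 2 * 4 ^+ n * ((1 + `|ln (d j)|) * d j).
    have -> : 2 * (2 * d j) = 4 * d j by ring.
    rewrite /W.
    rewrite exprMn; have : d j ^+ n != 0 by rewrite expf_neq0// gt_eqF.
    by move: (d j ^+ n) => z z0; field.
  have Q0 : 0 <= C * D * 2 * 4 ^+ n by rewrite !mulr_ge0// exprn_ge0.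
  have -> : E * h j = C * D * 2 * 4 ^+ n * (5 * h j) by rewrite /E; ring.
  rewrite ler_wpM2l//.
  have -> : ln (d j) = ln (h j) + ln (h j) by rewrite dE expr2 lnM ?posrE.
  have := abs_ln_le (h0 j) => hl.
  have hl2 : `|ln (h j) + ln (h j)| <= 2 * (h j + (h j)^-1).
    by apply: le_trans (ler_normD _ _) _; lra.
  apply: (@le_trans _ _ ((1 + 2 * (h j + (h j)^-1)) * d j)).
    by rewrite ler_wpM2r ?(ltW (d0 j))// lerD2l.
  rewrite dE [leLHS](_ : _ = h j ^+ 2 + 2 * h j ^+ 3 + 2 * h j).
    have := h0 j; have := h1 j; rewrite !exprS expr0 mulr1; move: (h j) => t t1 t0.
    have : t * t <= t by rewrite ler_piMl// ltW.
    have : t * (t * t) <= t by rewrite ler_piMr ?mulr_ile1// ltW.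
    by lra.
  by have := lt0r_neq0 (h0 j); move: (h j) => t t0; field.
have cv0 : (fun j => Int (F j)) @ \oo --> (0 : R).
  apply/cvgrPdist_lt => e e0.
  have /cvgrPdist_lt /(_ (e / (E + 1))) := @cvg_inv_succ R.
  rewrite divr_gt0 ?ltr_wpDl// => /(_ isT) near_h.
  near=> j; rewrite sub0r normrN.
  apply: (@le_lt_trans _ _ (E * h j)); first by near: j.
  have : `|0 - h j| < e / (E + 1) by near: j.
  rewrite sub0r normrN gtr0_norm// ltr_pdivlMr ?ltr_wpDl// => hj.
  by apply: le_lt_trans hj; have := h0 j; nra.
by rewrite -(cvg_lim (@Rhausdorff R) cv) (cvg_lim (@Rhausdorff R) cv0).
Unshelve. all: by end_near. Qed.

(** Subtracting [g 0 * chi] reduces to [rep_zero], and the integral for [chi] is 1 by the choice of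
    [c]. *)
Lemma rep0 g (M : R) : 0 < M -> CC (2 * m) setT g ->
  (forall y : 'rV[R]_n, M < `|y| -> g y = 0) ->
  Int (fun y => phi y * plm m g y) = g 0.
Proof.
move=> M0 hg gM.
have sup (y : 'rV[R]_n) : 1 < `|y| -> chi y = 0.
  by move=> h; apply: chi_out; apply: le_trans (ltW h) (norm_le_enorm y).
have ichi := L1_phi_plm0 ltr01 (CC_chi (2 * m)) sup.
have ig := L1_phi_plm0 M0 hg gM.
pose gd x := g x - g 0 * chi x.
have hs := CC_scale (g 0) oT (CC_chi (2 * m)).
have hgd : CC (2 * m) setT gd by apply: CC_sub_fun.
have := @rep_zero gd (M + 1) (ltac:(by rewrite addr_gt0)) hgd.
rewrite (eq_Int (h := fun y => phi y * plm m g y - g 0 * (phi y * plm m chi y))).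
  rewrite IntB//; last exact: L1Z.
  rewrite IntZ// Int_phi_chi mulr1 => h; apply/eqP; rewrite -subr_eq0; apply/eqP; apply: h.
    move=> y hy; rewrite /gd gM ?sup ?mulr0 ?subr0//.
      by apply: le_lt_trans hy; rewrite lerDr ltW.
    by apply: le_lt_trans hy; rewrite lerDl.
  by rewrite /gd chi0 mulr1 subrr.
move=> y; rewrite (plm_sub oT hg hs Logic.I) (plm_scale _ oT (CC_chi _) Logic.I).
by ring.
Qed.

(** [rep0] for the translate of [g], together with the evenness of [phi]. *)
Lemma rep (x : 'rV[R]_n) g (M : R) : 0 < M -> CC (2 * m) setT g ->
  (forall y : 'rV[R]_n, M < `|y| -> g y = 0) ->
  Int (fun y => phi (x - y) * plm m g y) = g x.
Proof.
move=> M0 hg gM; rewrite -(Int_translate x (L1_phi_plm x M0 hg gM)).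
pose gx y := g (1 *: y + x).
have hgx : CC (2 * m) setT gx by exact: CC_affine oT hg (fun _ _ => Logic.I).
have -> : g x = gx 0 by rewrite /gx scaler0 add0r.
rewrite -(@rep0 gx (M + `|x|)) //; first last.
- move=> y hy; apply: gM; rewrite scale1r.
  have := ler_normB (y + x) x; rewrite addrK; lra.
- by rewrite ltr_pwDl.
apply: eq_Int => y; rewrite opprD addrCA subrr addr0 /phi fundsolN; congr (_ * _).
by rewrite (@plm_affine R n m setT setT _ 1 x y oT oT hg) // expr1n mul1r scale1r.
Qed.

End Rep.

(** * Integrability of u near the origin *)


Section LogTest.
Variable R : realType.
Implicit Types (n k m q j : nat).

Definition lt_fun (lam : R) q j (t : R) : R := t ^+ q * posp j (1 + lam * ln t).

Lemma is_derive_lt_fun lam q j (t : R) : 0 < t ->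
  is_derive t 1 (lt_fun lam q j.+2)
    ((q%:R * lt_fun lam q j.+2 t + j.+2%:R * lam * lt_fun lam q j.+1 t) / t).
Proof.
move=> t0; have tn : t != 0 by rewrite gt_eqF.
have d1 : is_derive t 1 (fun s : R => s ^+ q) (q%:R * t ^+ q.-1).
  have := @is_deriveX R R id q t 1 1 (is_derive_id _ _).
  rewrite (_ : id ^+ q = (fun s : R => s ^+ q)); last first.
    by apply/funext => u; elim: q => // i IHi; rewrite !exprS -IHi.
  by move=> /is_derive_eq; apply; rewrite [_ *: _]mulr1.
have dl : is_derive t 1 (fun s : R => 1 + lam * ln s) (lam * t^-1).
  have := @is_deriveD R R R (fun=> 1) (fun s => lam * ln s) t 1 _ _ (is_derive_cst _ _ _)
    (is_derive_cmul lam (is_derive1_ln t0)).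
  by rewrite add0r.
have d2 := @is_derive1_comp R (posp j.+2) (fun s => 1 + lam * ln s) t _ _ (is_derive_posp j _) dl.
have := @is_deriveM R R (fun s : R => s ^+ q) (fun s => posp j.+2 (1 + lam * ln s)) t 1 _ _ d1 d2.
move=> /is_derive_eq; apply.
rewrite [LHS](_ : _ = t ^+ q * (j.+2%:R * posp j.+1 (1 + lam * ln t) * (lam * t^-1)) +
   posp j.+2 (1 + lam * ln t) * (q%:R * t ^+ q.-1))// /lt_fun.
have E : q%:R * t ^+ q.-1 = q%:R * t ^+ q / t.
  by case: q {d1} => [|q]; rewrite ?mul0r//= exprSr mulrA mulfK.
by rewrite E; field.
Qed.

(** Each differentiation of the logarithmic factor brings [lam / t] and lowers its exponent by one,
    so a Laplacian lowers the power of [t] by one and leaves terms in [lam ^+ 0], [lam] and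
    [lam ^+ 2]. Up to the global sign all coefficients are nonnegative. *)
Lemma mlap_lt_fun n lam q j (x : 'rV[R]_n) : x != 0 ->
  mlap (fun x => lt_fun lam q.+1 j.+3 (qf x)) x =
  - (q.+1%:R * (4 * q%:R + 2 * n%:R) * lt_fun lam q j.+3 (qf x) +
     j.+3%:R * (8 * q%:R + 4 + 2 * n%:R) * (lam * lt_fun lam q j.+2 (qf x)) +
     4 * j.+3%:R * j.+2%:R * (lam ^+ 2 * lt_fun lam q j.+1 (qf x))).
Proof.
move=> x0.
pose F1 t := q.+1%:R * lt_fun lam q j.+3 t + (j.+3%:R * lam) * lt_fun lam q j.+2 t.
pose F2 t := q.+1%:R * ((q%:R * lt_fun lam q j.+3 t + j.+3%:R * lam * lt_fun lam q j.+2 t) / t) +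
  (j.+3%:R * lam) * ((q%:R * lt_fun lam q j.+2 t + j.+2%:R * lam * lt_fun lam q j.+1 t) / t).
have h1 (t : R) : 0 < t -> is_derive t 1 (lt_fun lam q.+1 j.+3) (F1 t).
  move=> t0; have := is_derive_lt_fun lam q.+1 j.+1 t0; move=> /is_derive_eq; apply.
  have tn : t != 0 by rewrite gt_eqF.
  by rewrite /F1 /lt_fun exprS; field.
have h2 (t : R) : 0 < t -> is_derive t 1 F1 (F2 t).
  move=> t0.
  have := @is_deriveD R R R (fun t => q.+1%:R * lt_fun lam q j.+3 t)
    (fun t => (j.+3%:R * lam) * lt_fun lam q j.+2 t) t 1 _ _
    (is_derive_cmul _ (is_derive_lt_fun lam q j.+1 t0))
    (is_derive_cmul _ (is_derive_lt_fun lam q j t0)).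
  by [].
rewrite (mlap_radial h1 h2 x0); congr (- _).
have : qf x != 0 by rewrite gt_eqF// qf_gt0.
move: (qf x) => t tn; rewrite /F1 /F2 -[q.+1%:R]natr1.
by move: (lt_fun lam q j.+3 t) (lt_fun lam q j.+2 t) (lt_fun lam q j.+1 t) => a b d; field.
Qed.

Lemma C1_lt_fun k lam q j : (k < j)%N -> C1 k [set t : R | 0 < t] (lt_fun lam q j).
Proof.
move=> kj; have op := @open_pos R; apply: C1_mul => //.
  elim: q => [|q IH]; first by apply: C1_ext (C1_cst k 1 op) => // t _; rewrite expr0.
  by apply: C1_ext (C1_mul op (C1_id k op) IH) => // t _; rewrite exprS.
apply: (@C1_comp R k _ setT (posp j) (fun t => 1 + lam * ln t)) => //.
  exact: C1_posp.
by apply: C1_add => //; [exact: C1_cst|apply: C1_scale => //; exact: C1_ln].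
Qed.

Lemma CC_lt_fun n k lam q j : (k < j)%N ->
  CC k (@punct R n) (fun x => lt_fun lam q j (qf x)).
Proof. by move=> kj; exact/CC_radial/C1_lt_fun. Qed.

(* A triple (a, i, j) stands for the term [a lam^i (1 + lam ln t)_+^j]. *)
Definition tval lam q (t : R) (x : R * nat * nat) : R :=
  x.1.1 * (lam ^+ x.1.2 * lt_fun lam q x.2 t).

(** The terms issued from one term by one Laplacian, without the sign. The truncated predecessors
    are genuine, since [mlap_tval] asks for an exponent above 2. *)
Definition tstep n q (x : R * nat * nat) : seq (R * nat * nat) :=
  [:: (x.1.1 * (q.+1%:R * (4 * q%:R + 2 * n%:R)), x.1.2, x.2);
      (x.1.1 * (x.2%:R * (8 * q%:R + 4 + 2 * n%:R)), x.1.2.+1, x.2.-1);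
      (x.1.1 * (4 * x.2%:R * x.2.-1%:R), x.1.2.+2, x.2.-2)].

Definition tnn (x : R * nat * nat) : bool := 0 <= x.1.1.

Lemma tstep_nn n q x : tnn x -> all tnn (tstep n q x).
Proof.
rewrite /tnn => x0; have h1 : 0 <= 4 * q%:R + 2 * n%:R :> R by rewrite addr_ge0// mulr_ge0.
have h2 : 0 <= 8 * q%:R + 4 + 2 * n%:R :> R by rewrite !addr_ge0// mulr_ge0.
by rewrite /= !mulr_ge0.
Qed.

Lemma all_behead (T : Type) (P : pred T) (s : seq T) : all P s -> all P (behead s).
Proof. by case: s => //= y s' /andP[]. Qed.

Lemma mlap_tval n lam q (y : R * nat * nat) (x : 'rV[R]_n) : (2 < y.2)%N -> x != 0 ->
  mlap (fun x => tval lam q.+1 (qf x) y) x = - \sum_(z <- tstep n q y) tval lam q (qf x) z.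
Proof.
case: y => [[a i] [|[|[|j]]]] // _ x0; rewrite /tstep /tval /=.
have op := @open_punct R n.
have h2 := CC_lt_fun n lam q.+1 (ltac:(by []) : (2 < j.+3)%N).
rewrite (mlap_scale a op (CC_scale _ op h2) x0).
rewrite (mlap_scale (lam ^+ i) op h2 x0) mlap_lt_fun//.
rewrite !big_cons big_nil /= !exprS expr0; move: (lt_fun _ _ _ _) => A.
by move: (lt_fun _ _ _ _) => B; move: (lt_fun _ _ _ _) => D; ring.
Qed.

(** After [l] Laplacians every exponent is at least $k-2l$; as $k>2m$, it still exceeds 2 before the
    last one. The leading coefficient is kept apart from the list because it must be positive, not
    merely nonnegative. *)
Lemma plm_test n m k : (2 * m < k)%N -> (0 < n)%N ->
  exists (a0 : R) (L : seq (R * nat * nat)),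
   [/\ 0 < a0, all tnn L &
   forall (lam : R) (x : 'rV[R]_n), x != 0 ->
   plm m (fun x => lt_fun lam m k (qf x)) x =
   (-1) ^+ m * (a0 * posp k (1 + lam * ln (qf x)) +
      \sum_(y <- L) y.1.1 * (lam ^+ y.1.2 * posp y.2 (1 + lam * ln (qf x))))].
Proof.
move=> mk n0.
have op := @open_punct R n.
suff H l : (l <= m)%N -> exists (a0 : R) (L : seq (R * nat * nat)),
   [/\ 0 < a0, all tnn L, all (fun x => k - 2 * l <= x.2)%N L &
   forall (lam : R) (x : 'rV[R]_n), x != 0 ->
   plm l (fun x => lt_fun lam m k (qf x)) x =
   (-1) ^+ l * \sum_(y <- (a0, 0%N, k) :: L) tval lam (m - l) (qf x) y].
  have [a0 [L [h0 h1 _ h2]]] := H m (leqnn m); exists a0, L; split => // lam x x0.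
  rewrite h2// big_cons subnn /tval /lt_fun /= !expr0 !mul1r.
  by under eq_bigr do rewrite mul1r.
elim: l => [|l IH] lm.
  exists 1, [::]; split => //.
  by move=> lam x x0; rewrite plm0 big_cons big_nil subn0 /tval /= !expr0 !mul1r addr0.
have [a0 [L [h0 h1 h2 h3]]] := IH (ltnW lm).
pose q := (m - l.+1)%N.
have qE : (m - l = q.+1)%N by rewrite /q; lia.
(* The head of [St] is the new leading term, coming from the old one with its exponent [k]
   unchanged; [behead] leaves the rest. *)
pose St := flatten [seq tstep n q y | y <- (a0, 0%N, k) :: L].
exists (a0 * (q.+1%:R * (4 * q%:R + 2 * n%:R))), (behead St); split.
- by rewrite mulr_gt0// mulr_gt0 ?ltr0n// ltr_wpDl ?mulr_ge0// mulr_gt0// ltr0n.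
- apply: (@all_behead _ tnn); rewrite /St.
  have : all tnn ((a0, 0%N, k) :: L) by rewrite /= h1 andbT /tnn /= ltW.
  elim: ((a0, 0%N, k) :: L) => //= y L' IHL /andP[y0 hL].
  by have := tstep_nn n q y0; rewrite /= IHL.
- have hk : (k - 2 * l.+1 <= k - 2)%N by lia.
  rewrite /St /=; apply/and3P; split; [lia|lia|].
  elim: (L) h2 => //= y L' IHL /andP[y0 hL].
  by rewrite IHL// andbT; apply/and3P; split; lia.
move=> lam x x0.
rewrite -[LHS]/(mlap (plm l (fun x => lt_fun lam m k (qf x))) x).
rewrite (mlap_open (g := fun x => (-1) ^+ l * \sum_(y <- (a0, 0%N, k) :: L) tval lam (m - l) (qf x) y) op _ x0); last first.
  by move=> y y0; exact: h3.
have hall : all (fun x : R * nat * nat => 2 < x.2)%N ((a0, 0%N, k) :: L).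
  rewrite /=; apply/andP; split; first lia.
  by apply: sub_all h2 => y /=; lia.
have hC (y : R * nat * nat) : (2 < y.2)%N -> CC 2 (@punct R n) (fun x => tval lam (m - l) (qf x) y).
  by move=> hy; apply: CC_scale => //; apply: CC_scale => //; exact: CC_lt_fun.
have -> : (a0 * (q.+1%:R * (4 * q%:R + 2 * n%:R)), 0%N, k) :: behead St = St by [].
rewrite /St; elim: ((a0, 0%N, k) :: L) hall => [_|y L' IHL /= /andP[hy hL]].
  rewrite /= big_nil mulr0 (mlap_open (g := fun=> 0) op _ x0); last first.
    by move=> z z0; rewrite big_nil mulr0.
  rewrite mlapE big1 ?oppr0// => i _.
  by rewrite (pd_open (g := fun=> 0) i op _ x0) ?pd_cst// => z _; exact: pd_cst.
have hL' : CC 2 (@punct R n) (fun x => \sum_(z <- L') tval lam (m - l) (qf x) z).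
  elim: (L') hL {IHL} => [_|z L'' IH' /= /andP[hz hL'']].
    by apply: CC_ext (CC_cst 2 0 op) => // w _; rewrite big_nil.
  by apply: CC_ext (CC_add op (hC z hz) (IH' hL'')) => // w _; rewrite big_cons.
rewrite (mlap_open (g := fun x => (-1) ^+ l * tval lam (m - l) (qf x) y +
   (-1) ^+ l * \sum_(z <- L') tval lam (m - l) (qf x) z) op _ x0); last first.
  by move=> z z0; rewrite big_cons mulrDr.
rewrite (mlap_add op (CC_scale _ op (hC y hy)) (CC_scale _ op hL') x0).
rewrite IHL// (mlap_scale _ op (hC y hy) x0) qE mlap_tval//.
by rewrite [in RHS]/tstep /= !big_cons big_nil /q exprS; ring.
Qed.

End LogTest.


Section Shell.
Variables (R : realType) (n : nat).

Definition shell (a b : R) : set 'rV[R]_n := [set x | a <= enorm x /\ enorm x <= b].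

Lemma closed_shell a b : closed (shell a b).
Proof.
exact: (@closedI _ [set x | a <= enorm x] [set x | enorm x <= b] (@closed_enorm_ge _ _ _) (@closed_enorm_le _ _ _)).
Qed.

Lemma shell_pb (a b : R) : 0 < a -> b < 1 -> shell a b `<=` @pball1 R n.
Proof.
move=> a0 b1 x [ax xb]; split; first exact: le_lt_trans xb b1.
by rewrite -enorm_gt0; exact: lt_le_trans ax.
Qed.

Lemma shell_bd (a b : R) (x : 'rV[R]_n) : shell a b x -> `|x| <= b.
Proof. by move=> [_ xb]; exact: le_trans (norm_le_enorm x) xb. Qed.

End Shell.

(** * Testing the equation with logarithmic weights *)

Section ULone.
Variables (R : realType) (m n s : nat) (u : 'rV[R]_n -> R).
Hypotheses (m0 : (0 < m)%N) (mn : (2 * m <= n)%N) (sm : (s <= 2 * m)%N).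
Let pb := @pball1 R n.
Hypothesis hu : CC (2 * m) pb u.
Hypothesis hf : L1 (fun x => if `[< pb x >] then enorm x ^+ s * `|plm m u x| else 0).
Hypothesis hup : L1 (fun x => if `[< pb x >] then Num.max (u x) 0 else 0).

(** The least exponent for which $(\cdot)_+^k$ is of class [C^(2m)]. *)
Let k := (2 * m).+1.
Let op := @open_punct R n.
Let opb := @open_pball R n.
Let chi0 : 'rV[R]_n -> R := cutoff (1 / 2) (3 / 4).
Let W (lam : R) (x : 'rV[R]_n) := lt_fun lam m k (qf x).
Let H lam x := W lam x * chi0 x.

Let h12 : 0 <= 1 / 2 :> R. Proof. lra. Qed.
Let h34 : 1 / 2 < 3 / 4 :> R. Proof. lra. Qed.

Let CW lam : CC (2 * m) (@punct R n) (W lam).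
Proof. exact: CC_lt_fun. Qed.

Let Cchi (O : set 'rV[R]_n) : CC (2 * m) O chi0.
Proof. by apply: CC_sub (CC_cut n _ _ _). Qed.

Let CH lam : CC (2 * m) (@punct R n) (H lam).
Proof. exact: CC_mul. Qed.

Lemma sub_pb_punct : pb `<=` @punct R n.
Proof. by move=> x []. Qed.

(** The inner radius $e^{-1/(2\lambda)}$ is where $1+\lambda\ln|x|^2$ vanishes. *)
Let K (lam : R) : set 'rV[R]_n := shell (expR (- (2 * lam)^-1)) (3 / 4).

Lemma csuppH lam : 0 < lam -> csupp pb (K lam) (H lam).
Proof.
move=> l0; split.
- exact: closed_shell.
- by apply: shell_pb; [exact: expR_gt0|lra].
- by exists (3 / 4) => x; exact: shell_bd.
move=> x nK; rewrite /H.
have [x34|x34] := leP (3 / 4) (enorm x); first by rewrite /chi0 cut_out// mulr0.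
rewrite /W /lt_fun.
have [->|x0] := eqVneq x 0; first by rewrite qf0 expr0n (_ : (m == 0)%N = false) ?mul0r//; lia.
have xr : enorm x < expR (- (2 * lam)^-1).
  by rewrite ltNge; apply/negP => h; apply: nK; split => //; exact: ltW.
have q0 : 0 < qf x by rewrite qf_gt0.
rewrite /posp (_ : 0 < _ = false) ?mulr0 ?mul0r//; apply/negbTE; rewrite -leNgt.
have : ln (qf x) <= - lam^-1.
  rewrite -[leRHS]expRK ler_ln ?posrE ?expR_gt0// -enorm_sqr.
  have -> : - lam^-1 = 2%:R * (- (2 * lam)^-1) by field; rewrite gt_eqF.
  by rewrite expRM_natl lerXn2r ?nnegrE ?enorm_ge0 ?expR_ge0// ltW.
move=> h; have : lam * ln (qf x) <= lam * (- lam^-1) by rewrite ler_wpM2l// ltW.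
by rewrite mulrN divff ?gt_eqF//; lra.
Qed.

Lemma L1_shell_u (a b : R) : 0 < a -> b < 1 -> 0 <= b ->
  L1 (fun x => if `[< shell a b x >] then `|u x| else 0).
Proof.
move=> a0 b1 b0.
have [M M0 HM] := bounded_compact (@closed_shell R n a b)
  (@shell_bd R n a b) (fun x hx => CC_cont hu (shell_pb a0 b1 hx)).
apply: (L1_bounded_supp (C := M) b0).
- apply: meas_if_set; [exact: closed_measurable_rV (@closed_shell R n a b)| |exact: meas_cst].
  apply: (@measurable_funS _ _ (rVm R n) _ (pb : set (rVm R n))).
  + exact: open_measurable_rV opb.
  + exact: shell_pb.
  apply: open_measurable_fun_rV opb _ => x px.
  apply: (@continuous_comp _ _ _ u (fun t => `|t|) x); first exact: (CC_cont hu).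
  exact: norm_continuous.
- by move=> x; case: asboolP => h; rewrite ?normr_id ?normr0//; exact: HM.
- by move=> x hx; case: asboolP => // /shell_bd; rewrite leNgt hx.
Qed.

Let posp_le1 j (lam t : R) : 0 < lam -> 0 < t -> t < 1 -> posp j (1 + lam * ln t) <= 1.
Proof.
move=> l0 t0 t1; rewrite /posp; case: ltP => // h.
have l : ln t <= 0 by rewrite ln_le0// ltW.
by apply: exprn_ile1; [exact: ltW|nra].
Qed.

(** The bound must be uniform in [lam] where the cutoff varies. For $|x|>1/4$ and $\lambda\le 1/8$
    one has $1+\lambda\ln|x|^2\ge 1/2$, so the positive part is inactive and the binomial formula
    writes [H lam] as a polynomial in [lam] whose coefficient functions [v i] do not involve
    [lam]. *)
Lemma shell_bound : exists2 M : R, 0 <= M & forall (lam : R) x, 0 < lam -> lam <= 1 / 8 ->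
  1 / 2 <= enorm x -> `|plm m (H lam) x| <= (if `[< shell (1 / 2) (3 / 4) x >] then M else 0).
Proof.
pose v i (x : 'rV[R]_n) := qf x ^+ m * ln (qf x) ^+ i * chi0 x.
have Cv i : CC (2 * m) (@punct R n) (v i).
  apply: CC_mul => //; apply: CC_mul => //; apply: CC_exp => //; first exact: CC_qf.
  exact: CC_radial (@C1_ln R _).
have Cp i : CC 0 (@punct R n) (plm m (v i)) by apply: CC_plm => //; rewrite addn0.
have s0 : shell (1 / 2) (3 / 4) `<=` @punct R n.
  by apply: subset_trans sub_pb_punct; apply: shell_pb; lra.
have /choice[M HM] : forall i, exists M : R, 0 <= M /\
    forall x, shell (1 / 2) (3 / 4) x -> `|plm m (v i) x| <= M.
  move=> i; have [M M0 h] := bounded_compact (@closed_shell R n (1 / 2) (3 / 4))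
    (@shell_bd R n _ _)
    (fun x hx => CC_cont (Cp i) (s0 x hx)).
  by exists M.
pose MM := \sum_(i < k.+1) ('C(k, i))%:R * M i.
have MM0 : 0 <= MM by apply: sumr_ge0 => i _; rewrite mulr_ge0//; have [] := HM i.
exists MM => // lam x l0 l8 x12.
have O34 := @open_enorm_gt R n (3 / 4).
case: asboolP => hx; last first.
  have x34 : 3 / 4 < enorm x by rewrite ltNge; apply/negP => h; apply: hx.
  rewrite (plm_zero m O34 _ x34) ?normr0// => y /= y34.
  by rewrite /H /chi0 cut_out ?mulr0// ltW.
have Oq := @open_enorm_gt R n (1 / 4).
have xq : 1 / 4 < enorm x by lra.
have sub : [set x : 'rV[R]_n | 1 / 4 < enorm x] `<=` @punct R n.
  by move=> y /= hy; rewrite /punct /= -enorm_gt0; lra.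
have E y : 1 / 4 < enorm y -> H lam y = \sum_(i < k.+1) (('C(k, i))%:R * lam ^+ i) * v i y.
  move=> hy; have y0 : y != 0 := sub y hy.
  have q0 : 0 < qf y by rewrite qf_gt0.
  have pos : 0 < 1 + lam * ln (qf y).
    have h16 : 16^-1 <= qf y.
      rewrite -enorm_sqr (_ : 16^-1 = (1 / 4) ^+ 2); last by field.
      by rewrite lerXn2r ?nnegrE ?enorm_ge0 ?ltW//; lra.
    have : - ln (qf y) <= 4.
      rewrite -lnV ?posrE//; apply: (@le_trans _ _ (ln 16)).
        by rewrite ler_ln ?posrE ?invr_gt0// -[16]invrK lef_pV2 ?posrE ?invr_gt0.
      rewrite (_ : 16 = 2 ^+ 4); last by ring.
      rewrite lnXn//; have := @le_ln1Dx R 1 (ltac:(lra)).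
      by rewrite (_ : 1 + 1 = 2)// => h; lra.
    by move=> h; nra.
  rewrite /H /W /lt_fun /posp pos [1 + _]addrC exprD1n mulr_sumr mulr_suml; apply: eq_bigr => i _.
  by rewrite exprMn /v -mulr_natl; ring.
rewrite (plm_eq m Oq xq E) (plm_sum _ _ Oq _ xq); last first.
  by move=> i; apply: CC_scale => //; exact: CC_sub sub (Cv i).
apply: le_trans (ler_norm_sum _ _ _) _; apply: ler_sum => i _.
rewrite (plm_scale _ Oq (CC_sub sub (Cv i)) xq) normrM; apply: ler_pM => //.
  rewrite ger0_norm ?mulr_ge0 ?exprn_ge0 ?(ltW l0)//.
  by rewrite ler_piMr// exprn_ile1 ?(ltW l0)//; lra.
by have [_] := HM i; apply.
Qed.

(** The region where the cutoff [chi0] equals 1. *)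
Let A : set 'rV[R]_n := [set x | pb x /\ enorm x < 1 / 2].

Lemma open_A : open A.
Proof. exact: (@openI _ pb [set x | enorm x < 1 / 2] opb (@open_enorm_lt _ _ _)). Qed.

Lemma u_neg_L1 : L1 (fun x => if `[< A x >] then Num.max (- u x) 0 else 0).
Proof.
have [a0 [L [a00 hL EP]]] := @plm_test R n m k (ltnSn _) (ltac:(lia)).
have [M M0 HM] := shell_bound.
(* Bounds the whole bracket of [plm_test] on the unit ball, since there [lam] and the powers of the
   logarithmic factor are at most 1. *)
pose CL := a0 + \sum_(y <- L) y.1.1.
have sumL0 : 0 <= \sum_(y <- L) y.1.1.
  by elim: (L) hL => [|y L' IH] /=; rewrite ?big_nil// big_cons => /andP[y0 /IH]; apply: addr_ge0.
pose F x := if `[< pb x >] then enorm x ^+ s * `|plm m u x| else 0.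
pose Up x := if `[< pb x >] then Num.max (u x) 0 else 0.
pose Sh x := if `[< shell (1 / 2) (3 / 4) x >] then `|u x| else 0.
have iSh : L1 Sh by apply: L1_shell_u; lra.
pose CC0 := Int F + CL * Int Up + M * Int Sh.
(* Tends to 0 and stays within the range of [shell_bound]. *)
pose lam (j : nat) : R := 8^-1 * j.+1%:R^-1.
have l0 j : 0 < lam j by rewrite mulr_gt0 ?invr_gt0.
have l8 j : lam j <= 1 / 8.
  by rewrite /lam mul1r ler_piMr ?invr_ge0// invf_le1// ler1n.
pose g j x := if `[< A x >] then Num.max (- u x) 0 * (a0 * posp k (1 + lam j * ln (qf x))) else 0.
have Asub x : A x -> @punct R n x by move=> [/sub_pb_punct].
have cun x : A x -> {for x, continuous (fun x => Num.max (- u x) 0)}.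
  move=> [px _]; apply: (@continuous_max R _ (fun x => - u x) (fun=> 0) x); last exact: cst_continuous.
  by apply: (@continuousN R _ _ u x); exact: (CC_cont hu).
have mg j : meas (g j).
  apply: meas_if_open; first exact: open_A.
  move=> x Ax; apply: (@continuousM R _ (fun x => Num.max (- u x) 0)); first exact: cun.
  apply: (@continuousM R _ (fun=> a0)); first exact: cst_continuous.
  apply: (CC_cont (k := 0) (O := @punct R n)); last exact: Asub.
  apply: (@CC_radial R n 0 (fun t => posp k (1 + lam j * ln t))).
  have := @C1_lt_fun R 0 (lam j) 0 k (ltn0Sn _).
  by apply: C1_ext; [exact: open_pos|move=> t _; rewrite /lt_fun expr0 mul1r].
have nonneg x : 0 <= Num.max (- u x) 0 by rewrite le_max lexx orbT.
have g0 j x : 0 <= g j x.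
  rewrite /g; case: ifP => // _; rewrite mulr_ge0// mulr_ge0// ?posp_ge0//; exact: ltW.
pose P j x := (-1) ^+ m * plm m (H (lam j)) x.
have cs j := csuppH (l0 j).
have CHp j : CC (2 * m) pb (H (lam j)) by exact: CC_sub sub_pb_punct (CH _).
have iuP j : L1 (fun x => u x * plm m (H (lam j)) x).
  apply: (csupp_L1 opb (csupp_mulr u (csupp_plm m (cs j)))); apply: (CC_mul opb).
    exact: CC_leq hu.
  by apply: CC_plm => //; rewrite addn0.
have ifH j : L1 (fun x => plm m u x * H (lam j) x).
  apply: (csupp_L1 opb (csupp_mulr _ (cs j))); apply: (CC_mul opb).
    by apply: CC_plm => //; rewrite addn0.
  exact: CC_leq (CHp j).
have ibpH j : Int (fun x => u x * plm m (H (lam j)) x) = Int (fun x => plm m u x * H (lam j) x).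
  exact: (ibp_plm opb (cs j) hu (CHp j)).
have HF j x : `|plm m u x * H (lam j) x| <= F x.
  rewrite /F; case: asboolP => px; last first.
    have [_ KO _ ->] := cs j; first by rewrite mulr0 normr0.
    by move=> /KO.
  have [x1 x0] := px; have q0 : 0 < qf x by rewrite qf_gt0.
  have q1 : qf x < 1.
    by rewrite -enorm_sqr -(expr1n R 2) ltrXn2r ?nnegrE ?enorm_ge0.
  rewrite normrM mulrC ler_wpM2r// /H normrM.
  apply: (@le_trans _ _ (qf x ^+ m * 1)).
    apply: ler_pM => //; last exact: cut_abs.
    rewrite /W /lt_fun ger0_norm; last by rewrite mulr_ge0 ?posp_ge0 ?exprn_ge0 ?qf_ge0.
    by rewrite ler_piMr ?exprn_ge0 ?qf_ge0// posp_le1.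
  by rewrite mulr1 -enorm_sqr -exprM ler_wiXn2l ?enorm_ge0// ltW.
(* For $|x|<1/2$ the function $(-1)^m(-\Delta)^m W$ is nonnegative, so the negative part of [u] is
   isolated with a favourable sign and the positive part costs at most [CL * Up]. On the shell only
   [|u|] and [shell_bound] are used. *)
have key j x : g j x <= - ((-1) ^+ m * (u x * plm m (H (lam j)) x)) + CL * Up x + M * Sh x.
  have [x12|x12] := leP (1 / 2) (enorm x).
    have -> : g j x = 0 by rewrite /g; case: asboolP => // -[_ h]; lra.
    have b := HM (lam j) x (l0 j) (l8 j) x12.
    have up0 : 0 <= CL * Up x.
      rewrite mulr_ge0 ?addr_ge0 ?(ltW a00)// /Up; case: ifP => // _.
      by rewrite le_max lexx orbT.
    have : `|(-1) ^+ m * (u x * plm m (H (lam j)) x)| <= M * Sh x.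
      rewrite normrM normrX normrN1 expr1n mul1r normrM mulrC.
      move: b; rewrite /Sh; case: ifP => _ b; first by rewrite ler_wpM2r.
      by move: b; rewrite normr_le0 => /eqP ->; rewrite normr0 mul0r mulr0.
    by rewrite ler_norml => /andP[h1 h2]; lra.
  have Sh0 : 0 <= M * Sh x by rewrite mulr_ge0// /Sh; case: ifP.
  have [px|npx] := pselect (pb x); last first.
    have -> : g j x = 0 by rewrite /g; case: asboolP => // -[].
    have [_ KO _ ->] := csupp_plm m (cs j); last by move=> /KO.
    rewrite !mulr0 oppr0 add0r; apply: addr_ge0 => //.
    by rewrite /Up; case: asboolP => // _; rewrite mulr0.
  have [x1 x0] := px; have q0 : 0 < qf x by rewrite qf_gt0.
  have q1 : qf x < 1.
    by rewrite -enorm_sqr -(expr1n R 2) ltrXn2r ?nnegrE ?enorm_ge0.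
  have -> : g j x = Num.max (- u x) 0 * (a0 * posp k (1 + lam j * ln (qf x))).
    by rewrite /g; case: asboolP => // h; exfalso; exact: h.
  have -> : Up x = Num.max (u x) 0 by rewrite /Up; case: asboolP.
  have O12 := @open_enorm_lt R n (1 / 2).
  have -> : plm m (H (lam j)) x = plm m (W (lam j)) x.
    apply: (plm_eq m O12 x12) => y /= y12.
    by rewrite /H /chi0 cut_in ?mulr1// ltW.
  rewrite EP//.
  set V := \sum_(y <- L) _.
  have -> : (-1) ^+ m * (u x * ((-1) ^+ m * (a0 * posp k (1 + lam j * ln (qf x)) + V))) =
      u x * (a0 * posp k (1 + lam j * ln (qf x)) + V).
    by rewrite mulrCA; congr (_ * _); rewrite mulrA -expr2 sqrr_sign mul1r.
  have V0 : 0 <= V /\ V <= \sum_(y <- L) y.1.1.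
    rewrite /V; elim: (L) hL => [|y L' IH] /=; first by rewrite !big_nil.
    rewrite !big_cons => /andP[y0 /IH[v0 v1]].
    have t0 : 0 <= lam j ^+ y.1.2 * posp y.2 (1 + lam j * ln (qf x)).
      by rewrite mulr_ge0 ?posp_ge0// exprn_ge0// ltW.
    have t1 : lam j ^+ y.1.2 * posp y.2 (1 + lam j * ln (qf x)) <= 1.
      apply: mulr_ile1; rewrite ?posp_ge0 ?posp_le1 ?exprn_ge0 ?(ltW (l0 j))//.
      by apply: exprn_ile1; [exact: ltW|have := l8 j; lra].
    split; first by rewrite addr_ge0// mulr_ge0.
    by rewrite lerD// ler_piMr.
  have p1 := @posp_le1 k (lam j) (qf x) (l0 j) q0 q1.
  have p0 := posp_ge0 k (1 + lam j * ln (qf x)).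
  set p := posp k _ in p0 p1 *.
  have [v0 v1] := V0; rewrite /CL.
  set SL := \sum_(y <- L) y.1.1 in v1 *.
  have ap : 0 <= a0 * p by rewrite mulr_ge0// ltW.
  have ap1 : a0 * p <= a0 by rewrite ler_piMr// ltW.
  case: (leP 0 (u x)) => ux.
    rewrite (max_r (_ : - u x <= 0)) ?oppr_le0// mul0r.
    have : u x * (a0 * p + V) <= (a0 + SL) * u x by rewrite mulrC ler_wpM2r// lerD.
    by lra.
  rewrite max_l; last by rewrite oppr_ge0 ltW.
  have : 0 <= - u x * V by rewrite mulr_ge0// oppr_ge0 ltW.
  by lra.
have ig j : L1 (g j).
  apply: L1_le (mg j) (_ : L1 (fun x => - ((-1) ^+ m * (u x * plm m (H (lam j)) x)) + CL * Up x + M * Sh x)) _.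
    by apply: L1D; [apply: L1D; [apply: L1N; exact: L1Z|exact: L1Z]|exact: L1Z].
  by move=> x; rewrite ger0_norm.
have bnd j : Int (g j) <= CC0.
  have i1 : L1 (fun x => - ((-1) ^+ m * (u x * plm m (H (lam j)) x))) by apply: L1N; exact: L1Z.
  have i2 : L1 (fun x => CL * Up x) by exact: L1Z.
  have i3 : L1 (fun x => M * Sh x) by exact: L1Z.
  apply: le_trans (Int_le (ig j) (L1D (L1D i1 i2) i3) (key j)) _.
  rewrite IntD//; last exact: L1D.
  rewrite IntD// !IntZ// IntN; last exact: L1Z.
  rewrite IntZ// ibpH /CC0 !lerD2r.
  apply: le_trans (ler_norm _) _.
  rewrite normrN normrM normrX normrN1 expr1n mul1r.
  apply: le_trans (Int_abs (ifH j)) _.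
  exact: Int_le (L1_abs (ifH j)) hf (HF j).
have := @L1_fatou R n g (fun x => a0 * (if `[< A x >] then Num.max (- u x) 0 else 0)) CC0 ig g0 bnd.
have mU : meas (fun x => if `[< A x >] then Num.max (- u x) 0 else 0).
  by apply: meas_if_open; [exact: open_A|exact: cun].
move=> /(_ _ (measM (meas_cst a0) mU)) iL.
have : L1 (fun x => a0^-1 * (a0 * (if `[< A x >] then Num.max (- u x) 0 else 0))).
  apply: L1Z; apply: iL => x; rewrite /g; case: asboolP => Ax; last first.
    by rewrite mulr0; exact: cvg_cst.
  rewrite [X in _ --> X](_ : _ = Num.max (- u x) 0 * (a0 * posp k (1 + 0 * ln (qf x)))); last first.
    by rewrite mul0r addr0 /posp ltr01 expr1n mulr1 mulrC.
  apply: cvgMr; apply: cvgMr.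
  apply: (@cvg_comp _ _ _ (fun j => 1 + lam j * ln (qf x)) (posp k)); last first.
    have := C1_cont (@C1_posp R 0 k (ltn0Sn _)) (t := 1 + 0 * ln (qf x)) Logic.I.
    exact.
  apply: cvgD; first exact: cvg_cst.
  apply: cvgMl; rewrite -[X in _ --> X](mulr0 8^-1); apply: cvgMr; exact: cvg_inv_succ.
by apply: L1_ext => x; rewrite mulrA mulVf ?mul1r// gt_eqF.
Qed.

Lemma u_L1 : L1 (fun x => if `[< A x >] then u x else 0).
Proof.
have mU : meas (fun x => if `[< A x >] then u x else 0).
  by apply: meas_if_open; [exact: open_A|move=> x [px _]; exact: (CC_cont hu)].
apply: L1_le mU (L1D hup u_neg_L1) _ => x.
case: asboolP => Ax; last first.
  by rewrite normr0; case: ifP => _; rewrite addr0// le_max lexx orbT.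
have [px _] := Ax; have -> : `[< pb x >] by exact/asboolP.
case: (leP 0 (u x)) => ux; first by rewrite ger0_norm// lerDl le_max lexx orbT.
by rewrite ltr0_norm// add0r le_max lexx.
Qed.

End ULone.

(** * The Taylor remainder of the fundamental solution *)


Section TaylorPoly.
Variable R : realType.
Implicit Types (n k m : nat).

Lemma Van_intro n k (g : 'rV[R]_n -> R) :
  (forall s, (size s < k)%N -> Dsq s g 0 = 0) -> Van k g.
Proof.
elim: k g => [//|k IH] g H; split; first exact: (H [::]).
by move=> i; apply: IH => s sk; rewrite -Dsq_rcons; apply: H; rewrite size_rcons.
Qed.

Lemma Dsq_add n (O : set 'rV[R]_n) (s : seq 'I_n) f g : open O ->
  CC (size s) O f -> CC (size s) O g ->
  forall y, O y -> Dsq s (fun x => f x + g x) y = Dsq s f y + Dsq s g y.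
Proof.
move=> oO; elim: s => [//|i s IH] cf cg y Oy.
rewrite [LHS](pd_open i oO (g := fun y => Dsq s f y + Dsq s g y))//; last first.
  by move=> z Oz; apply: IH => //; exact: CC_S.
have d h : CC (size s).+1 O h -> CC 1 O (Dsq s h) by move=> ch; apply: CC_Dsq; rewrite addn1.
by rewrite (pd_add _ (d _ cf) (d _ cg) Oy).
Qed.

Lemma Dsq_scale n (O : set 'rV[R]_n) (s : seq 'I_n) (a : R) f : open O ->
  CC (size s) O f ->
  forall y, O y -> Dsq s (fun x => a * f x) y = a * Dsq s f y.
Proof.
move=> oO; elim: s => [//|i s IH] cf y Oy.
rewrite [LHS](pd_open i oO (g := fun y => a * Dsq s f y))//; last first.
  by move=> z Oz; apply: IH => //; exact: CC_S.
have d h : CC (size s).+1 O h -> CC 1 O (Dsq s h) by move=> ch; apply: CC_Dsq; rewrite addn1.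
by rewrite (pd_scale _ _ oO (d _ cf) Oy).
Qed.

Lemma Dsq_cst0 n (s : seq 'I_n) (y : 'rV[R]_n) : Dsq s (fun=> 0) y = 0.
Proof.
elim: s y => [//|i s IH] y.
rewrite [LHS](pd_open i (@openT 'rV[R]_n) (g := fun=> 0)) ?pd_cst// => z _; exact: IH.
Qed.

Lemma Dsq_sum n (O : set 'rV[R]_n) (I : Type) (r : seq I) (P : pred I) (s : seq 'I_n)
    (a : I -> R) (f : I -> 'rV[R]_n -> R) : open O ->
  (forall i, CC (size s) O (f i)) -> forall y, O y ->
  Dsq s (fun x => \sum_(i <- r | P i) f i x * a i) y = \sum_(i <- r | P i) Dsq s (f i) y * a i.
Proof.
move=> oO cf y Oy; elim: r => [|i r IH].
  rewrite big_nil -[RHS](Dsq_cst0 s y).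
  by apply: (Dsq_open s oO) => // z _; rewrite big_nil.
rewrite big_cons; case: (boolP (P i)) => Pi; last first.
  by rewrite -IH; apply: (Dsq_open s oO) => // z _; rewrite big_cons (negbTE Pi).
have c1 : CC (size s) O (fun x => a i * f i x) by exact: CC_scale.
have c2 : CC (size s) O (fun x => \sum_(i <- r | P i) f i x * a i).
  apply: CC_sum => // j; apply: CC_mul => //; exact: CC_cst.
rewrite -IH mulrC -(Dsq_scale (a i) oO (cf i) Oy) -(Dsq_add oO c1 c2 Oy).
by apply: (Dsq_open s oO) => // z _; rewrite big_cons Pi mulrC.
Qed.

Lemma Dsq_reflect n (O : set 'rV[R]_n) (s : seq 'I_n) (g : 'rV[R]_n -> R) (x : 'rV[R]_n) :
  open O -> CC (size s) O g -> forall y, O (x - y) ->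
  Dsq s (fun y => g (x - y)) y = (-1) ^+ size s * Dsq s g (x - y).
Proof.
move=> oO; elim: s => [|i s IH] cg y Oy; first by rewrite mul1r.
have aE (z : 'rV[R]_n) : x - z = -1 *: z + x by rewrite scaleN1r addrC.
pose O' := [set y : 'rV[R]_n | O (x - y)].
have oO' : open O'.
  apply: (@open_comp _ _ (fun y : 'rV[R]_n => x - y) O) => // z _.
  rewrite (_ : (fun y : 'rV[R]_n => x - y) = (fun y => -1 *: y + x)); last by apply/funext.
  exact: affine_continuous.
rewrite [LHS](pd_open i oO' (g := fun y => (-1) ^+ size s * Dsq s g (-1 *: y + x)))//; last first.
  by move=> z Oz; rewrite -aE; apply: IH => //; exact: CC_S.
have d : CC 1 O (Dsq s g) by apply: CC_Dsq; rewrite addn1.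
have Oy' : O (-1 *: y + x) by rewrite -aE.
have h := is_derive_affine (pd_is_derive (@CC_derivable _ _ _ _ _ d _ i Oy')).
rewrite (pdP (is_deriveZ ((-1) ^+ size s) h)) aE exprS /=.
rewrite /GRing.scale /=; ring.
Qed.

Lemma is_derive_mono n (b : 'I_n -> nat) (i : 'I_n) (y : 'rV[R]_n) :
  is_derive y (evec R i) (mono_fact b)
    (if b i == 0%N then 0 else - mono_fact (fun j => (b j - (j == i))%N) y).
Proof.
apply/line_derive0.
pose K := (\prod_(j | j != i) (- y 0 j) ^+ b j) / (\prod_j (b j)`!)%:R.
have E : (fun h : R => mono_fact b (h *: evec R i + y)) =
    K *: ((- (id + cst (y 0 i))) ^+ b i).
  apply/funext => h; rewrite /mono_fact /K (bigD1 i)//= !mxE eqxx mulr1.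
  rewrite (eq_bigr (fun j => (- y 0 j) ^+ b j)); last first.
    by move=> j ji; rewrite !mxE eq_sym (negbTE ji) mulr0 add0r.
  rewrite [RHS]/GRing.scale /= -mulrA mulrC; congr (_ * _).
  by elim: (b i) => [|k IH]; rewrite ?expr0// !exprS IH.
rewrite E; case: (b i =P 0%N) => [b0|/eqP b0].
  rewrite b0 expr0.
  have -> : K *: (1 : R -> R) = cst K by apply/funext => h; rewrite /= [LHS]mulr1.
  exact: is_derive_cst.
have : exists k, b i = k.+1 by exists (b i).-1; rewrite prednK// lt0n.
move=> [k bk]; rewrite bk.
apply: is_derive_eq.
rewrite /= /GRing.scale /= !fctE /mono_fact.
rewrite [\prod_j (- y 0 j) ^+ _](bigD1 i)//= eqxx bk subn1 /=.
rewrite (eq_bigr (fun j => (- y 0 j) ^+ b j)); last first.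
  by move=> j /negbTE ->; rewrite subn0.
have EF : (\prod_j (b j)`! = k.+1 * \prod_j (b j - (j == i))`!)%N.
  rewrite (bigD1 i)//= [in RHS](bigD1 i)//= eqxx bk subn1 factS mulnA; congr (_ * _)%N.
  by apply: eq_bigr => j /negbTE ->; rewrite subn0.
rewrite /K EF natrM add0r addr0.
have F0 : (\prod_j (b j - (j == i))`!)%:R != 0 :> R.
  by rewrite pnatr_eq0 -lt0n prodn_gt0// => j; exact: fact_gt0.
have k0 : k.+1%:R != 0 :> R by rewrite pnatr_eq0.
move: (\prod_j _`!)%:R F0 k.+1%:R k0 (\prod_(j | _) _) (- y 0 i) => F F0 k' k0 P yi.
by field; rewrite F0.
Qed.

Lemma Dsq_mono n (b : 'I_n -> nat) (s : seq 'I_n) (y : 'rV[R]_n) :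
  Dsq s (mono_fact b) y = if [forall i, (count_mem i s <= b i)%N]
    then (-1) ^+ size s * mono_fact (fun i => (b i - count_mem i s)%N) y else 0.
Proof.
elim: s y => [|i s IH] y.
  have -> : [forall i : 'I_n, (count_mem i [::] <= b i)%N] by apply/forallP.
  by rewrite mul1r; congr mono_fact; apply/funext => j; rewrite subn0.
have oT := @openT 'rV[R]_n.
rewrite [LHS](pd_open i oT (fun y _ => IH y))//.
case: (boolP [forall i, (count_mem i s <= b i)%N]) => [/forallP h|/forallPn[j]]; last first.
  rewrite -ltnNge => h; rewrite pd_cst.
  case: forallP => // /(_ j); rewrite /= leqNgt; case/negP.
  by apply: leq_trans h _; rewrite leq_addl.
rewrite (pdP (is_deriveZ ((-1) ^+ size s) (is_derive_mono _ _ _))).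
rewrite [LHS]/GRing.scale /=; case: eqP => bi.
  rewrite mulr0; case: forallP => // /(_ i); rewrite /= eqxx add1n.
  by move/eqP: bi; rewrite subn_eq0 => b1 b2; have := leq_trans b2 b1; rewrite ltnn.
have -> : [forall i0, ((i == i0) + count_mem i0 s <= b i0)%N].
  apply/forallP => j; have := h j; case: eqP => [<- _|_]; last by rewrite add0n.
  by rewrite add1n -subn_gt0 lt0n; exact/eqP.
rewrite exprS mulN1r mulrN mulNr; congr (- (_ * mono_fact _ _)).
by apply/funext => j; rewrite eq_sym; lia.
Qed.

Lemma mono_fact0 n (b : 'I_n -> nat) :
  mono_fact b (0 : 'rV[R]_n) = [forall i, b i == 0%N]%:R.
Proof.
rewrite /mono_fact; case: (boolP [forall i, b i == 0%N]) => [/forallP h|/forallPn[i bi]].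
  by rewrite !big1 ?divr1// => i _; rewrite (eqP (h i)).
by rewrite (bigD1 i)//= mxE oppr0 expr0n (negbTE bi) !mul0r.
Qed.

(** Up to sign, the scaled monomials are dual to the derivatives at the origin: a derivative of the
    Taylor polynomial picks out one coefficient. *)
Lemma Dsq_mono0 n (b : 'I_n -> nat) (s : seq 'I_n) :
  Dsq s (mono_fact b) (0 : 'rV[R]_n) = (-1) ^+ size s * [forall i, b i == count_mem i s]%:R.
Proof.
rewrite Dsq_mono mono_fact0.
case: (boolP [forall i, (_ <= _)%N]) => [/forallP h|/forallPn[i hi]].
  congr (_ * (nat_of_bool _)%:R); apply: eq_forallb => i; rewrite subn_eq0.
  by rewrite eqn_leq (h i) andbT.
case: forallP => [/(_ i)/eqP bi|]; last by rewrite mulr0.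
by rewrite bi leqnn in hi.
Qed.

Lemma CC_mono n k (b : 'I_n -> nat) (O : set 'rV[R]_n) : open O -> CC k O (mono_fact b).
Proof.
move=> oO.
have : CC k O (fun y => (\prod_i (b i)`!)%:R^-1 * \prod_i (- y 0 i) ^+ b i).
  apply: CC_scale => //; apply: CC_prod => // i; apply: CC_exp => //; apply: CC_opp => //.
  exact: CC_coord.
by apply: CC_ext => // y _; rewrite mulrC.
Qed.

Lemma sum_count_mem n (s : seq 'I_n) : (\sum_i count_mem i s)%N = size s.
Proof.
elim: s => [|j s IH]; first by rewrite big1.
rewrite /= big_split /= IH (bigD1 j)//= eqxx big1 ?addn0// => i ij.
by rewrite eq_sym (negbTE ij).
Qed.

Lemma perm_flatten_nseq n (s : seq 'I_n) :
  perm_eq (flatten [seq nseq (count_mem i s) i | i <- enum 'I_n]) s.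
Proof.
apply/allP => j _ /=; apply/eqP.
rewrite count_flatten -map_comp sumnE big_map big_enum /= (bigD1 j)//=.
rewrite count_nseq /= eqxx mul1n big1 ?addn0// => i ij.
by rewrite count_nseq /= (negbTE ij).
Qed.

Lemma open_neq_rV n (x : 'rV[R]_n) : open [set y : 'rV[R]_n | y != x].
Proof.
rewrite (_ : [set y | y != x] = (fun y => 1 *: y + - x) @^-1` (@punct R n)).
  by apply: open_comp => [y _|]; [exact: affine_continuous|exact: open_punct].
by apply/seteqP; split => y; rewrite /punct /= scale1r subr_eq0.
Qed.

Lemma CC_fundsol_sub m n k (c : R) (x : 'rV[R]_n) : (2 * m <= n)%N ->
  CC k [set y | y != x] (fun y => fundsol m n c (x - y)).
Proof.
move=> mn; have o := @open_neq_rV n x.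
have : CC k [set y | y != x] (fun y => fundsol m n c (-1 *: y + x)).
  apply: (CC_affine o (CC_phi c mn k)) => y /= yx.
  by rewrite /punct /= scaleN1r addrC subr_eq0 eq_sym.
by apply: CC_ext => // y _; rewrite scaleN1r addrC.
Qed.

Lemma CC_psi m n k s (c : R) (x : 'rV[R]_n) : (2 * m <= n)%N ->
  CC k [set y | y != x] (psi_kernel m n s c x).
Proof.
move=> mn; have o := @open_neq_rV n x.
apply: (CC_sub_fun o (CC_fundsol_sub k c x mn)); apply: CC_sum => // b.
by apply: CC_mul => //; [exact: CC_mono|exact: CC_cst].
Qed.

(** The sign $(-1)^{|s|}$ appears twice, from the reflection $y\mapsto x-y$ and from the monomials
    in $-y$, so the two contributions cancel once the directions are sorted. *)
Lemma Van_psi m n k (c : R) (x : 'rV[R]_n) : (2 * m <= n)%N -> x != 0 ->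
  Van k (psi_kernel m n k c x).
Proof.
move=> mn x0; apply: Van_intro => s sk.
have o := @open_neq_rV n x; have O0 : [set y : 'rV[R]_n | y != x] 0 by rewrite /= eq_sym.
pose P y := \sum_(b : {ffun 'I_n -> 'I_k} | (mabs (fun i => nat_of_ord (b i)) < k)%N)
     mono_fact (fun i => nat_of_ord (b i)) y *
     Dmulti (fun i => nat_of_ord (b i)) (fundsol m n c) x.
have cP : CC (size s) [set y | y != x] P.
  by apply: CC_sum => // b; apply: CC_mul => //; [exact: CC_mono|exact: CC_cst].
have := Dsq_add o (CC_fundsol_sub (size s) c x mn) (CC_scale (-1) o cP) O0.
rewrite (Dsq_scale (-1) o cP O0) => E.
rewrite (_ : psi_kernel m n k c x = (fun y => fundsol m n c (x - y) + -1 * P y)); last first.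
  by apply/funext => y; rewrite mulN1r.
rewrite {}E (Dsq_reflect (@open_punct R n) (CC_phi c mn (size s))); last by rewrite subr0.
rewrite subr0 (Dsq_sum _ _ _ o _ O0); last by move=> b; exact: CC_mono.
have cn i : (count_mem i s < k)%N by apply: leq_ltn_trans (count_size _ _) sk.
(* The multi-index of the list [s]; its entries fit in ['I_k] because the list is shorter than
   [k]. *)
pose b0 : {ffun 'I_n -> 'I_k} := [ffun i => Ordinal (cn i)].
have b0E : (fun i => nat_of_ord (b0 i)) = (fun i => count_mem i s).
  by apply/funext => i; rewrite ffunE.
rewrite (bigD1 b0) /=; last by rewrite b0E /mabs sum_count_mem.
rewrite big1 ?addr0; last first.
  move=> b /andP[_ bb]; rewrite Dsq_mono0.
  case: forallP => [h|_]; last by rewrite mulr0 mul0r.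
  case/negP: bb; apply/eqP/ffunP => i; apply/val_inj; rewrite ffunE /=.
  exact/eqP.
rewrite Dsq_mono0 b0E.
have -> : [forall i, nat_of_ord (b0 i) == count_mem i s] by apply/forallP => i; rewrite ffunE.
rewrite mulr1 /Dmulti -DsqE (Dsq_perm (@open_punct R n) (perm_flatten_nseq s) _ x0).
  by rewrite mulN1r subrr.
exact: CC_phi.
Qed.

End TaylorPoly.


(** * Limits in finite-dimensional spans and changes at one point *)

Section Tools.
Variable R : realType.
Implicit Types (n k m : nat).

Lemma cvgn_unique (w : nat -> R) (a b : R) : w @ \oo --> a -> w @ \oo --> b -> a = b.
Proof. exact: cvg_unique. Qed.

(* Eliminate one function at a time, using a point where it does not vanish as a pivot. *)
Lemma span_limit (T : Type) (E : set T) (I : eqType) (r : seq I) : uniq r ->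
  forall (e : I -> T -> R) (A : nat -> I -> R) (w : T -> R),
  (forall x, E x -> (fun j => \sum_(i <- r) A j i * e i x) @ \oo --> w x) ->
  exists a : I -> R, forall x, E x -> w x = \sum_(i <- r) a i * e i x.
Proof.
elim: r => [_|i r IH] => [e A w H|/=/andP[ir ur] e A w H].
  exists (fun=> 0) => x Ex; rewrite big_nil; apply: cvgn_unique (H x Ex) _.
  rewrite (_ : (fun j => _) = cst 0); first exact: cvg_cst.
  by apply/funext => j; rewrite big_nil.
have [[x0 Ex0 ex0]|no] := pselect (exists2 x0, E x0 & e i x0 != 0); last first.
  have z x : E x -> e i x = 0.
    by move=> Ex; apply/eqP; case: eqP => // /eqP h; exfalso; apply: no; exists x.
  have [|a Ha] := IH ur e A w.
    move=> x Ex; have := H x Ex.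
    rewrite (_ : (fun j => \sum_(k <- i :: r) _) = (fun j => \sum_(k <- r) A j k * e k x))//.
    by apply/funext => j; rewrite big_cons z// mulr0 add0r.
  by exists a => x Ex; rewrite big_cons z// mulr0 add0r; exact: Ha.
pose e' (k : I) x := e k x - e k x0 / e i x0 * e i x.
pose w' x := w x - w x0 * (e i x / e i x0).
have [|a Ha] := IH ur e' A w'.
  move=> x Ex.
  rewrite (_ : (fun j => \sum_(k <- r) _) = (fun j => \sum_(k <- i :: r) A j k * e k x -
      (\sum_(k <- i :: r) A j k * e k x0) * (e i x / e i x0))).
    by apply: cvgB; [exact: H|apply: cvgMl; exact: H].
  apply/funext => j; rewrite !big_cons mulrDl.
  have -> : A j i * e i x0 * (e i x / e i x0) = A j i * e i x by field.
  rewrite opprD addrACA subrr add0r mulr_suml -sumrB; apply: eq_bigr => k _.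
  by rewrite /e'; ring.
exists (fun k : I => if k == i then w x0 / e i x0 - \sum_(k <- r) a k * (e k x0 / e i x0) else a k).
move=> x Ex; rewrite big_cons eqxx.
rewrite [X in _ = _ + X](eq_big_seq (fun k : I => a k * e k x)); last first.
  by move=> k kr; case: eqP => // ki; rewrite -ki kr in ir.
have := Ha x Ex; rewrite /w' => /eqP; rewrite subr_eq => /eqP ->.

have -> : \sum_(j <- r) a j * e' j x = \sum_(j <- r) a j * e j x -
    (\sum_(j <- r) a j * (e j x0 / e i x0)) * e i x.
  by rewrite mulr_suml -sumrB; apply: eq_bigr => j _; rewrite /e'; ring.
by ring.
Qed.

Lemma CC_local n k (O : set 'rV[R]_n) g :
  (forall x, O x -> exists2 O' : set 'rV[R]_n, O' x & CC k O' g) -> CC k O g.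
Proof.
move=> H; apply/CC_Ck => s sk x Ox; case: (H x Ox) => V Vx /CC_Ck h; exact: h.
Qed.

Lemma near_small (e : R) : 0 < e -> \forall j \near \oo, (j.+1%:R^-1 : R) < e.
Proof. by move=> e0; exact: (near_infty_natSinv_lt (PosNum e0)). Qed.

(** The indicator of the point is the limit of indicators of shrinking cubes. *)
Lemma Int_point n (x : 'rV[R]_n) (a : R) : (0 < n)%N ->
  L1 (fun y => if y == x then a else 0) /\ Int (fun y => if y == x then a else 0) = 0.
Proof.
move=> n0; pose h (j : nat) : R := j.+1%:R^-1.
have h0 j : 0 < h j by rewrite invr_gt0.
have h1 j : h j <= 1 by rewrite invf_le1// ler1n.
have ib M : 0 <= M -> L1 (fun y : 'rV[R]_n => boxi M (y - x)).
  by move=> M0; exact: (L1_translate (- x) (@L1_boxi R n M M0)).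
have [||||ig gl] := @Int_cvg R n (fun j y => a * boxi (h j) (y - x))
    (fun y => if y == x then a else 0) (fun y => `|a| * boxi 1 (y - x)).
- by move=> j; apply: L1_meas; apply: L1Z; apply: ib; exact: ltW.
- by apply: L1Z; exact: ib.
- move=> j y; rewrite normrM ler_wpM2l// ger0_norm ?boxi_ge0//.
  rewrite /boxi; case: (leP `|y - x| (h j)) => yh; last by case: ifP.
  by rewrite (le_trans yh (h1 j)).
- move=> y; case: eqP => [->|/eqP yx].
    rewrite (_ : (fun j => _) = cst a); first exact: cvg_cst.
    by apply/funext => j; rewrite subrr boxi_in ?mulr1// normr0 ltW.
  apply: cvg_near_cst.
  have p : 0 < `|y - x| by rewrite normr_gt0 subr_eq0.
  have : \forall j \near \oo, h j < `|y - x|.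
    exact: near_small.
  by apply: filterS => j hj; rewrite boxi_out ?mulr0.
split=> //; apply: cvgn_unique gl _.
rewrite (_ : (fun j => _) = (fun j => a * (2 * h j) ^+ n)); last first.
  apply/funext => j; have j0 := ltW (h0 j).
  by rewrite (IntZ _ (ib _ j0)) (Int_translate (- x) (L1_boxi n j0)) Int_boxi.
rewrite -[X in _ --> X](mulr0 a); apply: cvgMr.
rewrite (_ : 0 = (2 * 0) ^+ n :> R); last by rewrite mulr0 expr0n eqn0Ngt n0.
apply: (@cvg_comp _ _ _ (fun j => 2 * h j) (fun t => t ^+ n)); last exact: exprn_continuous.
by apply: cvgMr; exact: cvg_inv_succ.
Qed.

(** [Npot] sets its integrand to 0 at [y = x]; this allows comparison with integrands that are not
    modified there. *)
Lemma Int_modify n (x : 'rV[R]_n) g h : (0 < n)%N -> L1 g ->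
  (forall y, y != x -> h y = g y) -> L1 h /\ Int h = Int g.
Proof.
move=> n0 ig gh; have [ip Ip] := Int_point x (h x - g x) n0.
have E : h = (fun y => g y + (if y == x then h x - g x else 0)).
  apply/funext => y; case: eqP => [->|/eqP yx]; first by rewrite addrC subrK.
  by rewrite addr0 gh.
by rewrite E; split; [exact: L1D|rewrite IntD// Ip addr0].
Qed.

End Tools.

(** * Convergence of the integral defining N *)

Section Newton.
Variables (R : realType) (m n s : nat) (c : R) (f : 'rV[R]_n -> R).
Hypotheses (m0 : (0 < m)%N) (mn : (2 * m <= n)%N).
Let pb := @pball1 R n.
Let opb := @open_pball R n.
Hypothesis cf : CC 0 pb f.
Let F y := if `[< pb y >] then enorm y ^+ s * `|f y| else 0.
Hypothesis hf : L1 F.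
Let phi := fundsol m n c.
Let psi := psi_kernel m n s c.

Lemma continuous_dist (x : 'rV[R]_n) : continuous (fun y : 'rV[R]_n => `|y - x|).
Proof.
move=> y; apply/continuous_rVP => e e0; exists e => // z zy.
apply: le_lt_trans (ler_dist_dist _ _) _.
by rewrite opprB addrA subrK.
Qed.

Lemma closed_box (x : 'rV[R]_n) (r : R) : closed [set y : 'rV[R]_n | `|y - x| <= r].
Proof.
apply: (@closed_comp _ _ (fun y : 'rV[R]_n => `|y - x|) [set t | t <= r]); last exact: closed_le.
by move=> y _; exact: continuous_dist.
Qed.

Lemma closed_boxC (x : 'rV[R]_n) (r : R) : closed [set y : 'rV[R]_n | r <= `|y - x|].
Proof.
apply: (@closed_comp _ _ (fun y : 'rV[R]_n => `|y - x|) [set t | r <= t]); last exact: closed_ge.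
by move=> y _; exact: continuous_dist.
Qed.

Lemma open_pbx (x : 'rV[R]_n) : open [set y | pb y /\ y != x].
Proof. exact: (@openI _ pb [set y | y != x] opb (@open_neq_rV R n x)). Qed.

(** Three regions. Near the origin $|\psi|\le C|y|^s$, which the weighted integrability of [f]
    absorbs. Near [x], [f] is bounded, [phi] is locally integrable and the Taylor polynomial is
    bounded. Elsewhere [psi] is bounded and $|y|\ge\rho$, so $|f|\le\rho^{-s}F$. *)
Lemma psi_f_L1 (x : 'rV[R]_n) : pb x ->
  L1 (fun y => if `[< pb y /\ y != x >] then psi x y * f y else 0).
Proof.
move=> px; have [x1 x0] := px.
have cpsi := CC_psi 0 s c x mn.
have [C [C0 [rho rho0 [_ HC]]]] := taylor_pointwise (@open_neq_rV R n x)
  (ltac:(by rewrite /= eq_sym) : [set y : 'rV[R]_n | y != x] 0) (CC_psi s s c x mn) (Van_psi s c mn x0).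
have [e e0 He] : exists2 e : R, 0 < e & forall y : 'rV[R]_n, `|y - x| <= e -> pb y.
  have /nbhs_ballP[e /= e0 He] : nbhs x pb by exact: open_nbhs_nbhs.
  exists (e / 2); first by rewrite divr_gt0.
  move=> y yx; apply: He; rewrite mx_norm_ball /ball_ /= distrC; lra.
have [M M0 HM] : exists2 M : R, 0 <= M & forall y, `|y - x| <= e -> `|f y| <= M.
  apply: (bounded_compact (L := e + `|x|) (@closed_box x e)) => y /= ye.
    by rewrite -[y](subrK x); apply: le_trans (ler_normD _ _) _; rewrite lerD2r.
  exact: (CC_cont cf (He y ye)).
(* The Taylor polynomial in [y], recovered as a difference; unlike [psi] it has no singularity at
   [x]. *)
pose P y := phi (x - y) - psi x y.
have [K K0 HK] : exists2 K : R, 0 <= K & forall y : 'rV[R]_n, enorm y <= 1 -> `|P y| <= K.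
  apply: (bounded_compact (L := 1) (@closed_enorm_le R n 1)) => y /= y1.
    exact: le_trans (norm_le_enorm y) y1.
  have oT := @openT 'rV[R]_n.
  have : CC 0 setT P; last by move=> h; exact: (CC_cont h Logic.I).
  apply: (CC_ext oT (f := fun y => \sum_(beta : {ffun 'I_n -> 'I_s} | (mabs (fun i => nat_of_ord (beta i)) < s)%N)
     mono_fact (fun i => nat_of_ord (beta i)) y *
     Dmulti (fun i => nat_of_ord (beta i)) (fundsol m n c) x)).
    by move=> z _; rewrite /P /psi /psi_kernel opprB addrC subrK.
  by apply: CC_sum => // b; apply: CC_mul => //; [exact: CC_mono|exact: CC_cst].
have [C' C'0 HC'] : exists2 C' : R, 0 <= C' & forall y : 'rV[R]_n,
    [/\ enorm y <= 1, rho <= `|y| & e <= `|y - x|] -> `|psi x y| <= C'.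
  have cl : closed [set y : 'rV[R]_n | [/\ enorm y <= 1, rho <= `|y| & e <= `|y - x|]].
    rewrite (_ : [set y | _] = [set y : 'rV[R]_n | enorm y <= 1] `&`
      ([set y : 'rV[R]_n | rho <= `|y - 0|] `&` [set y : 'rV[R]_n | e <= `|y - x|])).
      apply: closedI; first exact: closed_enorm_le.
      apply: closedI; exact: closed_boxC.
    by apply/seteqP; split => y /=; rewrite subr0; [case=> a b d; split|case=> a [b d]; split].
  apply: (bounded_compact (L := 1) cl) => y /= [y1 _ ye].
    exact: le_trans (norm_le_enorm y) y1.
  apply: (CC_cont cpsi) => /=; apply/eqP => yx; move: ye; rewrite yx subrr normr0; lra.
pose g y := M * boxi e (y - x).
have g0 y : 0 <= g y by rewrite mulr_ge0 ?boxi_ge0.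
have ig : L1 g by apply: L1Z; exact: (L1_translate (- x) (@L1_boxi R n e (ltW e0))).
have igphi : L1 (fun y => phi (x - y) * g y).
  apply: (@L1_phi_bounded R m n c m0 mn x g M (e + `|x|)) => //.
  - by rewrite ltr_pwDl.
  - exact: L1_meas.
  - move=> y; rewrite ger0_norm// /g ler_piMr// /boxi; by case: ifP.
  - move=> y h; rewrite /g boxi_out ?mulr0//.
    have : `|y| <= `|y - x| + `|x| by rewrite -{1}[y](subrK x); exact: ler_normD.
    lra.
pose D y := (C + C' * (rho ^+ s)^-1) * F y + (`|phi (x - y) * g y| + K * g y).
have F0 y : 0 <= F y by rewrite /F; case: ifP => // _; rewrite mulr_ge0// exprn_ge0// enorm_ge0.
have CC'0 : 0 <= C' * (rho ^+ s)^-1 by rewrite mulr_ge0// invr_ge0 exprn_ge0// ltW.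
have iD : L1 D.
  by apply: L1D; [exact: L1Z|apply: L1D; [exact: L1_abs|exact: L1Z]].
apply: (L1_le _ iD).
  apply: meas_if_open; first exact: open_pbx.
  move=> y [py yx]; apply: (@continuousM R _ (psi x) f y); first exact: (CC_cont cpsi).
  exact: (CC_cont cf).
move=> y; case: asboolP => [[py yx]|_]; last first.
  by rewrite normr0 /D addr_ge0// ?mulr_ge0// addr_ge0// mulr_ge0.
have FE : F y = enorm y ^+ s * `|f y| by rewrite /F; case: asboolP.
have [y1 _] := py; rewrite normrM /D.
have t1 : 0 <= C * F y by rewrite mulr_ge0.
have t2 : 0 <= C' * (rho ^+ s)^-1 * F y by rewrite mulr_ge0.
have t3 : 0 <= `|phi (x - y) * g y| by [].
have t4 : 0 <= K * g y by rewrite mulr_ge0.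
have [yr|yr] := ltP `|y| rho.
  have : `|psi x y| * `|f y| <= C * F y.
    rewrite FE mulrA ler_wpM2r//; apply: le_trans (HC y yr) _.
    by rewrite ler_wpM2l// lerXn2r ?nnegrE ?enorm_ge0//; exact: norm_le_enorm.
  rewrite mulrDl; lra.
have [ye|ye] := leP `|y - x| e.
  have gE : g y = M by rewrite /g boxi_in ?mulr1.
  have : `|psi x y| <= `|phi (x - y)| + K.
    have -> : psi x y = phi (x - y) - P y by rewrite /P opprB addrC subrK.
    by apply: le_trans (ler_normB _ _) _; rewrite lerD2l; apply: HK; exact: ltW.
  move=> h; have : `|psi x y| * `|f y| <= (`|phi (x - y)| + K) * M.
    by apply: ler_pM => //; exact: HM.
  rewrite normrM gE (ger0_norm M0) mulrDl mulrDl; lra.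
have : `|psi x y| * `|f y| <= C' * (rho ^+ s)^-1 * F y.
  rewrite FE -mulrA; apply: ler_pM => //; first by apply: HC'; split=> //; exact: ltW.
  rewrite mulrA ler_peMl// ler_pdivlMl ?exprn_gt0// mulr1.
  rewrite lerXn2r ?nnegrE ?enorm_ge0 ?(ltW rho0)//; exact: le_trans yr (norm_le_enorm y).
rewrite mulrDl; lra.
Qed.

End Newton.

(** * Splitting the source term *)


Section Kernel.
Variables (R : realType) (n : nat) (r : R) (w : 'rV[R]_n -> R).
Hypothesis iw : L1 w.
Hypothesis w_out : forall y, ~ shell r 1 y -> w y = 0.

(* The kernel is only evaluated away from its singularity. *)
Lemma L1_kernel (k : 'rV[R]_n -> R) (x : 'rV[R]_n) : CC 0 (@punct R n) k -> enorm x < r ->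
  L1 (fun y => k (x - y) * w y).
Proof.
move=> ck xr.
have sx y : shell r 1 y -> y != x by case=> ry _; apply/eqP => yx; move: ry; rewrite yx leNgt xr.
have ckx : CC 0 [set y | y != x] (fun y => k (x - y)).
  have o := @open_neq_rV R n x.
  have : CC 0 [set y | y != x] (fun y => k (-1 *: y + x)).
    apply: (CC_affine o ck) => y /= yx.
    by rewrite /punct /= scaleN1r addrC subr_eq0 eq_sym.
  by apply: CC_ext => // y _; rewrite scaleN1r addrC.
have [M M0 HM] := bounded_compact (@closed_shell R n r 1) (@shell_bd R n _ _)
  (fun y hy => CC_cont ckx (sx y hy)).
apply: (L1_ext (g := fun y => (if `[< [set y | y != x] y >] then k (x - y) else 0) * w y)).
  move=> y; case: asboolP => //= /negP; rewrite negbK => /eqP ->.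
  by rewrite w_out ?mulr0// => -[h _]; move: h; rewrite leNgt xr.
apply: (L1_le _ (L1Z M (L1_abs iw))).
  apply: measM; last exact: L1_meas iw.
  by apply: meas_if_open; [exact: open_neq_rV|exact: (CC_cont ckx)].
move=> y; rewrite normrM; have [hy|ny] := pselect (shell r 1 y); last first.
  by rewrite w_out// normr0 !mulr0.
by rewrite ler_wpM2r//; case: asboolP => _; rewrite ?normr0//; exact: HM.
Qed.

End Kernel.

(** * Inner and outer cutoffs of the solution *)

Section Decomposition.
Variables (R : realType) (m n s : nat) (c : R) (u : 'rV[R]_n -> R).
Hypotheses (m0 : (0 < m)%N) (mn : (2 * m <= n)%N) (hc : normalizing_const m n c).
Let pb := @pball1 R n.
Let opb := @open_pball R n.
Hypothesis hu : CC (2 * m) pb u.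
Let f := plm m u.
Let F y := if `[< pb y >] then enorm y ^+ s * `|f y| else 0.
Hypothesis hf : L1 F.
Let phi := fundsol m n c.

Lemma CC_plm_u : CC 0 pb f.
Proof. by apply: CC_plm => //; rewrite addn0. Qed.

Definition xi (d : R) : 'rV[R]_n -> R := cutoff d (2 * d).
Definition ud (d : R) (y : 'rV[R]_n) : R := u y * (1 - xi d y).
(** A commutator defined as a difference, so that the product rule for $(-\Delta)^m$ need not be
    expanded: it vanishes wherever [ud d] is locally [u] or 0. *)
Definition Cd (d : R) (y : 'rV[R]_n) : R :=
  if `[< pb y >] then plm m (ud d) y - f y * (1 - xi d y) else 0.
Definition fd (d : R) (y : 'rV[R]_n) : R :=
  (if `[< pb y >] then f y else 0) * (1 - xi d y).
Definition eta (r : R) : 'rV[R]_n -> R := cutoff r ((1 + r) / 2).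
(** Beyond radius [(1 + r) / 2] this is [- f]: it compensates [fd], which keeps [f] up to the unit
    sphere so as to be independent of [r]. *)
Definition Or (r : R) (y : 'rV[R]_n) : R :=
  if `[< pb y /\ r <= enorm y >] then plm m (fun z => u z * eta r z) y - f y else 0.

Lemma CC_xiC k d (O : set 'rV[R]_n) : CC k O (fun y => 1 - xi d y).
Proof. by apply: CC_sub (CC_cutC n k _ _). Qed.

Lemma xi_in d (y : 'rV[R]_n) : 0 < d -> enorm y <= d -> xi d y = 1.
Proof. by move=> d0 yd; apply: cut_in => //; lra. Qed.

Lemma xi_out d (y : 'rV[R]_n) : 0 < d -> 2 * d <= enorm y -> xi d y = 0.
Proof. by move=> d0 yd; apply: cut_out => //; lra. Qed.

Lemma xiC_abs d (y : 'rV[R]_n) : `|1 - xi d y| <= 1.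
Proof. exact: cutC_abs. Qed.

Lemma ud_zero d (y : 'rV[R]_n) : 0 < d -> enorm y <= d -> ud d y = 0.
Proof. by move=> d0 yd; rewrite /ud xi_in// subrr mulr0. Qed.

Lemma ud_u d (y : 'rV[R]_n) : 0 < d -> 2 * d <= enorm y -> ud d y = u y.
Proof. by move=> d0 yd; rewrite /ud xi_out// subr0 mulr1. Qed.

Lemma CC_ud_pb d : CC (2 * m) pb (ud d).
Proof. by apply: CC_mul => //; exact: CC_xiC. Qed.

Lemma CC_ud d : 0 < d -> CC (2 * m) (@ball1 R n) (ud d).
Proof.
move=> d0; have o := @open_enorm_lt R n d.
have h : CC (2 * m) [set y : 'rV[R]_n | enorm y < d] (ud d).
  by apply: CC_ext (CC_cst _ 0 o) => // y yd; rewrite ud_zero// ltW.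
apply: CC_sub (open_bigU opb o (CC_ud_pb d) h) => y y1.
have [->|y0] := eqVneq y 0; last by left.
by right; rewrite /= enormE qf0 sqrtr0.
Qed.

Lemma CdE d y : pb y -> Cd d y = plm m (ud d) y - f y * (1 - xi d y).
Proof. by move=> py; rewrite /Cd; case: asboolP. Qed.

Lemma Cd_lt d y : 0 < d -> enorm y < d -> Cd d y = 0.
Proof.
move=> d0 yd; rewrite /Cd; case: ifP => // _.
rewrite (plm_zero m (@open_enorm_lt R n d) _ yd); last by move=> z /ltW; exact: ud_zero.
by rewrite xi_in ?(ltW yd)// subrr mulr0 subrr.
Qed.

Lemma Cd_gt d y : 0 < d -> 2 * d < enorm y -> Cd d y = 0.
Proof.
move=> d0 yd; rewrite /Cd; case: ifP => // _.
rewrite (plm_eq m (@open_enorm_gt R n (2 * d)) yd (g := u)); last first.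
  by move=> z /= /ltW; exact: ud_u.
by rewrite xi_out ?(ltW yd)// subr0 mulr1 subrr.
Qed.

Lemma csupp_Cd d (O : set 'rV[R]_n) : 0 < d -> shell d (2 * d) `<=` O ->
  csupp O (shell d (2 * d)) (Cd d).
Proof.
move=> d0 sO; split=> //; first exact: closed_shell.
  by exists (2 * d) => y; exact: shell_bd.
move=> y ny; have [yd|yd] := ltP (enorm y) d; first exact: Cd_lt.
by apply: Cd_gt => //; rewrite ltNge; apply/negP => h; apply: ny.
Qed.

Lemma CC_Cd d : CC 0 pb (Cd d).
Proof.
apply: (CC_ext opb (f := fun y => plm m (ud d) y - f y * (1 - xi d y))).
  by move=> y py; rewrite CdE.
apply: CC_sub_fun => //; first by apply: CC_plm => //; rewrite addn0; exact: CC_ud_pb.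
by apply: CC_mul => //; [exact: CC_plm_u|exact: CC_xiC].
Qed.

Lemma F_ge0 y : 0 <= F y.
Proof. by rewrite /F; case: ifP => // _; rewrite mulr_ge0// exprn_ge0// enorm_ge0. Qed.

Lemma fd_le d y : 0 < d -> `|fd d y| <= (d ^+ s)^-1 * F y.
Proof.
move=> d0; rewrite /fd /F; case: asboolP => py; last by rewrite mul0r normr0 mulr0.
have [yd|yd] := leP (enorm y) d.
  rewrite xi_in// subrr mulr0 normr0 mulr_ge0// ?invr_ge0 ?exprn_ge0 ?(ltW d0)//.
  by rewrite mulr_ge0// exprn_ge0// enorm_ge0.
rewrite normrM; apply: (@le_trans _ _ (`|f y| * 1)).
  by rewrite ler_wpM2l// xiC_abs.
rewrite mulr1 mulrA ler_peMl// ler_pdivlMl ?exprn_gt0// mulr1.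
by rewrite lerXn2r ?nnegrE ?enorm_ge0 ?(ltW d0)// ltW.
Qed.

Lemma meas_fb : meas (fun y => if `[< pb y >] then f y else 0).
Proof. by apply: meas_if_open => // y py; exact: (CC_cont CC_plm_u). Qed.

Lemma meas_xiC d : meas (fun y => 1 - xi d y).
Proof.
by apply: meas_continuous => y; exact: (CC_cont (@CC_xiC 0 d setT) Logic.I).
Qed.

Lemma fd_L1 d : 0 < d -> L1 (fd d).
Proof.
move=> d0; apply: (L1_le _ (L1Z (d ^+ s)^-1 hf)); last by move=> y; exact: fd_le.
by apply: measM; [exact: meas_fb|exact: meas_xiC].
Qed.

Section Outer.
Variable r : R.
Hypotheses (r0 : 0 < r) (r1 : r < 1).

Let r2 : r < (1 + r) / 2. Proof. by move: r1 => p; lra. Qed.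
Let r3 : (1 + r) / 2 < 1. Proof. by move: r1 => p; lra. Qed.
Let r4 : 0 <= r. Proof. exact: ltW. Qed.

Lemma eta_in (y : 'rV[R]_n) : enorm y <= r -> eta r y = 1.
Proof. by move=> yr; exact: cut_in. Qed.

Lemma eta_out (y : 'rV[R]_n) : (1 + r) / 2 <= enorm y -> eta r y = 0.
Proof. by move=> yr; exact: cut_out. Qed.

Lemma CC_eta k (O : set 'rV[R]_n) : CC k O (eta r).
Proof. by apply: CC_sub (CC_cut n _ _ _). Qed.

Let ur z := u z * eta r z.

Let CC_ur : CC (2 * m) pb ur.
Proof. by apply: CC_mul => //; exact: CC_eta. Qed.

Let cpu : CC 0 pb (plm m ur).
Proof. by apply: CC_plm => //; rewrite addn0. Qed.

Lemma Or_out y : ~ shell r 1 y -> Or r y = 0.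
Proof.
move=> ny; rewrite /Or; case: asboolP => // -[[y1 _] yr]; exfalso; apply: ny.
by split=> //; exact: ltW.
Qed.

Lemma Or_L1 : L1 (Or r).
Proof.
have sb : shell r ((1 + r) / 2) `<=` pb by exact: shell_pb.
have [M M0 HM] := bounded_compact (@closed_shell R n r ((1 + r) / 2)) (@shell_bd R n _ _)
  (fun x hx => CC_cont cpu (sb x hx)).
have iD : L1 (fun y => M * boxi 1 y + (r ^+ s)^-1 * F y).
  by apply: L1D; [apply: L1Z; exact: L1_boxi|exact: L1Z].
apply: (L1_le _ iD).
  apply: meas_if_set; last exact: meas_cst.
    apply: (@measurableI _ (rVm R n) pb [set y | r <= enorm y]).
      exact: open_measurable_rV opb.
    exact: closed_measurable_rV (@closed_enorm_ge R n r).
  apply: (@measurable_funS _ _ (rVm R n) _ (pb : set (rVm R n))).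
  - exact: open_measurable_rV opb.
  - by move=> y [].
  apply: open_measurable_fun_rV opb _ => y py.
  by apply: (@continuousB R _ _ (plm m ur) f y); [exact: (CC_cont cpu)|exact: (CC_cont CC_plm_u)].
move=> y; rewrite /Or; case: asboolP => [[py yr]|_]; last first.
  by rewrite normr0 addr_ge0// ?mulr_ge0 ?boxi_ge0 ?F_ge0 ?invr_ge0 ?exprn_ge0 ?(ltW r0).
have [y1 _] := py.
apply: le_trans (ler_normB _ _) _; apply: lerD.
  rewrite boxi_in ?mulr1; last exact: le_trans (norm_le_enorm y) (ltW y1).
  have [h|h] := leP (enorm y) ((1 + r) / 2); first by apply: HM.
  rewrite (plm_zero m (@open_enorm_gt R n ((1 + r) / 2)) _ h) ?normr0//.
  by move=> z /ltW hz; rewrite eta_out// mulr0.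
rewrite /F; case: asboolP => // _.
rewrite mulrA ler_peMl// ler_pdivlMl ?exprn_gt0// mulr1.
by rewrite lerXn2r ?nnegrE ?enorm_ge0 ?(ltW r0).
Qed.

Section Inner.
Variable d : R.
Hypotheses (d0 : 0 < d) (dr : 2 * d < r).

Let v y := ud d y * eta r y.

(** As [2 * d < r], the two cutoffs vary on disjoint shells: near every point [v] coincides with
    [ud d], with [u * eta r], or with 0. *)
Lemma plm_v y : plm m v y = fd d y + Cd d y + Or r y.
Proof.
have [py|npy] := pselect (pb y); last first.
  have -> : fd d y = 0 by rewrite /fd; case: asboolP => // _; rewrite mul0r.
  have -> : Cd d y = 0 by rewrite /Cd; case: asboolP.
  have -> : Or r y = 0 by rewrite /Or; case: asboolP => // -[].
  rewrite !addr0; have [y1|y1] := leP 1 (enorm y).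
    have yr : (1 + r) / 2 < enorm y := lt_le_trans r3 y1.
    apply: (plm_zero m (@open_enorm_gt R n ((1 + r) / 2)) _ yr) => z /ltW hz.
    by rewrite /v eta_out// mulr0.
  have yd : enorm y < d.
    have [->|y0] := eqVneq y 0; first by rewrite enormE qf0 sqrtr0.
    by exfalso; apply: npy.
  by apply: (plm_zero m (@open_enorm_lt R n d) _ yd) => z /ltW hz; rewrite /v ud_zero// mul0r.
have fdE : fd d y = f y * (1 - xi d y) by rewrite /fd; case: asboolP.
have [yr|yr] := ltP (enorm y) r.
  have -> : Or r y = 0 by apply: Or_out => -[h _]; move: h; rewrite leNgt yr.
  rewrite addr0 fdE CdE// addrC subrK.
  apply: (plm_eq m (@open_enorm_lt R n r) yr) => z /ltW hz.
  exact: (etrans (congr1 (fun t => ud d z * t) (eta_in hz)) (mulr1 _)).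
have yd : 2 * d < enorm y := lt_le_trans dr yr.
rewrite Cd_gt// addr0 fdE xi_out ?(ltW yd)// subr0 mulr1.
have -> : Or r y = plm m ur y - f y by rewrite /Or; case: asboolP => // h; exfalso; apply: h.
rewrite addrC subrK.
by apply: (plm_eq m (@open_enorm_gt R n (2 * d)) yd) => z /= /ltW hz; rewrite /v ud_u.
Qed.

Lemma CC_v : CC (2 * m) setT v.
Proof.
have oB := @open_enorm_lt R n 1.
apply: (CC_glue oB (@closed_enorm_le R n ((1 + r) / 2))).
- by move=> y /= h; exact: le_lt_trans h r3.
- by apply: CC_mul => //; [exact: CC_ud|exact: CC_eta].
- by move=> y /= /negP; rewrite -ltNge => /ltW h; rewrite /v eta_out// mulr0.
Qed.

Let v_out (y : 'rV[R]_n) : 1 < `|y| -> v y = 0.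
Proof.
move=> y1; rewrite /v eta_out ?mulr0//.
by apply: ltW; apply: lt_le_trans r3 _; apply: le_trans (ltW y1) (norm_le_enorm y).
Qed.

Variable x : 'rV[R]_n.
Hypotheses (px : pb x) (xr : enorm x < r) (dx : 2 * d < enorm x).

Let Ox : set 'rV[R]_n := [set y | pb y /\ y != x].

Let shell_Ox : shell d (2 * d) `<=` Ox.
Proof.
move=> y hy; split; first exact: shell_pb d0 (lt_trans dr r1) _ hy.
by have [_ h] := hy; apply/eqP => yx; move: h; rewrite yx leNgt dx.
Qed.

Lemma L1_ker_Cd (k : 'rV[R]_n -> R) : CC 0 Ox k -> L1 (fun y => k y * Cd d y).
Proof.
move=> ck; apply: (csupp_L1 (@open_pbx R n x) (csupp_mulr k (csupp_Cd d0 shell_Ox))).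
apply: (CC_mul (@open_pbx R n x)) => //; apply: CC_sub (CC_Cd d) => y; by case.
Qed.

Lemma L1_phi_Cd : L1 (fun y => phi (x - y) * Cd d y).
Proof. by apply: L1_ker_Cd; apply: CC_sub (CC_fundsol_sub 0 c x mn) => y; case. Qed.

Lemma L1_phi_Or : L1 (fun y => phi (x - y) * Or r y).
Proof. exact: (L1_kernel Or_L1 Or_out (CC_phi c mn 0) xr). Qed.

(** Obtained by difference: by [plm_v], the product with the continuous compactly supported
    [plm m v] is integrable, and so are the two other parts. *)
Lemma L1_phi_fd : L1 (fun y => phi (x - y) * fd d y).
Proof.
have h := L1_phi_plm c m0 mn x ltr01 CC_v v_out.
apply: L1_ext (L1B h (L1D L1_phi_Cd L1_phi_Or)) => y.
by rewrite plm_v -/phi; move: (phi _) => p; ring.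
Qed.

Lemma rep_split : u x = Int (fun y => phi (x - y) * fd d y) +
  Int (fun y => phi (x - y) * Cd d y) + Int (fun y => phi (x - y) * Or r y).
Proof.
have := rep m0 mn hc x ltr01 CC_v v_out.
rewrite {2}/v ud_u ?(ltW dx)// eta_in ?(ltW xr)// mulr1 => <-.
rewrite -(IntD L1_phi_fd L1_phi_Cd) -(IntD (L1D L1_phi_fd L1_phi_Cd) L1_phi_Or).
by apply: eq_Int => y; rewrite plm_v !mulrDr.
Qed.

End Inner.
End Outer.
End Decomposition.


(** * Bounds for cutoffs of functions vanishing at the origin *)

Section ScaledBound.
Variables (R : realType) (m n : nat) (O : set 'rV[R]_n) (g : 'rV[R]_n -> R).
Hypotheses (oO : open O) (O0 : O 0) (cg : CC (2 * m) O g) (vg : Van (2 * m) g).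

Lemma CC_scaleV k (chi : 'rV[R]_n -> R) (d : R) : CC k setT chi ->
  CC k setT (fun y => chi (d^-1 *: y)).
Proof.
move=> h; have oT := @openT 'rV[R]_n.
apply: (CC_ext oT (f := fun y => chi (d^-1 *: y + 0))); first by move=> y _; rewrite addr0.
exact: (CC_affine oT h).
Qed.

(** After zooming in at scale [d], the derivatives of [g] are of order $d^{2m}$ and those of [chi]
    are bounded; undoing the scaling costs $d^{-2m}$, so the bound does not depend on [d]. *)
Lemma scaled_bound (chi : 'rV[R]_n -> R) : CC (2 * m) setT chi ->
  (forall z : 'rV[R]_n, 4 <= enorm z -> chi z = 0) ->
  exists2 K : R, 0 <= K & exists2 d1 : R, 0 < d1 & forall d : R, 0 < d -> d <= d1 ->
    forall y, `|plm m (fun y => g y * chi (d^-1 *: y)) y| <= K.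
Proof.
move=> cchi chi0.
have [C [C0 [r r0 [rO HB]]]] := taylor_scaled oO O0 cg vg.
have [B B0 HBc] := Bd_compact cchi (@closed_box R n 0 5)
  (fun x => (fun hx : `|x - 0| <= 5 => ltac:(by move: hx; rewrite subr0) : `|x| <= 5)) (@subsetT _ _).
(* The factor [n ^+ m] counts the terms of the iterated Laplacian, [2 ^+ (2 * m)] those of the
   product rule. *)
pose K : R := n%:R ^+ m * (2 ^+ (2 * m) * (C * B)).
have K0 : 0 <= K by rewrite !mulr_ge0// exprn_ge0.
exists K => //; exists r => // d d0 dr y.
pose W y := g y * chi (d^-1 *: y).
have oc := @open_cube R n 5.
have inO z : cube 5 z -> O (d *: z).
  by move=> hz; apply: rO; apply: (cubeZ (L := 5)) hz => //; rewrite mulrC mulKf.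
have CW : CC (2 * m) O W.
  by apply: CC_mul => //; apply: CC_sub (CC_scaleV d cchi).
have cgd : CC (2 * m) (@cube R n 5) (fun z => g (d *: z)).
  apply: (CC_ext oc (f := fun z => g (d *: z + 0))); first by move=> z _; rewrite addr0.
  by apply: (CC_affine oc cg) => z hz; rewrite addr0; exact: inO.
have [y5|y5] := ltP `|y| (5 * d); last first.
  have h4 : 4 * d < enorm y by apply: lt_le_trans (norm_le_enorm y); lra.
  rewrite (plm_zero m (@open_enorm_gt R n (4 * d)) _ h4) ?normr0// => z /= hz.
  rewrite chi0 ?mulr0// enormZ gtr0_norm ?invr_gt0// ler_pdivlMl// mulrC; exact: ltW.
pose z := d^-1 *: y.
have zc : @cube R n 5 z.
  by rewrite /cube /= mx_normZ normfV gtr0_norm// ltr_pdivrMl// mulrC.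
have yE : y = d *: z + 0 by rewrite addr0 scalerA divff ?scale1r// gt_eqF.
have cz : CC (2 * m) (@cube R n 5) chi by apply: CC_sub cchi.
have bz : Bd (2 * m) (@cube R n 5) chi B.
  by apply: Bd_sub HBc => w; rewrite /cube /= subr0; exact: ltW.
have := Bd_plm oc (CC_mul oc cgd cz) (Bd_mul oc _ B0 cgd cz (HB d d0 dr) bz) zc.
rewrite (plm_eq m oc zc (g := fun z => W (d *: z + 0))); last first.
  by move=> w _; rewrite /W addr0 scalerA mulVf ?scale1r// gt_eqF.
rewrite (plm_affine (O' := @cube R n 5) oO oc CW _ zc); last by move=> w hw; rewrite addr0; exact: inO.
rewrite -yE normrM => h.
have dm : 0 < d ^+ (2 * m) by rewrite exprn_gt0.
rewrite -(ler_pM2l dm); move: h; rewrite (gtr0_norm dm) => h.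
apply: le_trans (h _) _; first by rewrite mulr_ge0// ltW.
rewrite /K le_eqVlt; apply/orP; left; apply/eqP; ring.
Qed.

End ScaledBound.

(** * Passage to the limit in the inner cutoff *)

Section Limits.
Variables (R : realType) (m n s : nat) (c : R) (u : 'rV[R]_n -> R).
Hypotheses (m0 : (0 < m)%N) (mn : (2 * m <= n)%N) (hc : normalizing_const m n c).
Let pb := @pball1 R n.
Let opb := @open_pball R n.
Hypothesis hu : CC (2 * m) pb u.
Let f := plm m u.
Let F y := if `[< pb y >] then enorm y ^+ s * `|f y| else 0.
Hypothesis hf : L1 F.
Let phi := fundsol m n c.
Let A : set 'rV[R]_n := [set x | pb x /\ enorm x < 1 / 2].
Let uA x := if `[< A x >] then u x else 0.
Hypothesis iu : L1 uA.
Let mi k (b : {ffun 'I_n -> 'I_k}) i := nat_of_ord (b i).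

Let n0 : (0 < n)%N. Proof. by move: m0 mn; lia. Qed.

Lemma mono_bounded (b : 'I_n -> nat) : exists2 M : R, 0 <= M &
  forall y : 'rV[R]_n, enorm y <= 1 -> `|mono_fact b y| <= M.
Proof.
apply: (bounded_compact (L := 1) (@closed_enorm_le R n 1)) => y /= y1.
  exact: le_trans (norm_le_enorm y) y1.
exact: (CC_cont (CC_mono 0 b (@openT 'rV[R]_n)) Logic.I).
Qed.

Lemma meas_mono (b : 'I_n -> nat) : meas (@mono_fact R n b).
Proof.
by apply: meas_continuous => y; exact: (CC_cont (CC_mono 0 b (@openT 'rV[R]_n)) Logic.I).
Qed.

Lemma L1_mono_fd (d : R) (b : 'I_n -> nat) : 0 < d -> L1 (fun y => mono_fact b y * fd m u d y).
Proof.
move=> d0; have [M M0 HM] := mono_bounded b; have i := fd_L1 hu hf d0.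
apply: (L1_le _ (L1Z M (L1_abs i))).
  by apply: measM; [exact: meas_mono|exact: L1_meas].
move=> y; rewrite normrM; have [py|npy] := pselect (pb y).
  by rewrite ler_wpM2r// HM//; case: py => /ltW.
have -> : fd m u d y = 0 by rewrite /fd; case: asboolP => // _; rewrite mul0r.
by rewrite normr0 !mulr0.
Qed.

Lemma L1_mono_Cd (d : R) (b : 'I_n -> nat) : 0 < d -> 2 * d < 1 ->
  L1 (fun y => mono_fact b y * Cd m u d y).
Proof.
move=> d0 d1.
have sO : shell d (2 * d) `<=` pb by apply: shell_pb.
apply: (csupp_L1 opb (csupp_mulr _ (csupp_Cd m u d0 sO))).
by apply: (CC_mul opb); [exact: CC_mono|exact: CC_Cd].
Qed.

Lemma Int_phi_split k (x : 'rV[R]_n) (g : 'rV[R]_n -> R) : L1 (fun y => phi (x - y) * g y) ->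
  (forall b : {ffun 'I_n -> 'I_k}, L1 (fun y => mono_fact (mi b) y * g y)) ->
  Int (fun y => phi (x - y) * g y) = Int (fun y => psi_kernel m n k c x y * g y) +
    \sum_(b : {ffun 'I_n -> 'I_k} | (mabs (mi b) < k)%N)
       Int (fun y => mono_fact (mi b) y * g y) * Dmulti (mi b) phi x.
Proof.
move=> i ib.
pose G (b : {ffun 'I_n -> 'I_k}) y := Dmulti (mi b) phi x * (mono_fact (mi b) y * g y).
have iG b : L1 (G b) by exact: L1Z.
have iS := L1_sum (index_enum {ffun 'I_n -> 'I_k}) (fun b => (mabs (mi b) < k)%N) iG.
have E y : psi_kernel m n k c x y * g y = phi (x - y) * g y -
    \sum_(b : {ffun 'I_n -> 'I_k} | (mabs (mi b) < k)%N) G b y.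
  rewrite /psi_kernel mulrBl mulr_suml; congr (_ - _); apply: eq_bigr => b _.
  by rewrite /G mulrA [_ * mono_fact _ _]mulrC.
rewrite (eq_Int E) (IntB i iS) (Int_sum _ _ iG).
rewrite -addrA [X in _ + X](_ : _ = 0) ?addr0//.
apply/eqP; rewrite addrC subr_eq0; apply/eqP; apply: eq_bigr => b _.
by rewrite (IntZ _ (ib b)) mulrC.
Qed.

(* Neither [fd] nor [Cd] involves the outer radius [r], hence neither do these coefficients. *)
Definition moment_f k (d : R) (b : {ffun 'I_n -> 'I_k}) : R :=
  Int (fun y => mono_fact (mi b) y * fd m u d y).
Definition moment_C k (d : R) (b : {ffun 'I_n -> 'I_k}) : R :=
  Int (fun y => mono_fact (mi b) y * Cd m u d y).

Lemma rep_coef (r d : R) (x : 'rV[R]_n) : 0 < r -> r < 1 -> 0 < d -> enorm x < r -> 2 * d < enorm x ->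
  u x = Int (fun y => psi_kernel m n s c x y * fd m u d y) +
    \sum_(b : {ffun 'I_n -> 'I_s} | (mabs (mi b) < s)%N) moment_f d b * Dmulti (mi b) phi x +
    (Int (fun y => psi_kernel m n (2 * m) c x y * Cd m u d y) +
    \sum_(b : {ffun 'I_n -> 'I_(2 * m)} | (mabs (mi b) < 2 * m)%N)
      moment_C d b * Dmulti (mi b) phi x) +
    Int (fun y => phi (x - y) * Or m u r y).
Proof.
move=> r0 r1 d0 xr dx; have dr := lt_trans dx xr.
rewrite {1}(rep_split m0 mn hc hu hf r0 r1 d0 dr xr dx) -/phi.
rewrite (Int_phi_split (k := s) (L1_phi_fd c m0 mn hu hf r0 r1 d0 dr xr dx)).
  rewrite (Int_phi_split (k := 2 * m) (L1_phi_Cd c mn hu r1 d0 dr dx)) => [//|b].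
  by apply: L1_mono_Cd => //; exact: lt_trans r1.
by move=> b; exact: L1_mono_fd.
Qed.

Definition dj (j : nat) : R := 8^-1 * j.+1%:R^-1.

Lemma dj_gt0 j : 0 < dj j.
Proof. by rewrite mulr_gt0 ?invr_gt0. Qed.

Lemma near_dj (e : R) : 0 < e -> \forall j \near \oo, dj j < e.
Proof.
move=> e0; have : 0 < 8 * e by rewrite mulr_gt0.
move=> /near_small; apply: filterS => j; rewrite /dj; set t := j.+1%:R^-1 => h.
by lra.
Qed.

Lemma cvg_psi_fd (x : 'rV[R]_n) : pb x ->
  (fun j => Int (fun y => psi_kernel m n s c x y * fd m u (dj j) y)) @ \oo --> Npot m n s c f x.
Proof.
move=> px; have iH := psi_f_L1 c m0 mn (CC_plm_u hu) hf px.
rewrite /Npot Rint_Int//; set H := (fun y : 'rV[R]_n => _) in iH *.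
have mH j : meas (fun y => H y * (1 - xi (dj j) y)).
  by apply: measM; [exact: L1_meas|exact: meas_xiC].
have bH j y : `|H y * (1 - xi (dj j) y)| <= `|H y|.
  by rewrite normrM ler_piMr// xiC_abs.
rewrite (_ : (fun j => _) = (fun j => Int (fun y => H y * (1 - xi (dj j) y)))); last first.
  apply/funext => j; have iHj := L1_le (mH j) (L1_abs iH) (bH j).
  have E y : y != x -> psi_kernel m n s c x y * fd m u (dj j) y = H y * (1 - xi (dj j) y).
    move=> yx; rewrite /fd /H; case: asboolP => py; last first.
      by case: asboolP => [[]//|_]; rewrite !mul0r mulr0.
    by case: asboolP => [_|[]//]; rewrite mulrA.
  by have [_ ->] := Int_modify n0 iHj E.
apply: (Int_cvg mH (L1_abs iH) bH _).2 => y.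
have [->|y0] := eqVneq y 0.
  have -> : H 0 = 0 by rewrite /H; case: asboolP => // -[[_]]; rewrite eqxx.
  rewrite (_ : (fun j => _) = cst 0); first exact: cvg_cst.
  by apply/funext => j; rewrite mul0r.
apply: cvg_near_cst.
have e0 : 0 < enorm y / 2 by rewrite divr_gt0// enorm_gt0.
apply: filterS (near_dj e0) => j h; rewrite xi_out ?subr0 ?mulr1 ?dj_gt0//; lra.
Qed.

Section SmallPart.
Variable x : 'rV[R]_n.
Hypothesis px : pb x.
Let psi := psi_kernel m n (2 * m) c x.
(** Rescaled by [d], this equals 1 for $|y|\le 2d$, hence on the support of [Cd d]: there [psi] may
    be replaced by the compactly supported [T1 d]. *)
Let chi1 : 'rV[R]_n -> R := cutoff 2 4.
(** Moves the factor $1-\xi_d$ of the second part of [Cd] onto the test function. *)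
Let chi2 (z : 'rV[R]_n) := chi1 z * (1 - cutoff 1 2 z).

Let x0 : x != 0. Proof. by case: px. Qed.

Let CC_chi1 : CC (2 * m) setT chi1.
Proof. exact: CC_cut. Qed.

Let CC_chi2 : CC (2 * m) setT chi2.
Proof. by apply: CC_mul; [exact: openT|exact: CC_cut|exact: CC_cutC]. Qed.

Let chi1_out (z : 'rV[R]_n) : 4 <= enorm z -> chi1 z = 0.
Proof. by move=> h; apply: cut_out => //; lra. Qed.

Let chi2_out (z : 'rV[R]_n) : 4 <= enorm z -> chi2 z = 0.
Proof. by move=> h; rewrite /chi2 chi1_out// mul0r. Qed.

Let T1 (d : R) y := psi y * chi1 (d^-1 *: y).
Let T2 (d : R) y := psi y * chi2 (d^-1 *: y).

Let xiE (d : R) (y : 'rV[R]_n) : 0 < d -> xi d y = cutoff 1 2 (d^-1 *: y).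
Proof.
move=> d0; have dn : d != 0 by rewrite gt_eqF.
have E : d *: (d^-1 *: y) = y by rewrite scalerA (divff dn) scale1r.
by rewrite -(cutZ 1 2 (d^-1 *: y) d0) E /xi mulr1 (mulrC 2).
Qed.

Let T2E (d : R) y : 0 < d -> T2 d y = T1 d y * (1 - xi d y).
Proof. by move=> d0; rewrite xiE// /T2 /T1 /chi2 mulrA. Qed.

Let Cpsi : CC (2 * m) [set y | y != x] psi.
Proof. exact: CC_psi. Qed.

Let CT1 d : CC (2 * m) [set y | y != x] (T1 d).
Proof.
have o := @open_neq_rV R n x.
by apply: (CC_mul o Cpsi); exact: (CC_sub (@subsetT _ _) (CC_scaleV d CC_chi1)).
Qed.

Let CT2 d : CC (2 * m) [set y | y != x] (T2 d).
Proof.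
have o := @open_neq_rV R n x.
by apply: (CC_mul o Cpsi); exact: (CC_sub (@subsetT _ _) (CC_scaleV d CC_chi2)).
Qed.

Let T1_out (d : R) y : 0 < d -> 4 * d <= enorm y -> T1 d y = 0.
Proof.
move=> d0 h; rewrite /T1 chi1_out ?mulr0//.
by rewrite enormZ gtr0_norm ?invr_gt0// ler_pdivlMl// mulrC.
Qed.

Let T2_out (d : R) y : 0 < d -> 4 * d <= enorm y -> T2 d y = 0.
Proof. by move=> d0 h; rewrite T2E// T1_out// mul0r. Qed.

Let T2_in (d : R) y : 0 < d -> enorm y <= d -> T2 d y = 0.
Proof. by move=> d0 h; rewrite T2E// xi_in// subrr mulr0. Qed.

Let T1_mid (d : R) y : 0 < d -> enorm y <= 2 * d -> T1 d y = psi y.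
Proof.
move=> d0 h; have h2 : enorm (d^-1 *: y) <= 2.
  by rewrite enormZ gtr0_norm ?invr_gt0// ler_pdivrMl// mulrC.
have h24 : 2 < 4 :> R by lra.
by rewrite /T1 /chi1 (cut_in _ h24 h2) ?mulr1.
Qed.

Section FixD.
Variable d : R.
Hypotheses (d0 : 0 < d) (dx : 4 * d < enorm x) (d2 : 4 * d < 1 / 2).

Let O1 : set 'rV[R]_n := [set y | enorm y < enorm x].
Let O2 : set 'rV[R]_n := pb `&` O1.
Let x1 : enorm x < 1. Proof. by case: px. Qed.
Let oO1 : open O1. Proof. exact: open_enorm_lt. Qed.
Let oO2 : open O2. Proof. exact: openI. Qed.

Let O1x : O1 `<=` [set y | y != x].
Proof. by move=> y h /=; apply/eqP => yx; move: h; rewrite /O1 /= yx ltxx. Qed.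

Let O1b : O1 `<=` @ball1 R n.
Proof. by move=> y h; exact: lt_trans x1. Qed.

Let cs1 : csupp O1 [set y | enorm y <= 4 * d] (T1 d).
Proof.
split; first exact: closed_enorm_le.
- by move=> y /= h; exact: le_lt_trans dx.
- by exists (4 * d) => y /=; exact: le_trans (norm_le_enorm y).
- by move=> y /= /negP; rewrite -ltNge => /ltW; exact: T1_out.
Qed.

Let cs2 : csupp O2 (shell d (4 * d)) (T2 d).
Proof.
split; first exact: closed_shell.
- move=> y hy; split; last by case: hy => _ h; exact: le_lt_trans dx.
  by apply: shell_pb hy => //; exact: lt_trans dx x1.
- by exists (4 * d) => y; exact: shell_bd.
- move=> y ny; have [yd|yd] := leP (enorm y) d; first exact: T2_in.
  apply: T2_out => //; rewrite leNgt; apply/negP => h; apply: ny; split; exact: ltW.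
Qed.

Let cu1 : CC (2 * m) O1 (ud u d).
Proof. by apply: CC_sub (CC_ud hu d0). Qed.

Let cu2 : CC (2 * m) O2 u.
Proof. by apply: CC_sub hu => y []. Qed.

Let ct1 : CC (2 * m) O1 (T1 d).
Proof. exact: CC_sub O1x (CT1 d). Qed.

Let ct2 : CC (2 * m) O2 (T2 d).
Proof. by apply: CC_sub (CT2 d) => y [_ /O1x]. Qed.

Let C0plm (O : set 'rV[R]_n) g : open O -> CC (2 * m) O g -> CC 0 O (plm m g).
Proof. by move=> oO h; apply: CC_plm => //; rewrite addn0. Qed.

Let C0 (O : set 'rV[R]_n) g : CC (2 * m) O g -> CC 0 O g.
Proof. exact: CC_leq. Qed.

Let j1 : L1 (fun y => ud u d y * plm m (T1 d) y).
Proof.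
apply: (csupp_L1 oO1 (csupp_mulr _ (csupp_plm m cs1))).
by apply: (CC_mul oO1); [exact: C0|exact: C0plm].
Qed.

Let j2 : L1 (fun y => u y * plm m (T2 d) y).
Proof.
apply: (csupp_L1 oO2 (csupp_mulr _ (csupp_plm m cs2))).
by apply: (CC_mul oO2); [exact: C0|exact: C0plm].
Qed.

Let j3 : L1 (fun y => plm m (ud u d) y * T1 d y).
Proof.
apply: (csupp_L1 oO1 (csupp_mulr _ cs1)).
by apply: (CC_mul oO1); [exact: C0plm|exact: C0].
Qed.

Let j4 : L1 (fun y => plm m u y * T2 d y).
Proof.
apply: (csupp_L1 oO2 (csupp_mulr _ cs2)).
by apply: (CC_mul oO2); [exact: C0plm|exact: C0].
Qed.

(** The two parts of [Cd] are integrated by parts on different domains. In the first, [ud d] is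
    smooth across the origin, so the ball $|y|<|x|$ serves; in the second, [u] is singular at the
    origin but [T2 d] vanishes there, so the punctured domain serves. Both avoid the singularity of
    [psi] at [x]. *)
Lemma psi_Cd_ibp : Int (fun y => psi y * Cd m u d y) =
  Int (fun y => ud u d y * plm m (T1 d) y) - Int (fun y => u y * plm m (T2 d) y).
Proof.
rewrite (ibp_plm oO1 cs1 cu1 ct1) (ibp_plm oO2 cs2 cu2 ct2) -(IntB j3 j4).
apply: eq_Int => y; have [py|npy] := pselect (pb y).
  have -> : psi y * Cd m u d y = T1 d y * Cd m u d y.
    have [y2|y2] := leP (enorm y) (2 * d); first by rewrite T1_mid.
    by rewrite Cd_gt// !mulr0.
  by rewrite CdE// T2E//; move: (T1 d y) (xi d y) => t z; ring.
have -> : Cd m u d y = 0 by rewrite /Cd; case: asboolP.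
rewrite mulr0; have [y1|y1] := leP 1 (enorm y).
  have h : 4 * d <= enorm y by move: d2 => h; lra.
  by rewrite T1_out// T2_out// !mulr0 subrr.
have y0 : enorm y < d.
  have [->|y0] := eqVneq y 0; first by rewrite enormE qf0 sqrtr0.
  by exfalso; apply: npy.
rewrite (plm_zero m (@open_enorm_lt R n d) _ y0); last by move=> z /ltW; exact: ud_zero.
by rewrite T2_in ?(ltW y0)// mul0r mulr0 subrr.
Qed.

Let U y := `|uA y| * (if `[< [set y : 'rV[R]_n | enorm y <= 4 * d] y >] then 1 else 0).

Lemma meas_ball_ind (e : R) :
  meas (fun y => if `[< [set y : 'rV[R]_n | enorm y <= e] y >] then 1 else 0 : R).
Proof.
apply: meas_if_set; [|exact: measurable_cst|exact: meas_cst].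
exact: closed_measurable_rV (@closed_enorm_le R n e).
Qed.

Lemma L1_uA_ind (e : R) :
  L1 (fun y => `|uA y| * (if `[< [set y : 'rV[R]_n | enorm y <= e] y >] then 1 else 0)).
Proof.
apply: (L1_le _ (L1_abs iu)).
  by apply: measM; [exact: meas_abs (L1_meas iu)|exact: meas_ball_ind].
by move=> y; case: ifP => _; rewrite ?mulr1 ?mulr0 ?normr0// normr_id.
Qed.

Let UE y : y != 0 -> enorm y <= 4 * d -> U y = `|u y|.
Proof.
move=> y0 h; have h1 : enorm y < 1 / 2 by exact: le_lt_trans d2.
rewrite /U /uA; case: asboolP => [_|[]]; last first.
  by split=> //; split=> //; apply: lt_trans h1 _; lra.
by case: asboolP => // _; rewrite mulr1.
Qed.

Lemma psi_Cd_bound (K : R) : 0 <= K ->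
  (forall y, `|plm m (T1 d) y| <= K) -> (forall y, `|plm m (T2 d) y| <= K) ->
  `|Int (fun y => psi y * Cd m u d y)| <= 2 * K * Int U.
Proof.
move=> K0 H1 H2; have iU : L1 U by exact: L1_uA_ind.
have U0 y : 0 <= K * U y by rewrite mulr_ge0// mulr_ge0//; case: ifP.
have bnd g : L1 g -> (forall y, `|g y| <= K * U y) -> `|Int g| <= K * Int U.
  move=> ig gU; apply: le_trans (Int_abs ig) _.
  by rewrite -(IntZ K iU); exact: Int_le (L1_abs ig) (L1Z K iU) gU.
rewrite psi_Cd_ibp (_ : 2 * K * Int U = K * Int U + K * Int U); last by ring.
apply: le_trans (ler_normB _ _) _; apply: lerD; apply: bnd => // y.
  have [y4|y4] := leP (enorm y) (4 * d); last first.
    have [_ _ _ ->] := csupp_plm m cs1; first by rewrite mulr0 normr0.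
    by move=> /=; rewrite leNgt y4.
  have [->|y0] := eqVneq y 0.
    by rewrite ud_zero ?mul0r ?normr0// enormE qf0 sqrtr0 ltW.
  rewrite UE// normrM mulrC; apply: ler_pM => //.
  by rewrite /ud normrM ler_piMr// xiC_abs.
have [hy|ny] := pselect (shell d (4 * d) y); last first.
  by have [_ _ _ ->] := csupp_plm m cs2 => //; rewrite mulr0 normr0.
have [yd y4] := hy; have y0 : y != 0 by rewrite -enorm_gt0; exact: lt_le_trans yd.
by rewrite UE// normrM mulrC ler_wpM2r.
Qed.

End FixD.

Lemma cvg_psi_Cd : (fun j => Int (fun y => psi y * Cd m u (dj j) y)) @ \oo --> 0.
Proof.
have o := @open_neq_rV R n x.
have O0 : [set y : 'rV[R]_n | y != x] 0 by rewrite /= eq_sym.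
have vp : Van (2 * m) psi by exact: Van_psi.
have [K1 K10 [e1 e10 H1]] := scaled_bound o O0 Cpsi vp CC_chi1 chi1_out.
have [K2 K20 [e2 e20 H2]] := scaled_bound o O0 Cpsi vp CC_chi2 chi2_out.
pose U (j : nat) y := `|uA y| *
  (if `[< [set y : 'rV[R]_n | enorm y <= 4 * dj j] y >] then 1 else 0).
have U0 j y : 0 <= U j y by rewrite mulr_ge0//; case: ifP.
have cU : (fun j => Int (U j)) @ \oo --> 0.
  rewrite -(Int0 R n); apply: (@Int_cvg R n U (fun=> 0) (fun y => `|uA y|) _ _ _ _).2.
  - by move=> j; exact: L1_meas (L1_uA_ind _).
  - exact: L1_abs.
  - by move=> j y; rewrite ger0_norm// ler_piMr//; case: ifP.
  move=> y; have [->|y0] := eqVneq y 0.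
    rewrite (_ : (fun j => _) = cst 0); first exact: cvg_cst.
    apply/funext => j; rewrite /U /uA; case: asboolP => [[[_]]|_]; first by rewrite eqxx.
    by rewrite normr0 mul0r.
  apply: cvg_near_cst.
  have e0 : 0 < enorm y / 4 by rewrite divr_gt0// enorm_gt0.
  apply: filterS (near_dj e0) => j h; rewrite /U; case: asboolP => [/= h'|_]; last by rewrite mulr0.
  by exfalso; lra.
apply: norm_cvg0; apply: (squeeze_cvgr _ (cvg_cst 0)); last first.
  rewrite -[X in _ --> X](mulr0 (2 * (K1 + K2))); apply: cvgMr; exact: cU.
have ex : 0 < enorm x / 4 by rewrite divr_gt0// enorm_gt0.
have e8 : 0 < 1 / 8 :> R by lra.
near=> j; rewrite normr_ge0 /=.
have d0 := dj_gt0 j.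
have h1 : dj j < e1 by near: j; exact: near_dj.
have h2 : dj j < e2 by near: j; exact: near_dj.
have h3 : dj j < enorm x / 4 by near: j; exact: near_dj.
have h4 : dj j < 1 / 8 by near: j; exact: near_dj.
apply: psi_Cd_bound => //; [lra|lra|exact: addr_ge0| |] => y.
  by apply: le_trans (H1 _ d0 (ltW h1) y) _; rewrite lerDl.
by apply: le_trans (H2 _ d0 (ltW h2) y) _; rewrite lerDr.
Unshelve. all: by end_near.
Qed.

End SmallPart.
End Limits.

(** * Convolution with a source away from the singularity *)


Section Convolution.
Variables (R : realType) (n : nat) (r : R) (w : 'rV[R]_n -> R).
Hypothesis iw : L1 w.
Hypothesis w_out : forall y, ~ shell r 1 y -> w y = 0.

Let op := @open_punct R n.
Let Br : set 'rV[R]_n := [set x | enorm x < r].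
Let oBr : open Br := @open_enorm_lt R n r.

Definition convol (k : 'rV[R]_n -> R) (x : 'rV[R]_n) : R := Int (fun y => k (x - y) * w y).

Definition smooth_off0 (k : 'rV[R]_n -> R) : Prop := forall l, CC l (@punct R n) k.

Lemma smooth_off0_pd k i : smooth_off0 k -> smooth_off0 (pd i k).
Proof. by move=> hk l; apply: CC_pd. Qed.

Lemma L1_conv k x : smooth_off0 k -> enorm x < r -> L1 (fun y => k (x - y) * w y).
Proof. by move=> hk xr; exact: (L1_kernel iw w_out (hk 0%N) xr). Qed.

(** The function $1/|y-x|$ is continuous on the compact shell, hence bounded, which keeps the
    distance away from 0. *)
Lemma dist_shell (x : 'rV[R]_n) : enorm x < r ->
  exists2 e : R, 0 < e & forall y, shell r 1 y -> 2 * e <= `|x - y|.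
Proof.
move=> xr.
have pos (y : 'rV[R]_n) : shell r 1 y -> 0 < `|y - x|.
  move=> [ry _]; rewrite normr_gt0 subr_eq0; apply/eqP => yx.
  by move: ry; rewrite yx leNgt xr.
have cV (y : 'rV[R]_n) : shell r 1 y -> {for y, continuous (fun y : 'rV[R]_n => `|y - x|^-1)}.
  move=> hy; apply: (@continuousV R _ (fun y : 'rV[R]_n => `|y - x|) y).
    exact: lt0r_neq0 (pos y hy).
  exact: continuous_dist.
have [M M0 HM] := bounded_compact (@closed_shell R n r 1) (@shell_bd R n _ _) cV.
have M1 : 0 < 2 * (M + 1) by rewrite mulr_gt0// ltr_wpDl.
exists (2 * (M + 1))^-1; first by rewrite invr_gt0.
move=> y hy; have p := pos y hy; rewrite distrC.
have := HM y hy; rewrite ger0_norm ?invr_ge0// => h.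
have -> : 2 * (2 * (M + 1))^-1 = (M + 1)^-1.
  by rewrite invfM mulrA divff ?mul1r.
rewrite -[leRHS]invrK lef_pV2 ?posrE ?invr_gt0//; last by rewrite ltr_wpDl.
by apply: le_trans h _; rewrite lerDl.
Qed.

(** Halving the distance to the shell leaves room to move [x]: all arguments met lie in an annulus
    [K] away from 0, where compactness bounds the derivatives up to order two. *)
Lemma kernel_local k x : smooth_off0 k -> enorm x < r ->
  exists2 e : R, 0 < e & exists2 M : R, 0 <= M &
  (forall z, `|z - x| < e -> enorm z < r) /\
  forall y, shell r 1 y -> forall z, `|z - (x - y)| <= e ->
    [/\ z != 0, forall i, `|pd i k z| <= M & forall i j, `|pd j (pd i k) z| <= M].
Proof.
move=> hk xr; have [e1 e10 H1] := dist_shell xr.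
have /nbhs_ballP[e2 /= e20 H2] : nbhs x Br by exact: open_nbhs_nbhs.
pose L : R := `|x| + 1 + e1.
pose K : set 'rV[R]_n := [set z | e1 <= `|z - 0|] `&` [set z | `|z - 0| <= L].
have cK : closed K by apply: closedI; [exact: closed_boxC|exact: closed_box].
have bK z : K z -> `|z| <= L by case=> _; rewrite /= subr0.
have Kp : K `<=` @punct R n.
  by move=> z [/= h _]; move: h; rewrite subr0 /punct /= -normr_gt0; exact: lt_le_trans.
have [M M0 HB] := Bd_compact (hk 2%N) cK bK Kp.
have Kz y : shell r 1 y -> forall z, `|z - (x - y)| <= e1 -> K z.
  move=> hy z hz; have h1 := H1 y hy; have h2 := shell_bd hy.
  have t1 : `|x - y| <= `|z| + `|z - (x - y)|.
    by have := ler_normB z (z - (x - y)); rewrite subKr.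
  have t2 : `|z| <= `|x - y| + `|z - (x - y)|.
    by rewrite -{1}[z](subrK (x - y)) addrC; exact: ler_normD.
  have t3 : `|x - y| <= `|x| + `|y| by exact: ler_normB.
  by split; rewrite /= subr0 /L; lra.
exists (Num.min e1 e2); first by rewrite lt_min e10.
exists M => //; split.
  move=> z; rewrite lt_min => /andP[_ hz]; apply: H2.
  by rewrite mx_norm_ball /ball_ /= distrC.
move=> y hy z; rewrite le_min => /andP[hz _]; have kz := Kz y hy z hz.
have [_ B1] := HB.
split; first exact: Kp.
  by move=> i; exact: ((B1 i).1 z kz).
by move=> i j; exact: (((B1 i).2 j).1 z kz).
Qed.

Let W := Int (fun y => `|w y|).

Let Int_wbound g (C : R) : 0 <= C -> L1 (fun y => g y * w y) ->
  (forall y, shell r 1 y -> `|g y| <= C) -> `|Int (fun y => g y * w y)| <= C * W.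
Proof.
move=> C0 ig gC; apply: le_trans (Int_abs ig) _; rewrite -(IntZ C (L1_abs iw)).
apply: (Int_le (L1_abs ig) (L1Z C (L1_abs iw))) => y; rewrite normrM.
have [hy|ny] := pselect (shell r 1 y); first by rewrite ler_wpM2r// gC.
by rewrite w_out// normr0 !mulr0.
Qed.

Let W0 : 0 <= W.
Proof. by apply: Int_ge0. Qed.

Lemma conv_continuous k x : smooth_off0 k -> enorm x < r -> {for x, continuous (convol k)}.
Proof.
move=> hk xr; have [e e0 [M M0 [He H]]] := kernel_local hk xr.
apply/continuous_rVP => eps eps0.
pose C : R := n%:R * M * W + 1.
have C0 : 0 < C by rewrite ltr_wpDl// !mulr_ge0.
exists (Num.min e (eps / C)); first by rewrite lt_min e0 divr_gt0.
move=> z; rewrite lt_min distrC => /andP[h1 h2].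
have zr := He z h1.
have nM : 0 <= n%:R * M * `|z - x| by rewrite !mulr_ge0.
rewrite distrC /convol -(IntB (L1_conv hk zr) (L1_conv hk xr)).
have iD : L1 (fun y => (k (z - y) - k (x - y)) * w y).
  by apply: L1_ext (L1B (L1_conv hk zr) (L1_conv hk xr)) => y; rewrite mulrBl.
rewrite (eq_Int (h := fun y => (k (z - y) - k (x - y)) * w y)); last by move=> y; rewrite mulrBl.
apply: le_lt_trans (Int_wbound nM iD _) _.
  move=> y hy; rewrite (_ : z - y = (z - x) + (x - y)); last by rewrite addrA subrK.
  apply: (mv_ineq (hk 1%N)) => v hv; have := H y hy v (le_trans hv (ltW h1)).
  by case.
rewrite mulrAC; apply: (@le_lt_trans _ _ (C * `|z - x|)).
  by rewrite ler_wpM2r// /C lerDl.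
by rewrite mulrC -ltr_pdivlMr.
Qed.

(** The difference quotient of the kernel differs from its derivative by at most [n M |h|]: the mean
    value theorem rewrites it as a derivative at a nearby point, and the bound on second derivatives
    compares the two. The error is thus uniform over the shell. *)
Lemma conv_derive k x i : smooth_off0 k -> enorm x < r ->
  is_derive x (evec R i) (convol k) (convol (pd i k) x).
Proof.
move=> hk xr; have [e e0 [M M0 [He H]]] := kernel_local hk xr.
pose C : R := n%:R * M * W + 1.
have C0 : 0 < C by rewrite ltr_wpDl// !mulr_ge0.
have L : (fun h : R => h^-1 *: ((convol k \o shift x) (h *: evec R i) - convol k x)) @ 0^' --> convol (pd i k) x.
  apply/cvgrPdist_le => eps eps0.
  have ec : 0 < eps / C by rewrite divr_gt0.
  near=> h.
  have hn0 : h != 0 by near: h; exact: nbhs_dnbhs_neq.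
  have he : `|h| < e by near: h; exact: dnbhs0_lt.
  have hc : `|h| < eps / C by near: h; exact: dnbhs0_lt.
  have zr : enorm (h *: evec R i + x) < r.
    by apply: He; rewrite addrK; exact: le_lt_trans (evecZ_norm i h) he.
  have i1 := L1_conv hk zr; have i0 := L1_conv hk xr.
  have ip := L1_conv (smooth_off0_pd i hk) xr.
  pose g y := h^-1 * (k (h *: evec R i + x - y) - k (x - y)) - pd i k (x - y).
  have E y : g y * w y = h^-1 * (k (h *: evec R i + x - y) * w y - k (x - y) * w y) -
      pd i k (x - y) * w y by rewrite /g; ring.
  have iz := L1Z h^-1 (L1B i1 i0).
  have ig : L1 (fun y => g y * w y) by apply: L1_ext (L1B iz ip) => y; rewrite E.
  have nM : 0 <= n%:R * M * `|h| by rewrite !mulr_ge0.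
  rewrite distrC (_ : _ - _ = Int (fun y => g y * w y)); last first.
    by rewrite (eq_Int E) (IntB iz ip) (IntZ _ (L1B i1 i0)) (IntB i1 i0).
  apply: le_trans (Int_wbound nM ig _) _; last first.
    rewrite mulrAC; apply: (@le_trans _ _ (C * `|h|)).
      by rewrite ler_wpM2r// /C lerDl.
    by rewrite mulrC -ler_pdivlMr// ltW.
  move=> y hy.
  have near_ (t : R) : 0 <= t <= 1 -> `|(t * h) *: evec R i| <= `|h|.
    move=> /andP[t0 t1]; apply: le_trans (evecZ_norm i _) _.
    by rewrite normrM ger0_norm// ler_piMl.
  have [|t t01 Et] := @line_mvt R n i k (x - y) h.
    move=> t t01; apply: (@CC_derivable _ _ _ _ _ (hk 1%N)).
    by have [] := H y hy ((t * h) *: evec R i + (x - y)); rewrite // addrK (le_trans (near_ t t01))// ltW.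
  rewrite /g -[h *: _ + x - y]addrA Et mulrA mulVf// mul1r.
  apply: (@le_trans _ _ (n%:R * M * `|(t * h) *: evec R i|)).
    apply: (mv_ineq (CC_pd i (hk 2%N))) => v hv.
    have [] := H y hy v; first by apply: le_trans hv _; apply: le_trans (near_ t t01) (ltW he).
    by move=> v0 _ h2; split.
  by rewrite ler_wpM2l ?mulr_ge0// near_.
by apply: DeriveDef; [exact: cvgP L|exact: cvg_lim L].
Unshelve. all: by end_near.
Qed.

Lemma CC_conv l k : smooth_off0 k -> CC l Br (convol k).
Proof.
elim: l k => [|l IH] k hk; first by split=> // x; exact: conv_continuous.
apply: (CC_intro (dg := fun i => convol (pd i k)) oBr).
- by move=> x; exact: conv_continuous.
- by move=> x i; exact: conv_derive.
- by move=> i; apply: IH; exact: smooth_off0_pd.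
Qed.

Lemma pd_conv k i x : smooth_off0 k -> Br x -> pd i (convol k) x = convol (pd i k) x.
Proof. by move=> hk xr; apply: pdP; exact: conv_derive. Qed.

Lemma smooth_off0_mlap k : smooth_off0 k -> smooth_off0 (mlap k).
Proof. by move=> hk l; apply: CC_mlap. Qed.

Lemma mlap_conv k x : smooth_off0 k -> Br x -> mlap (convol k) x = convol (mlap k) x.
Proof.
move=> hk xr; rewrite mlapE.
have E i : pd i (pd i (convol k)) x = convol (pd i (pd i k)) x.
  rewrite (pd_open i oBr (fun y (hy : Br y) => pd_conv i hk hy))//.
  by apply: pd_conv => //; exact: smooth_off0_pd.
rewrite (eq_bigr _ (fun i _ => E i)) /convol.
have ii i : L1 (fun y => pd i (pd i k) (x - y) * w y).
  by apply: L1_conv => //; do 2 apply: smooth_off0_pd.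
rewrite -(Int_sum _ _ ii) -IntN; last exact: L1_sum.
by apply: eq_Int => y; rewrite mlapE -mulr_suml mulNr.
Qed.

Lemma plm_conv m k x : smooth_off0 k -> Br x -> plm m (convol k) x = convol (plm m k) x.
Proof.
elim: m k x => [|m IH] k x hk xr; first by rewrite !plm0.
rewrite !plmSr (plm_eq m oBr xr (fun y (hy : Br y) => mlap_conv hk hy)).
by apply: IH => //; exact: smooth_off0_mlap.
Qed.

Lemma plm_conv_phi m (c : R) x : (0 < m)%N -> (2 * m <= n)%N -> enorm x < r ->
  plm m (convol (fundsol m n c)) x = 0.
Proof.
move=> m0 mn xr; rewrite plm_conv//; last by move=> l; exact: CC_phi.
rewrite /convol (eq_Int (h := fun=> 0)) ?Int0// => y.
have [[ry _]|ny] := pselect (shell r 1 y); last by rewrite w_out// mulr0.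
rewrite plm_phi ?mul0r// subr_eq0; apply/eqP => xy.
by move: ry; rewrite -xy leNgt xr.
Qed.

End Convolution.

(** * The representation of u *)


Section Representation.
Variables (R : realType) (m n s : nat) (c : R) (u : 'rV[R]_n -> R).
Hypotheses (m0 : (0 < m)%N) (mn : (2 * m <= n)%N) (hc : normalizing_const m n c).
Hypothesis sm : (s <= 2 * m)%N.
Let pb := @pball1 R n.
Let opb := @open_pball R n.
Hypothesis hu : CC (2 * m) pb u.
Hypothesis hf : L1 (fun y => if `[< pb y >] then enorm y ^+ s * `|plm m u y| else 0).
Hypothesis hup : L1 (fun x => if `[< pb x >] then Num.max (u x) 0 else 0).
Let phi := fundsol m n c.
Let mi k (b : {ffun 'I_n -> 'I_k}) (i : 'I_n) := nat_of_ord (b i).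
Let IX := {ffun 'I_n -> 'I_(2 * m)}.

(** Brings the two Taylor sums, of orders [s] and [2 m], to a common index type. The coefficients
    are chosen before [G], hence serve all points [x] at once; they are sums over the fibres of the
    embedding. *)
Lemma widen_multi k (a : {ffun 'I_n -> 'I_s} -> R) : (s <= k)%N ->
  exists a' : {ffun 'I_n -> 'I_k} -> R, forall G : ('I_n -> nat) -> R,
    \sum_(b : {ffun 'I_n -> 'I_s} | (mabs (mi b) < s)%N) a b * G (mi b) =
    \sum_(b : {ffun 'I_n -> 'I_k} | (mabs (mi b) < k)%N) a' b * G (mi b).
Proof.
move=> sk.
pose emb (b : {ffun 'I_n -> 'I_s}) : {ffun 'I_n -> 'I_k} := [ffun i => widen_ord sk (b i)].
have embE b : mi (emb b) = mi b by apply/funext => i; rewrite /mi ffunE.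
exists (fun b' => \sum_(b | (mabs (mi b) < s)%N && (emb b == b')) a b) => G.
rewrite (partition_big emb (fun b' => (mabs (mi b') < k)%N)) /=; last first.
  by move=> b h; rewrite embE; exact: leq_trans h sk.
apply: eq_bigr => b' _; rewrite mulr_suml; apply: eq_bigr => b /andP[_ /eqP <-].
by rewrite embE.
Qed.

Lemma representation : exists (a : IX -> R) (h : 'rV[R]_n -> R),
  (forall l, CC l (@ball1 R n) h) /\
  (forall x, ball1 n x -> plm m h x = 0) /\
  (forall x, pb x -> u x = Npot m n s c (plm m u) x + h x +
     \sum_(b : IX | (mabs (mi b) < 2 * m)%N) a b * Dmulti (mi b) phi x).
Proof.
have iu := u_L1 m0 mn sm hu hf hup.
have /choice[a' Ha'] := fun j => widen_multi (moment_f m u (dj R j)) sm.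
pose A (j : nat) (b : IX) := a' j b + moment_C m u (dj R j) b.
pose D (b : IX) x := Dmulti (mi b) phi x.
pose P (b : IX) := (mabs (mi b) < 2 * m)%N.
pose N := Npot m n s c (plm m u).
pose H r := convol (Or m u r) phi.
have lim (r : R) x : 0 < r -> r < 1 -> pb x -> enorm x < r ->
    (fun j => \sum_(b | P b) A j b * D b x) @ \oo --> u x - N x - H r x.
  move=> r0 r1 px xr; have [_ x0] := px.
  have M1 := cvg_psi_fd (c := c) m0 mn hu hf px.
  have M2 := cvg_psi_Cd c mn hu iu px.
  have L : (fun j => u x - Int (fun y => psi_kernel m n s c x y * fd m u (dj R j) y) -
      Int (fun y => psi_kernel m n (2 * m) c x y * Cd m u (dj R j) y) - H r x) @ \oo --> u x - N x - H r x.
    rewrite -[X in X - H r x](subr0 (u x - N x)).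
    apply: cvgB; last exact: cvg_cst.
    by apply: cvgB => //; apply: cvgB => //; exact: cvg_cst.
  apply: cvg_trans L; apply: near_eq_cvg.
  have e0 : 0 < enorm x / 2 by rewrite divr_gt0// enorm_gt0.
  apply: filterS (near_dj e0) => j h.
  have h2 : 2 * dj R j < enorm x by lra.
  have := rep_coef m0 mn hc hu hf r0 r1 (dj_gt0 R j) xr h2.
  rewrite (Ha' j (fun b => Dmulti b phi x)) => E.
  have -> : \sum_(b | P b) A j b * D b x = \sum_(b | P b) a' j b * D b x +
      \sum_(b | P b) moment_C m u (dj R j) b * D b x.
    by rewrite -big_split; apply: eq_bigr => b _; rewrite /A mulrDl.
  move: E; rewrite /H /convol /D /P.
  move: (Int _) (Int _) (Int _) (\sum_(b | _) _) (\sum_(b | _) _) => t1 t2 t3 t4 t5 E.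
  by rewrite [u x]E; ring.
(* A radius strictly between $|x|$ and 1. *)
pose rr x : R := (1 + @enorm R n x) / 2.
have rr0 x : 0 < rr x by rewrite divr_gt0// ltr_pwDl// enorm_ge0.
have rrx x : enorm x < 1 -> enorm x < rr x by rewrite /rr => h; lra.
have rr1 x : enorm x < 1 -> rr x < 1 by rewrite /rr => h; lra.
pose q := [seq b <- index_enum IX | P b].
have uq : uniq q by rewrite filter_uniq// index_enum_uniq.
(* The outer radius may vary with [x] here because the coefficients [A j] do not involve it. *)
have [|a Ha] := @span_limit R _ pb IX q uq D A (fun x => u x - N x - H (rr x) x).
  move=> x px; have [x1 _] := px.
  have := lim (rr x) x (rr0 x) (rr1 x x1) px (rrx x x1).
  by under eq_fun do rewrite -big_filter.
pose S x := \sum_(b | P b) a b * D b x.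
(* The approximating sums do not contain [r], so by uniqueness of limits [H r x] is the same for
   every [r] above $|x|$. *)
have HS (r : R) x : 0 < r -> r < 1 -> pb x -> enorm x < r -> u x - N x - S x = H r x.
  move=> r0 r1 px xr; have [x1 _] := px.
  have E := cvgn_unique (lim r x r0 r1 px xr) (lim (rr x) x (rr0 x) (rr1 x x1) px (rrx x x1)).
  have := Ha x px; rewrite -E big_filter -/(S x) => <-.
  by rewrite subKr.
have half0 : 0 < 1 / 2 :> R by lra.
have half1 : 1 / 2 < 1 :> R by lra.
(* At the origin [u] and [phi] say nothing, so the value is taken from the convolution, which is
   smooth there. *)
pose h (x : 'rV[R]_n) := if x == 0 then H (1 / 2) 0 else u x - N x - S x.
have hS (r : R) x : 0 < r -> r < 1 -> x != 0 -> enorm x < r -> h x = H r x.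
  move=> r0 r1 x0 xr; rewrite /h (negbTE x0); apply: HS => //; split=> //.
  exact: lt_trans r1.
have h0 x : enorm x < 1 / 2 -> h x = H (1 / 2) x.
  by move=> xr; have [->|x0] := eqVneq x 0; [rewrite /h eqxx|exact: hS].
have sphi : smooth_off0 phi by move=> l; exact: CC_phi.
have CH (r : R) l : 0 < r -> r < 1 -> CC l [set x : 'rV[R]_n | enorm x < r] (H r).
  move=> r0 r1; exact: (CC_conv (Or_L1 hu hf r0 r1) (@Or_out R m n u r) l sphi).
have PH (r : R) x : 0 < r -> r < 1 -> enorm x < r -> plm m (H r) x = 0.
  move=> r0 r1; exact: (plm_conv_phi (Or_L1 hu hf r0 r1) (@Or_out R m n u r) c m0 mn).
(* Near every point of the ball, [h] is one of the convolutions [H r]: with [r = 1 / 2] around the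
   origin, and with [r = rr x] on a set avoiding the origin elsewhere. *)
have loc x : ball1 n x -> exists2 r : R, 0 < r < 1 &
    exists2 V : set 'rV[R]_n, open V /\ V x & V `<=` [set x | enorm x < r] /\
      forall y, V y -> H r y = h y.
  move=> x1; have [->|x0] := eqVneq x 0.
    exists (1 / 2); first by rewrite half0.
    exists [set x | enorm x < 1 / 2]; last by split=> // y hy; rewrite h0.
    by split; [exact: open_enorm_lt|rewrite /= enormE qf0 sqrtr0].
  exists (rr x); first by rewrite rr0 rr1.
  exists ([set z | enorm z < rr x] `&` @punct R n).
    split; last by split=> //; exact: rrx.
    by apply: openI; [exact: open_enorm_lt|exact: open_punct].
  by split=> [y []//|y [yr y0]]; rewrite (hS (rr x))// rr1.
exists a, h; split; [|split].
- move=> l; apply: CC_local => x x1; have [r /andP[r0 r1] [V [oV Vx] [sV E]]] := loc x x1.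
  by exists V => //; apply: (CC_ext oV E); exact: CC_sub sV (CH r l r0 r1).
- move=> x x1; have [r /andP[r0 r1] [V [oV Vx] [sV E]]] := loc x x1.
  by rewrite -(plm_eq m oV Vx E) PH//; exact: sV.
- move=> x [x1 x0]; rewrite /h (negbTE x0) -/N -/(S x).
  by ring.
Qed.

End Representation.

Theorem theorem1p4 (R : realType) (m n s : nat) (c : R)
    (u f : 'rV[R]_n -> R) :
  (0 < m)%N -> (0 < n)%N -> (2 * m <= n)%N ->
  normalizing_const m n c ->
  Ck (2 * m) (pball1 n) u ->
  (forall x, pball1 n x -> mlapm n m u x = f x) ->
  (s <= 2 * m - 1)%N ->
  (iint (fun x => (if `[< pball1 n x >] then enorm x ^+ s * `|f x| else 0)%:E)
     < +oo)%E ->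
  (iint (fun x => (if `[< pball1 n x >] then Num.max (u x) 0 else 0)%:E)
     < +oo)%E ->
  exists (a : {ffun 'I_n -> 'I_(2 * m)} -> R) (h : 'rV[R]_n -> R),
    Cinf (ball1 n) h /\
    (forall x, ball1 n x -> mlapm n m h x = 0) /\
    (forall x, pball1 n x ->
       u x = Npot m n s c f x + h x +
             \sum_(beta : {ffun 'I_n -> 'I_(2 * m)} |
                     (mabs (fun i => nat_of_ord (beta i)) < 2 * m)%N)
                a beta * Dmulti (fun i => nat_of_ord (beta i)) (fundsol m n c) x).
Proof.
move=> m0 n0 mn hc /CC_Ck hu fE sm hf hup.
have fE' x : pball1 n x -> plm m u x = f x by rewrite plmE; exact: fE.
have opb := @open_pball R n.
(* Source of the measurability of the integrand in [f]: on the punctured ball [f] is $(-\Delta)^m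
   u$, hence continuous. *)
have cf : CC 0 (pball1 n) (plm m u) by exact: CC_plm_u.
have sm' : (s <= 2 * m)%N by apply: leq_trans sm _; exact: leq_subr.
have L1f : L1 (fun x => if `[< pball1 n x >] then enorm x ^+ s * `|plm m u x| else 0).
  apply: iint_L1.
  - apply: meas_if_open => // x px.
    apply: (@continuousM R _ (fun x => enorm x ^+ s) (fun x => `|plm m u x|) x).
      apply: (@continuous_comp _ _ _ (@enorm R n) (fun t => t ^+ s) x); first exact: continuous_enorm.
      exact: exprn_continuous.
    apply: (@continuous_comp _ _ _ (plm m u) (fun t => `|t|) x); first exact: (CC_cont cf).
    exact: norm_continuous.
  - by move=> x; case: ifP => // _; rewrite mulr_ge0// exprn_ge0// enorm_ge0.
  - move: hf; congr (_ < _)%E; congr iint; apply/funext => x.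
    by case: asboolP => // px; rewrite fE'.
have L1u : L1 (fun x => if `[< pball1 n x >] then Num.max (u x) 0 else 0).
  apply: iint_L1 => //.
  - apply: meas_if_open => // x px.
    apply: (@continuous_max R _ u (fun=> 0) x); last exact: cst_continuous.
    exact: (CC_cont hu).
  - by move=> x; case: ifP => // _; rewrite le_max lexx orbT.
have [a [h [ch [ph E]]]] := representation m0 mn hc sm' hu L1f L1u.
exists a, h; split; [|split].
- by move=> k; apply/CC_Ck; exact: ch.
- by move=> x hx; rewrite -plmE; exact: ph.
- move=> x px; rewrite {1}(E x px); congr (_ + _ + _).
  (* The integrand of [Npot] sees [f] only on the punctured ball, where it equals [plm m u]. *)
  rewrite /Npot; congr Defs.Rint; apply/funext => y.
  by case: asboolP => // -[py _]; rewrite fE'.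
Qed.
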